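(* Let $k,A,M,\triangledown,E,K$ be as in the context and let $(\hat X,\hat b,\hat d,\hat B)$, $(\hat{\mathfrak X},\hat{\mathfrak b},\hat{\mathfrak d},\hat{\mathfrak B})$, $\hat\theta$ and $\hat\vartheta$ be the objects and maps defined there. Then: (1) $(\hat X,\hat b,\hat d,\hat B)$ is a double mixed complex. (2) Let $(\breve X,\breve b)$ be the total complex of $(\hat X,\hat b,\hat d)$ and $(\breve{\mathfrak X},\breve{\mathfrak b})$ the total complex of $(\hat{\mathfrak X},\hat{\mathfrak b},\hat{\mathfrak d})$. The maps $\hat\vartheta\colon(\hat X,\hat b,\hat d,\hat B)\to(\hat{\mathfrak X},\hat{\mathfrak b},\hat{\mathfrak d},\hat{\mathfrak B})$ and $\hat\theta\colon(\hat{\mathfrak X},\hat{\mathfrak b},\hat{\mathfrak d},\hat{\mathfrak B})\to(\hat X,\hat b,\hat d,\hat B)$ are morphisms of double mixed complexes such that $\hat\theta\circ\hat\vartheta=\mathrm{id}$. Moreover $\breve\vartheta\circ\breve\theta$ is homotopic to the identity map, where $\breve\vartheta\colon(\breve X,\breve b)\to(\breve{\mathfrak X},\breve{\mathfrak b})$ and $\breve\theta\colon(\breve{\mathfrak X},\breve{\mathfrak b})\to(\breve X,\breve b)$ are the morphisms induced by $\hat\vartheta$ and $\hat\theta$, respectively. (3) The Hochschild, cyclic, periodic and negative homologies of $(\hat X,\hat b,\hat d,\hat B)$ are the Hochschild, cyclic, periodic and negative homologies of the $K$-algebra $E$ relative to $M$, respectively.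
   Context: **Setting.** $k$ is a commutative ring with $\mathbb Q\subseteq k$; $A$ is an associative unital $k$-algebra; $M$ is an $A$-bimodule with an associative $A$-bimodule map $\triangledown\colon M\otimes_A M\to M$; $E=A\ltimes_\triangledown M$ is $A\times M$ with product $(a,m)(a',m')=(aa',am'+ma'+m\triangledown m')$; $K$ is a $k$-subalgebra of $A$. $\otimes$ means $\otimes_K$; $\overline A=A/K$, $\overline E=E/K=\overline A\oplus M$. For a $K$-bimodule $V$, $V\otimes:=V/[V,K]$, where $[V,K]$ is the $k$-submodule spanned by all $v\lambda-\lambda v$. For $0\le w\le n$, $B^n_w\subseteq\overline E^{\otimes n}$ is the $k$-submodule spanned by simple tensors with exactly $w$ factors in $M$ and the others in $\overline A$; $B^0_0=K$, and $B^n_w=0$ if $w<0$ or $w>n$. Always $n=v+w$. For $v,w\ge0$, $X_{vw}:=M\otimes B^n_w\otimes$; $X_{vw}:=0$ otherwise. **Maps.** All maps are given on (classes of) simple tensors $x_0\otimes\cdots\otimes x_n$ with each $x_i\in A\cup M$ (elements of $A$ in positions $\ge1$ taken modulo $K$), and extended linearly. For $x,y\in A\cup M$, $xy$ is the product in $A$ if both are in $A$, the bimodule action if exactly one is in $M$, and $0$ if both are in $M$; $x\triangledown y$ is as given if both are in $M$ and $0$ otherwise. For $0\le j<n$, $\mu_j(x_0\otimes\cdots\otimes x_n)=(-1)^jx_0\otimes\cdots\otimes x_jx_{j+1}\otimes\cdots\otimes x_n$, $\varrho_j(x_0\otimes\cdots\otimes x_n)=(-1)^jx_0\otimes\cdots\otimes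 (x_j\triangledown x_{j+1})\otimes\cdots\otimes x_n$; $\mu_n(x_0\otimes\cdots\otimes x_n)=(-1)^nx_nx_0\otimes x_1\otimes\cdots\otimes x_{n-1}$, $\varrho_n(x_0\otimes\cdots\otimes x_n)=(-1)^n(x_n\triangledown x_0)\otimes x_1\otimes\cdots\otimes x_{n-1}$. With $\pi_A,\pi_M$ the projections of $E=A\oplus M$, $\mu_0^A,\mu_n^A$ (resp. $\mu_0^M,\mu_n^M$) are $\mu_0,\mu_n$ with $\pi_A$ (resp. $\pi_M$) applied to the product $x_0x_1$, $x_nx_0$. Let $i(x_0\otimes\cdots\otimes x_n)$ be the last index $i$ with $x_i\in M$, and $t(x_0\otimes\cdots\otimes x_n)=(-1)^{in}x_i\otimes\cdots\otimes x_n\otimes x_0\otimes\cdots\otimes x_{i-1}$ for this $i$ (used also when $x_0\in A$). On $X_{vw}$: $b=\sum_{j=0}^n\mu_j$, $d'=\sum_{j=0}^{n-1}\varrho_j$, $d=d'+\varrho_n$, $N=\sum_{l=0}^wt^l$. **The two diagrams** ($v,w\ge0$). $\hat X_{vw}=X_{vw}\oplus X_{v-1,w}$, $\hat b(\mathbf x,\mathbf y)=(b(\mathbf x)+(\mathrm{id}-t)(\mathbf y),-b(\mathbf y))\in\hat X_{v-1,w}$, $\hat d(\mathbf x,\mathbf y)=(d(\mathbf x),-d'(\mathbf y))\in\hat X_{v,w-1}$, $\hat B(\mathbf x,\mathbf y)=(0,N(\mathbf x))\in\hat X_{v+1,w}$. $\hat{\mathfrak X}_{vw}=(M\otimes B^n_w\otimes)\oplus(A\otimes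 B^n_{w+1}\otimes)$, $\hat{\mathfrak b}(\mathbf x,\mathbf y)=(\mathfrak b^0(\mathbf x)+\alpha(\mathbf y),\mathfrak b^1(\mathbf y))$ with $\mathfrak b^0=\sum_{j=0}^n\mu_j$, $\mathfrak b^1=\mu_0^A+\sum_{j=1}^{n-1}\mu_j+\mu_n^A$, $\alpha=\mu_0^M+\mu_n^M$; $\hat{\mathfrak d}(\mathbf x,\mathbf y)=\sum_{j=0}^n(\varrho_j(\mathbf x),\varrho_j(\mathbf y))$; $\hat{\mathfrak B}(\mathbf x,\mathbf y)=(0,B(\mathbf x)+B(\mathbf y))\in\hat{\mathfrak X}_{v+1,w}$, where $B(x_0\otimes\cdots\otimes x_n)=\sum_{i=0}^n(-1)^{in}1\otimes x_i\otimes\cdots\otimes x_n\otimes x_0\otimes\cdots\otimes x_{i-1}$. This is a double mixed complex whose total mixed complex is the relative mixed complex defined below. $\hat\theta\colon\hat{\mathfrak X}_{vw}\to\hat X_{vw}$, $\hat\theta(\mathbf x,\mathbf y)=(\mathbf x+t(\mathbf y),\mu^M_0(\mathbf y))$. $\hat\vartheta\colon\hat X_{vw}\to\hat{\mathfrak X}_{vw}$, $\hat\vartheta(\mathbf x,\mathbf y)=\bigl(\mathbf x,\sum_{l=0}^{n-1-i(\mathbf y)}1\otimes\mathfrak t^l(\mathbf y)\bigr)$ for $\mathbf y=y_0\otimes\cdots\otimes y_{n-1}$, where $\mathfrak t(y_0\otimes\cdots\otimes y_{n-1})=(-1)^{n-1}y_{n-1}\otimes y_0\otimes\cdots\otimes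 y_{n-2}$. **Double mixed complexes and homologies.** A double mixed complex $(X,b,\beta,B)$ is a bigraded $k$-module with $b$ lowering the first index by 1, $\beta$ lowering the second index by 1, and $B$ raising one of the indices by 1, each fixing the other index, with $b^2=\beta^2=B^2=\beta b+b\beta=\beta B+B\beta=bB+Bb=0$; morphisms are bidegree-preserving maps commuting with the three maps. Its total mixed complex is $(\mathrm{Tot}(X),b+\beta,B)$. For a mixed complex $(X,b,B)$: $\mathrm{HH}$ is the homology of $(X,b)$, and $\mathrm{HC},\mathrm{HN},\mathrm{HP}$ are the homologies of the complexes which in degree $n$ are $\bigoplus_{j\ge0}X_{n-2j}$, $\prod_{j\ge0}X_{n+2j}$, $\prod_{j\in\mathbb Z}X_{n+2j}$, with differential $b+B$ (for $\mathrm{HC}$, $B$ is zero on the $j=0$ summand). The homologies of a double mixed complex are those of its total mixed complex. The homologies $\mathrm{HH}^K_*(E,M)$, $\mathrm{HC}^K_*(E,M)$, $\mathrm{HP}^K_*(E,M)$, $\mathrm{HN}^K_*(E,M)$ of the $K$-algebra $E$ relative to $M$ are those of the kernel of the canonical map of normalized mixed complexes $(E\otimes\overline E^{\otimes *}\otimes,b,B)\to(A\otimes\overline A^{\otimes *}\otimes,b,B)$ ($b$ the Hochschild boundary, $B$ the Connes operator given by $B(c_0\otimes\cdots\otimes c_n)=\sum_{i=0}^n(-1)^{in}1\otimes c_i\otimes\cdots\otimes c_n\otimes c_0\otimes\cdots\otimes c_{i-1}$). *)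

(* Defs.v *)
From HB Require Import structures.
From mathcomp Require Import all_boot all_order all_algebra.
From mathcomp Require Import ring_quotient boolp.
From mathcomp Require Import freeg.

Set Implicit Arguments.
Unset Strict Implicit.
Unset Printing Implicit Defensive.

Import GRing.Theory.
Local Open Scope ring_scope.
Local Open Scope quotient_scope.
Import Quotient.Exports.

Section Modules.
Variable k : pzRingType.

Definition spanl (V : lmodType k) (S : V -> Prop) : {pred V} := fun x =>
  `[< exists s : seq (k * V),
        (forall p, p \in s -> S p.2) /\ x = \sum_(p <- s) p.1 *: p.2 >].

Lemma spanl_submod (V : lmodType k) (S : V -> Prop) : GRing.submod_closed (spanl S).
Proof.
split; first by apply/asboolP; exists [::]; rewrite big_nil; split.
move=> a u v /asboolP[s [hs ->]] /asboolP[s' [hs' ->]]; apply/asboolP.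
exists ([seq (a * p.1, p.2) | p <- s] ++ s'); split.
  by move=> p; rewrite mem_cat => /orP[/mapP[q qs ->] /=|]; [exact: hs|exact: hs'].
rewrite big_cat big_map scaler_sumr; congr (_ + _).
by apply: eq_bigr => p _; rewrite scalerA.
Qed.

HB.instance Definition _ (V : lmodType k) (S : V -> Prop) :=
  GRing.isSubmodClosed.Build k V (spanl S) (spanl_submod S).

Definition kerl (V W : lmodType k) (f : {linear V -> W}) : {pred V} :=
  fun x => f x == 0.

Lemma kerl_submod (V W : lmodType k) (f : {linear V -> W}) :
  GRing.submod_closed (kerl f).
Proof.
split; first by rewrite /kerl unfold_in raddf0.
by move=> a u v; rewrite !unfold_in linearP => /eqP-> /eqP->; rewrite scaler0 addr0.
Qed.

HB.instance Definition _ (V W : lmodType k) (f : {linear V -> W}) :=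
  GRing.isSubmodClosed.Build k V (kerl f) (kerl_submod f).

Definition iml (V W : lmodType k) (f : {linear V -> W}) : {pred W} :=
  fun y => `[< exists x, y = f x >].

Lemma iml_submod (V W : lmodType k) (f : {linear V -> W}) :
  GRing.submod_closed (iml f).
Proof.
split; first by apply/asboolP; exists 0; rewrite raddf0.
move=> a u v /asboolP[x ->] /asboolP[y ->]; apply/asboolP.
by exists (a *: x + y); rewrite linearP.
Qed.

HB.instance Definition _ (V W : lmodType k) (f : {linear V -> W}) :=
  GRing.isSubmodClosed.Build k W (iml f) (iml_submod f).

Record sub (V : lmodType k) (S : submodClosed V) : Type :=
  Sub { sub_val : V; _ : sub_val \in S }.

HB.instance Definition _ V S := [isSub for @sub_val V S].
HB.instance Definition _ V S := [Choice of @sub V S by <:].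
HB.instance Definition _ V S := [SubChoice_isSubLmodule of @sub V S by <:].

Definition preim_sub (V : lmodType k) (S T : submodClosed V) : {pred sub S} :=
  fun x => val x \in T.

Lemma preim_sub_submod (V : lmodType k) (S T : submodClosed V) :
  GRing.submod_closed (@preim_sub V S T).
Proof.
split; first by rewrite unfold_in /preim_sub raddf0 rpred0.
move=> a u v hu hv; have: a *: val u + val v \in T.
  by apply: rpredD => //; apply: rpredZ.
by rewrite -linearP.
Qed.

HB.instance Definition _ (V : lmodType k) (S T : submodClosed V) :=
  GRing.isSubmodClosed.Build k (sub S) (@preim_sub V S T) (@preim_sub_submod V S T).

Section QuotLmod.
Variables (V : lmodType k) (S : submodClosed V).

Lemma submod_zmod_closed : GRing.zmod_closed S.
Proof.
split=> [|u v hu hv]; first exact: rpred0.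
by apply: rpredD => //; rewrite -scaleN1r; apply: rpredZ.
Qed.

Definition submod_zmod : zmodClosed V :=
  HB.pack (GRing.SubmodClosed.sort S) (GRing.isZmodClosed.Build V (GRing.SubmodClosed.sort S) submod_zmod_closed).

Definition quotm : Type := Quotient.quot submod_zmod.
HB.instance Definition _ := GRing.Zmodule.on quotm.

Definition cls (x : V) : quotm := \pi_(Quotient.quot submod_zmod) x.

Definition qscale (a : k) (x : quotm) : quotm :=
  cls (a *: repr (x : Quotient.quot submod_zmod)).

Lemma cls_reprK (x : quotm) : cls (repr (x : Quotient.quot submod_zmod)) = x.
Proof. exact: reprK. Qed.

Lemma clsD x y : cls (x + y) = cls x + cls y.
Proof. exact: raddfD. Qed.

Lemma clsE x y : (cls x == cls y) = (x - y \in S).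
Proof. by rewrite -(Quotient.idealrBE submod_zmod). Qed.

Lemma qscale_cls a x : qscale a (cls x) = cls (a *: x).
Proof.
apply/eqP; rewrite /qscale clsE -scalerBr; apply: rpredZ.
by rewrite -clsE cls_reprK.
Qed.

Lemma qscaleA a b x : qscale a (qscale b x) = qscale (a * b) x.
Proof. by rewrite -[x]cls_reprK !qscale_cls scalerA. Qed.
Lemma qscale1 : left_id 1 qscale.
Proof. by move=> x; rewrite -[x]cls_reprK qscale_cls scale1r. Qed.
Lemma qscaleDr : right_distributive qscale +%R.
Proof.
move=> a x y; rewrite -[x]cls_reprK -[y]cls_reprK.
by rewrite -clsD !qscale_cls -clsD scalerDr.
Qed.
Lemma qscaleDl x : {morph qscale^~ x : a b / a + b}.
Proof. by move=> a b; rewrite -[x]cls_reprK !qscale_cls scalerDl clsD. Qed.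

HB.instance Definition _ :=
  GRing.Zmodule_isLmodule.Build k quotm qscaleA qscale1 qscaleDr qscaleDl.

End QuotLmod.

Section Product.
Variables (I : Type) (X : I -> lmodType k).

Definition prodm : Type := forall i, X i.
HB.instance Definition _ := gen_eqMixin prodm.
HB.instance Definition _ := gen_choiceMixin prodm.

Implicit Types f g h : prodm.
Definition prodm_zero : prodm := fun=> 0.
Definition prodm_opp f : prodm := fun i => - f i.
Definition prodm_add f g : prodm := fun i => f i + g i.
Definition prodm_scale (a : k) f : prodm := fun i => a *: f i.

Fact prodm_addA : associative prodm_add.
Proof. by move=> f g h; apply: functional_extensionality_dep => i; exact: addrA. Qed.
Fact prodm_addC : commutative prodm_add.
Proof. by move=> f g; apply: functional_extensionality_dep => i; exact: addrC. Qed.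
Fact prodm_add0 : left_id prodm_zero prodm_add.
Proof. by move=> f; apply: functional_extensionality_dep => i; exact: add0r. Qed.
Fact prodm_addN : left_inverse prodm_zero prodm_opp prodm_add.
Proof. by move=> f; apply: functional_extensionality_dep => i; exact: addNr. Qed.
HB.instance Definition _ :=
  GRing.isZmodule.Build prodm prodm_addA prodm_addC prodm_add0 prodm_addN.

Fact prodm_scaleA a b f : prodm_scale a (prodm_scale b f) = prodm_scale (a * b) f.
Proof. by apply: functional_extensionality_dep => i; exact: scalerA. Qed.
Fact prodm_scale1 : left_id 1 prodm_scale.
Proof. by move=> f; apply: functional_extensionality_dep => i; exact: scale1r. Qed.
Fact prodm_scaleDr : right_distributive prodm_scale +%R.
Proof. by move=> a f g; apply: functional_extensionality_dep => i; exact: scalerDr. Qed.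
Fact prodm_scaleDl f : {morph prodm_scale^~ f : a b / a + b}.
Proof. by move=> a b; apply: functional_extensionality_dep => i; exact: scalerDl. Qed.
HB.instance Definition _ := GRing.Zmodule_isLmodule.Build k prodm
  prodm_scaleA prodm_scale1 prodm_scaleDr prodm_scaleDl.

(* The product of the X i with S i, as a submodule of the product of all X i. *)
Definition supp (S : pred I) : {pred prodm} :=
  fun f => `[< forall i, ~~ S i -> f i = 0 >].

Fact supp_submod S : GRing.submod_closed (supp S).
Proof.
split; first by apply/asboolP.
move=> a f g /asboolP hf /asboolP hg; apply/asboolP => i hi.
have -> : (a *: f + g) i = a *: f i + g i by [].
by rewrite (hf i hi) (hg i hi) addr0 scaler0.
Qed.
HB.instance Definition _ S :=
  GRing.isSubmodClosed.Build k prodm (supp S) (supp_submod S).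

Definition cut (S : pred I) (f : prodm) : prodm := fun i => if S i then f i else 0.

Fact cut_supp S f : cut S f \in supp S.
Proof. by apply/asboolP => i /negbTE; rewrite /cut => ->. Qed.

End Product.

(* The composite  prod_{S i} X i -> prod_i X i -D-> prod_j Y j -> prod_{T j} Y j
   of D with the inclusion and the projection. *)
Section SuppMap.
Variables (I J : Type) (X : I -> lmodType k) (Y : J -> lmodType k).
Variables (D : {linear prodm X -> prodm Y}) (S : pred I) (T : pred J).

Definition supp_map (f : sub (supp (X := X) S)) : sub (supp (X := Y) T) :=
  Sub (cut_supp T (D (val f))).

Fact supp_map_linear : linear supp_map.
Proof.
move=> a f g; apply/val_inj; rewrite linearP /= linearP.
apply: functional_extensionality_dep => i; rewrite /cut.
rewrite [RHS]/(a *: (if T i then D (val f) i else 0) + (if T i then D (val g) i else 0)).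
by case: (T i) => //; rewrite scaler0; exact: esym (addr0 _).
Qed.
HB.instance Definition _ :=
  GRing.isLinear.Build k _ _ _ supp_map supp_map_linear.
End SuppMap.

(* The linear map (x, y) |-> (f11 x + f12 y, f21 x + f22 y). *)
Section Block.
Variables (U1 U2 V1 V2 : lmodType k).
Variables (f11 : {linear U1 -> V1}) (f12 : {linear U2 -> V1}).
Variables (f21 : {linear U1 -> V2}) (f22 : {linear U2 -> V2}).

Definition block (p : U1 * U2) : V1 * V2 :=
  (f11 p.1 + f12 p.2, f21 p.1 + f22 p.2).

Fact block_linear : linear block.
Proof.
by move=> a p q; congr (_, _); rewrite /= !linearP /= scalerDr !addrA; congr (_ + _);
  rewrite -!addrA; congr (_ + _); rewrite addrC.
Qed.
HB.instance Definition _ := GRing.isLinear.Build k _ _ _ block block_linear.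
End Block.

Section DescribedMap.
Variables (U V : lmodType k) (P : {linear U -> V} -> Prop).

(* The linear map f such that P f. Below, P always prescribes the values of f on a
   generating set, so there is at most one such f, and there is one as soon as the
   prescription respects the relations between the generators. *)
Definition the_linear : {linear U -> V} :=
  if pselect (exists f, P f) is left e then projT1 (cid e) else \0.

Lemma the_linearP : (exists f, P f) -> P the_linear.
Proof.
by move=> e; rewrite /the_linear; case: pselect => // e'; case: (cid e').
Qed.
End DescribedMap.

Definition lmod_iso (V W : lmodType k) : Prop :=
  exists f : {linear V -> W}, bijective f.

Definition homology (U V W : lmodType k)
    (f : {linear U -> V}) (g : {linear V -> W}) : lmodType k := quotm (@preim_sub _ (kerl g) (iml f)).

End Modules.
Arguments supp_map [k I J X Y] D S T f.

Section MixedComplexes.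
Variable k : pzRingType.

Record mixed := Mixed {
  mcx :> nat -> lmodType k;
  mcx_b : forall n, {linear mcx n.+1 -> mcx n};
  mcx_B : forall n, {linear mcx n -> mcx n.+1} }.

(* First quadrant data in which B raises the first index; the modules with a
   negative index, and hence b on X 0 w and beta on X v 0, are zero. *)
Record dmixed := DMixed {
  dmx :> nat -> nat -> lmodType k;
  dmx_b : forall v w, {linear dmx v.+1 w -> dmx v w};
  dmx_beta : forall v w, {linear dmx v w.+1 -> dmx v w};
  dmx_B : forall v w, {linear dmx v w -> dmx v.+1 w} }.

(* The second clause on b B is the relation b B + B b = 0 on X 0 w. *)
Record is_double_mixed (X : dmixed) : Prop := {
  dmixed_bb : forall v w (x : X v.+2 w), dmx_b X v w (dmx_b X v.+1 w x) = 0;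
  dmixed_betabeta : forall v w (x : X v w.+2),
    dmx_beta X v w (dmx_beta X v w.+1 x) = 0;
  dmixed_BB : forall v w (x : X v w), dmx_B X v.+1 w (dmx_B X v w x) = 0;
  dmixed_betab : forall v w (x : X v.+1 w.+1),
    dmx_beta X v w (dmx_b X v w.+1 x) + dmx_b X v w (dmx_beta X v.+1 w x) = 0;
  dmixed_betaB : forall v w (x : X v w.+1),
    dmx_beta X v.+1 w (dmx_B X v w.+1 x) + dmx_B X v w (dmx_beta X v w x) = 0;
  dmixed_bB : forall v w (x : X v.+1 w),
    dmx_b X v.+1 w (dmx_B X v.+1 w x) + dmx_B X v w (dmx_b X v w x) = 0;
  dmixed_bB0 : forall w (x : X 0 w), dmx_b X 0 w (dmx_B X 0 w x) = 0 }.

Record is_dmixed_morphism (X Y : dmixed)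
    (f : forall v w, {linear X v w -> Y v w}) : Prop := {
  dmor_source : is_double_mixed X;
  dmor_target : is_double_mixed Y;
  dmor_b : forall v w (x : X v.+1 w),
    f v w (dmx_b X v w x) = dmx_b Y v w (f v.+1 w x);
  dmor_beta : forall v w (x : X v w.+1),
    f v w (dmx_beta X v w x) = dmx_beta Y v w (f v w.+1 x);
  dmor_B : forall v w (x : X v w),
    f v.+1 w (dmx_B X v w x) = dmx_B Y v w (f v w x) }.

Section Total.
Variable X : dmixed.

Definition dmx_pair (p : nat * nat) : lmodType k := X p.1 p.2.

Definition tot_degree (n : nat) : pred (nat * nat) := fun p => (p.1 + p.2)%N == n.

(* Tot(X)_n, the direct sum of the X v w over the finitely many v + w = n. *)
Definition tot_mod (n : nat) : lmodType k := sub (supp (X := dmx_pair) (tot_degree n)).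

Definition tot_b_fun (f : prodm dmx_pair) : prodm dmx_pair := fun p =>
  dmx_b X p.1 p.2 (f (p.1.+1, p.2)) + dmx_beta X p.1 p.2 (f (p.1, p.2.+1)).

Definition tot_B_fun (f : prodm dmx_pair) : prodm dmx_pair := fun p =>
  match p return dmx_pair p with
  | (0, w) => 0
  | (v.+1, w) => dmx_B X v w (f (v, w))
  end.

Fact tot_b_fun_linear : linear tot_b_fun.
Proof.
move=> a f g; apply: functional_extensionality_dep => -[v w].
rewrite /tot_b_fun /=.
have E p : (a *: f + g) p = a *: f p + g p by [].
rewrite !E !linearP.
have E' (h h' : prodm dmx_pair) : (a *: h + h') (v, w) = a *: h (v, w) + h' (v, w) by [].
rewrite E' /= scalerDr -!addrA; congr (_ + _).
by rewrite !addrA; congr (_ + _); rewrite addrC.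
Qed.
HB.instance Definition _ := GRing.isLinear.Build k _ _ _ tot_b_fun tot_b_fun_linear.

Fact tot_B_fun_linear : linear tot_B_fun.
Proof.
move=> a f g; apply: functional_extensionality_dep => -[[|v] w].
  have E' (h h' : prodm dmx_pair) : (a *: h + h') (0, w) = a *: h (0, w) + h' (0, w) by [].
  by rewrite E' /= scaler0 addr0.
have E' (h h' : prodm dmx_pair) : (a *: h + h') (v.+1, w) = a *: h (v.+1, w) + h' (v.+1, w) by [].
rewrite E' /=; have -> : (a *: f + g) (v, w) = a *: f (v, w) + g (v, w) by [].
by rewrite linearP.
Qed.
HB.instance Definition _ := GRing.isLinear.Build k _ _ _ tot_B_fun tot_B_fun_linear.

Definition tot_mixed : mixed := {|
  mcx := tot_mod;
  mcx_b := fun n => supp_map tot_b_fun (tot_degree n.+1) (tot_degree n);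
  mcx_B := fun n => supp_map tot_B_fun (tot_degree n) (tot_degree n.+1) |}.

End Total.

Section TotalMap.
Variables (X Y : dmixed) (f : forall v w, {linear X v w -> Y v w}).

Definition tot_fun (x : prodm (dmx_pair X)) : prodm (dmx_pair Y) :=
  fun p => f p.1 p.2 (x p).

Fact tot_fun_linear : linear tot_fun.
Proof.
move=> a x y; apply: functional_extensionality_dep => p.
rewrite /tot_fun; have -> : (a *: x + y) p = a *: x p + y p by [].
by rewrite linearP.
Qed.
HB.instance Definition _ := GRing.isLinear.Build k _ _ _ tot_fun tot_fun_linear.

Definition tot_map (n : nat) : {linear tot_mixed X n -> tot_mixed Y n} :=
  supp_map tot_fun (tot_degree n) (tot_degree n).

End TotalMap.

Definition homotopic (X Y : mixed) (f g : forall n, X n -> Y n) : Prop :=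
  exists h : forall n, {linear X n -> Y n.+1},
    (forall x : X 0, f 0 x - g 0 x = mcx_b Y 0 (h 0 x)) /\
    (forall n (x : X n.+1), f n.+1 x - g n.+1 x =
       mcx_b Y n.+1 (h n.+1 x) + h n (mcx_b X n x)).

Section Homologies.
Variable X : mixed.

Definition HH (n : nat) : lmodType k :=
  match n with
  | 0 => homology (mcx_b X 0) (\0 : {linear X 0 -> X 0})
  | m.+1 => homology (mcx_b X m.+1) (mcx_b X m)
  end.

Definition bB_fun (f : prodm X) : prodm X := fun n =>
  match n return X n with
  | 0 => mcx_b X 0 (f 1)
  | m.+1 => mcx_b X m.+1 (f m.+2) + mcx_B X m (f m)
  end.

Fact bB_fun_linear : linear bB_fun.
Proof.
move=> a f g; apply: functional_extensionality_dep => n.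
have -> : (a *: bB_fun f + bB_fun g) n = a *: bB_fun f n + bB_fun g n by [].
have E m : (a *: f + g) m = a *: f m + g m by [].
case: n => [|m] /=; first by rewrite E linearP.
rewrite !E !linearP scalerDr -!addrA; congr (_ + _).
by rewrite !addrA; congr (_ + _); rewrite addrC.
Qed.
HB.instance Definition _ := GRing.isLinear.Build k _ _ _ bB_fun bB_fun_linear.

(* The degree n component, for the integer n, is the product of the X m with m
   in S n. The differential is b + B followed by the projection onto the factors
   in S (n - 1): for HC this makes B zero on the factor m = n. *)
Definition bB_homology (S : int -> pred nat) (n : int) : lmodType k :=
  homology (supp_map bB_fun (S (n + 1)) (S n)) (supp_map bB_fun (S n) (S (n - 1))).

Definition same_parity (n : int) (m : nat) : bool := (2 %| m%:Z - n)%Z.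

Definition HC := bB_homology (fun n m => (m%:Z <= n) && same_parity n m).
Definition HN := bB_homology (fun n m => (n <= m%:Z) && same_parity n m).
Definition HP := bB_homology same_parity.

End Homologies.

Definition same_homologies (X Y : mixed) : Prop :=
  [/\ forall n, lmod_iso (HH X n) (HH Y n),
      forall n, lmod_iso (HC X n) (HC Y n),
      forall n, lmod_iso (HP X n) (HP Y n)
    & forall n, lmod_iso (HN X n) (HN Y n)].

End MixedComplexes.

Section Extension.
Variable k : comNzRingType.

Record bimodule (A : algType k) := Bimodule {
  bimod :> lmodType k;
  lact : A -> bimod -> bimod;
  ract : bimod -> A -> bimod;
  lact_linear : forall a, linear (lact a);
  lact_linearl : forall m, linear (lact^~ m);
  ract_linear : forall m, linear (ract m);
  ract_linearl : forall a, linear (ract^~ a);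
  lact1 : forall m, lact 1 m = m;
  ract1 : forall m, ract m 1 = m;
  lactA : forall a b m, lact (a * b) m = lact a (lact b m);
  ractA : forall m a b, ract m (a * b) = ract (ract m a) b;
  lractA : forall a m b, ract (lact a m) b = lact a (ract m b) }.

(* tri m m' is the value on m (x) m' of an associative A-bimodule map
   M (x)_A M -> M. *)
Record bimodule_product (A : algType k) (M : bimodule A) := BimoduleProduct {
  tri :> M -> M -> M;
  tri_linear : forall m, linear (tri m);
  tri_linearl : forall m, linear (tri^~ m);
  tri_balanced : forall m a m', tri (ract m a) m' = tri m (lact a m');
  tri_lact : forall a m m', tri (lact a m) m' = lact a (tri m m');
  tri_ract : forall m m' a, tri m (ract m' a) = ract (tri m m') a;
  triA : forall m m' m'', tri m (tri m' m'') = tri (tri m m') m'' }.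

Definition ext (A : algType k) (M : bimodule A) (T : bimodule_product M) : Type :=
  (A * M)%type.

Variables (A : algType k) (M : bimodule A) (T : bimodule_product M).
Notation E := (ext T).

HB.instance Definition _ := GRing.Lmodule.copy E (A * M)%type.

Definition ext_mul (x y : E) : E :=
  (x.1 * y.1, lact x.1 y.2 + ract x.2 y.1 + T x.2 y.2).
Definition ext_one : E := (1, 0).

Let lactD a m m' : lact a (m + m') = lact a m + lact a m' :> M.
Proof. by have := lact_linear a 1 m m'; rewrite !scale1r. Qed.
Let lactDl m a a' : lact (a + a') m = lact a m + lact a' m :> M.
Proof. by have := lact_linearl m 1 a a'; rewrite /= !scale1r. Qed.
Let ractD m a a' : ract m (a + a') = ract m a + ract m a' :> M.
Proof. by have := ract_linear m 1 a a'; rewrite !scale1r. Qed.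
Let ractDl a m m' : ract (m + m') a = ract m a + ract m' a :> M.
Proof. by have := ract_linearl a 1 m m'; rewrite /= !scale1r. Qed.
Let triD m m' m'' : T m (m' + m'') = T m m' + T m m''.
Proof. by have := tri_linear T m 1 m' m''; rewrite !scale1r. Qed.
Let triDl m m' m'' : T (m' + m'') m = T m' m + T m'' m.
Proof. by have := tri_linearl T m 1 m' m''; rewrite /= !scale1r. Qed.
Let add_id0 (V : zmodType) (x : V) : x = x + x -> x = 0.
Proof. by rewrite -[LHS]addr0 => /addrI. Qed.
Let lact0 a : lact a 0 = 0 :> M.
Proof. by apply: add_id0; rewrite -lactD addr0. Qed.
Let ract0 a : ract 0 a = 0 :> M.
Proof. by apply: add_id0; rewrite -ractDl addr0. Qed.
Let tri0 m : T m 0 = 0.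
Proof. by apply: add_id0; rewrite -triD addr0. Qed.
Let tri0l m : T 0 m = 0.
Proof. by apply: add_id0; rewrite -triDl addr0. Qed.
Let scale_id0 (V W : lmodType k) (f : V -> W) c x :
  linear f -> f 0 = 0 -> f (c *: x) = c *: f x.
Proof. by move=> lf f0; have := lf c x 0; rewrite f0 !addr0. Qed.

Fact ext_mulA : associative ext_mul.
Proof.
move=> x y z; congr (_, _) => /=; first exact: mulrA.
rewrite !lactD !ractDl !triD !triDl ractA lactA lractA.
rewrite -tri_ract tri_lact tri_balanced triA.
by rewrite [LHS](AC (3*1*3) (1*(2*4*6)*(3*5*7))).
Qed.

Fact ext_mul1l : left_id ext_one ext_mul.
Proof.
case=> a m; rewrite /ext_mul /= mul1r lact1 ract0 tri0l !addr0; reflexivity.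
Qed.

Fact ext_mul1r : right_id ext_one ext_mul.
Proof.
case=> a m; rewrite /ext_mul /= mulr1 ract1 lact0 tri0 add0r addr0; reflexivity.
Qed.

Fact ext_mulDl : left_distributive ext_mul +%R.
Proof.
move=> x y z; congr (_, _) => /=; first exact: mulrDl.
by rewrite lactDl ractDl triDl [LHS](AC (2*2*2) ((1*3*5)*(2*4*6))).
Qed.

Fact ext_mulDr : right_distributive ext_mul +%R.
Proof.
move=> x y z; congr (_, _) => /=; first exact: mulrDr.
by rewrite lactD ractD triD [LHS](AC (2*2*2) ((1*3*5)*(2*4*6))).
Qed.

Fact ext_one_neq0 : ext_one != 0.
Proof. by apply/eqP => -[/eqP]; rewrite oner_eq0. Qed.

HB.instance Definition _ := GRing.Zmodule_isNzRing.Build E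
  ext_mulA ext_mul1l ext_mul1r ext_mulDl ext_mulDr ext_one_neq0.

Fact ext_scaleAl c (x y : E) : c *: (x * y) = c *: x * y.
Proof.
congr (_, _) => /=; first exact: scalerAl.
rewrite !scalerDr; congr (_ + _ + _).
- by rewrite (scale_id0 _ _ (lact_linearl y.2)) //; apply: add_id0; rewrite -lactDl addr0.
- by rewrite (scale_id0 _ _ (ract_linearl y.1)) // ract0.
- by rewrite (scale_id0 _ _ (tri_linearl T y.2)) // tri0l.
Qed.
HB.instance Definition _ := GRing.LSemiModule_isLSemiAlgebra.Build k E ext_scaleAl.

Fact ext_scaleAr c (x y : E) : c *: (x * y) = x * (c *: y).
Proof.
congr (_, _) => /=; first exact: scalerAr.
rewrite !scalerDr; congr (_ + _ + _).
- by rewrite (scale_id0 _ _ (lact_linear x.1)) // lact0.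
- by rewrite (scale_id0 _ _ (ract_linear x.2)) //; apply: add_id0; rewrite -ractD addr0.
- by rewrite (scale_id0 _ _ (tri_linear T x.2)) // tri0.
Qed.
HB.instance Definition _ := GRing.LSemiAlgebra_isSemiAlgebra.Build k E ext_scaleAr.

End Extension.

Section CyclicTensors.
Variables (k : comNzRingType) (R : algType k) (K : {pred R}).

Definition upd n (x : n.+1.-tuple R) (i : 'I_n.+1) (r : R) : n.+1.-tuple R :=
  [tuple if j == i then r else tnth x j | j < n.+1].

(* The relations between the simple tensors of R (x)_K (R/K)^{(x)_K n} (x)_K.
   As ordS n = 0, the last one for i = n reads
   x_0 (x) ... (x) x_n l = l x_0 (x) ... (x) x_n. *)
Inductive tensor_relation (n : nat) : {freeg (n.+1.-tuple R) / k} -> Prop :=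
| rel_add x i r s :
    tensor_relation (<< upd x i (r + s) >> - (<< upd x i r >> + << upd x i s >>))
| rel_scale x i c r :
    tensor_relation (<< upd x i (c *: r) >> - c *: << upd x i r >>)
| rel_mod x (i : 'I_n.+1) : i != ord0 -> tnth x i \in K -> tensor_relation << x >>
| rel_balanced x i l : l \in K ->
    tensor_relation (<< upd x i (tnth x i * l) >> -
                     << upd x (ordS i) (l * tnth x (ordS i)) >>).

Definition cyc_tensors (n : nat) : lmodType k := quotm (spanl (@tensor_relation n)).

(* The class of x_0 (x) ... (x) x_n; it is 0 when x does not have n + 1 terms. *)
Definition tensor (n : nat) (x : seq R) : cyc_tensors n :=
  if insub x is Some t then cls (spanl (@tensor_relation n)) << t : n.+1.-tuple R >>
  else 0.

End CyclicTensors.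

(* x_0, ..., op x_j x_{j+1}, ..., x_n for j < n, and
   op x_n x_0, x_1, ..., x_{n-1} for j = n. *)
Definition contract (L : Type) (z : L) (op : L -> L -> L) (j : nat) (x : seq L)
  : seq L :=
  let n := (size x).-1 in
  if (j < n)%N then take j x ++ op (nth z x j) (nth z x j.+1) :: drop j.+2 x
  else op (nth z x n) (nth z x 0) :: behead (take n x).

Section Hochschild.
Variables (k : comNzRingType) (R : algType k) (K : {pred R}).

Definition hoch_b (n : nat) : {linear cyc_tensors K n.+1 -> cyc_tensors K n} :=
  the_linear (fun f => forall x : seq R, size x = n.+2 ->
    f (tensor K n.+1 x) =
    \sum_(j < n.+2) (-1) ^+ j *: tensor K n (contract 0 *%R j x)).

Definition connes_B (n : nat) : {linear cyc_tensors K n -> cyc_tensors K n.+1} :=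
  the_linear (fun f => forall x : seq R, size x = n.+1 ->
    f (tensor K n x) =
    \sum_(i < n.+1) (-1) ^+ (i * n)%N *: tensor K n.+1 (1 :: rot i x)).

End Hochschild.

Section Main.
Variables (k : comNzRingType) (A : algType k) (M : bimodule A).
Variables (T : bimodule_product M) (K : {pred A}).

Definition E_algebra : algType k := ext T.
Definition K_in_E : {pred E_algebra} := fun e => (e.1 \in K) && (e.2 == 0).

Definition CE (n : nat) : lmodType k := cyc_tensors K_in_E n.
Definition CA (n : nat) : lmodType k := cyc_tensors K n.

Definition E_to_A (n : nat) : {linear CE n -> CA n} :=
  the_linear (fun f => forall x : seq E_algebra, size x = n.+1 ->
    f (tensor K_in_E n x) = tensor K n [seq e.1 | e <- x]).

Definition relative_mixed : mixed k := {|
  mcx := fun n => sub (kerl (E_to_A n));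
  mcx_b := fun n => the_linear (fun f => forall u, val (f u) = hoch_b K_in_E n (val u));
  mcx_B := fun n => the_linear (fun f => forall u, val (f u) = connes_B K_in_E n (val u))
|}.

(* A simple tensor x_0 (x) ... (x) x_n with each x_i in A or in M. *)
Notation letter := (A + M)%type.
Notation word := (seq letter).

Definition letter_E (x : letter) : E_algebra :=
  match x with inl a => (a, 0) | inr m => (0, m) end.

Definition wtensor (n : nat) (x : word) : CE n := tensor K_in_E n (map letter_E x).

Definition isM (x : letter) : bool := if x is inr _ then true else false.
Definition z0 : letter := inl 0.

(* M (x) B^n_w (x) if c = true and A (x) B^n_w (x) if c = false. They are direct
   summands of E (x) (E/K)^{(x) n} (x), because E/K = A/K (+) M. *)
Definition word_type (c : bool) (n w : int) (x : word) : bool :=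
  [&& (size x)%:Z == n + 1, isM (head z0 x) == c & (count isM (behead x))%:Z == w].

Definition TB (c : bool) (n w : int) : lmodType k :=
  sub (spanl (fun u : CE `|n|%N => exists2 x, word_type c n w x & u = wtensor `|n|%N x)).

(* The linear map sending the class of each word x of the source to the class of
   the formal linear combination g x of words. Only complete expressions such as
   the sum of all the mu_j occur as g x: a single mu_j is not compatible with
   taking the factors in positions >= 1 modulo K. *)
Definition wmap (c : bool) (n w : int) (c' : bool) (n' w' : int)
    (g : word -> seq (k * word)) : {linear TB c n w -> TB c' n' w'} :=
  the_linear (fun f => forall (x : word) (u : TB c n w),
    word_type c n w x -> val u = wtensor `|n|%N x ->
    val (f u) = \sum_(p <- g x) p.1 *: wtensor `|n'|%N p.2).

Definition lmul (x y : letter) : letter :=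
  match x, y with
  | inl a, inl a' => inl (a * a')
  | inl a, inr m => inr (lact a m)
  | inr m, inl a => inr (ract m a)
  | inr _, inr _ => z0
  end.

Definition ltri (x y : letter) : letter :=
  match x, y with inr m, inr m' => inr (T m m') | _, _ => z0 end.

Definition pi_A (x : letter) : letter := if x is inl _ then x else inl 0.
Definition pi_M (x : letter) : letter := if x is inr _ then x else inr 0.

Definition on_head (f : letter -> letter) (p : k * word) : k * word :=
  (p.1, if p.2 is x :: s then f x :: s else [::]).

Definition deg (x : word) : nat := (size x).-1.

Definition w_mu (j : nat) (x : word) : k * word := ((-1) ^+ j, contract z0 lmul j x).
Definition w_rho (j : nat) (x : word) : k * word := ((-1) ^+ j, contract z0 ltri j x).

Definition lastM (x : word) : nat := (deg x - find isM (rev x))%N.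

(* Words with coefficients: w_t p is the image of p.1 *: [p.2] under t, and
   similarly for w_ft with the rotation by one step in place of t. *)
Definition w_t (p : k * word) : k * word :=
  let i := lastM p.2 in (p.1 * (-1) ^+ (i * deg p.2)%N, rot i p.2).

Definition w_ft (p : k * word) : k * word := (p.1 * (-1) ^+ deg p.2, rotr 1 p.2).

Definition w_b (x : word) : seq (k * word) := [seq w_mu j x | j <- iota 0 (deg x).+1].
Definition w_d' (x : word) : seq (k * word) := [seq w_rho j x | j <- iota 0 (deg x)].
Definition w_d (x : word) : seq (k * word) := [seq w_rho j x | j <- iota 0 (deg x).+1].
Definition w_id_t (x : word) : seq (k * word) := [:: (1, x); w_t (-1, x)].
Definition w_N (x : word) : seq (k * word) :=
  [seq iter l w_t (1, x) | l <- iota 0 (count isM (behead x)).+1].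
Definition w_b1 (x : word) : seq (k * word) :=
  on_head pi_A (w_mu 0 x) ::
  [seq w_mu j x | j <- iota 1 (deg x).-1] ++ [:: on_head pi_A (w_mu (deg x) x)].
Definition w_alpha (x : word) : seq (k * word) :=
  [:: on_head pi_M (w_mu 0 x); on_head pi_M (w_mu (deg x) x)].
Definition w_B (x : word) : seq (k * word) :=
  [seq ((-1) ^+ (i * deg x)%N, inl 1 :: rot i x) | i <- iota 0 (deg x).+1].
Definition w_theta (x : word) : seq (k * word) := [:: on_head pi_M (w_mu 0 x)].
Definition w_vartheta (y : word) : seq (k * word) :=
  [seq (p.1, inl 1 :: p.2)
  | p <- [seq iter l w_ft (1, y) | l <- iota 0 (size y - lastM y)%N]].

Definition X (v w : int) : lmodType k := TB true (v + w) w.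

(* A (x) B^n_{w+1} (x) with n = v + w *)
Definition Y (v w : int) : lmodType k := TB false (v + w) (w + 1).

Definition Xmap (v w v' w' : int) (g : word -> seq (k * word)) :
  {linear X v w -> X v' w'} := wmap _ _ _ _ _ _ g.
Definition Ymap (v w v' w' : int) (g : word -> seq (k * word)) :
  {linear Y v w -> Y v' w'} := wmap _ _ _ _ _ _ g.
Definition XYmap (v w v' w' : int) (g : word -> seq (k * word)) :
  {linear X v w -> Y v' w'} := wmap _ _ _ _ _ _ g.
Definition YXmap (v w v' w' : int) (g : word -> seq (k * word)) :
  {linear Y v w -> X v' w'} := wmap _ _ _ _ _ _ g.

Definition hatX_mod (v w : nat) : lmodType k := (X v%:Z w%:Z * X (v%:Z - 1) w%:Z)%type.

Definition hat_b (v w : nat) : {linear hatX_mod v.+1 w -> hatX_mod v w} :=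
  block (Xmap _ _ _ _ w_b) (Xmap _ _ _ _ w_id_t)
        \0                 (\- Xmap _ _ _ _ w_b).
Definition hat_d (v w : nat) : {linear hatX_mod v w.+1 -> hatX_mod v w} :=
  block (Xmap _ _ _ _ w_d) \0
        \0                 (\- Xmap _ _ _ _ w_d').
Definition hat_B (v w : nat) : {linear hatX_mod v w -> hatX_mod v.+1 w} :=
  block \0                 \0
        (Xmap _ _ _ _ w_N) \0.

Definition hatX : dmixed k := DMixed hat_b hat_d hat_B.

Definition frakX_mod (v w : nat) : lmodType k := (X v%:Z w%:Z * Y v%:Z w%:Z)%type.

Definition frak_b (v w : nat) : {linear frakX_mod v.+1 w -> frakX_mod v w} :=
  block (Xmap _ _ _ _ w_b) (YXmap _ _ _ _ w_alpha)
        \0                 (Ymap _ _ _ _ w_b1).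
Definition frak_d (v w : nat) : {linear frakX_mod v w.+1 -> frakX_mod v w} :=
  block (Xmap _ _ _ _ w_d) \0
        \0                 (Ymap _ _ _ _ w_d).
Definition frak_B (v w : nat) : {linear frakX_mod v w -> frakX_mod v.+1 w} :=
  block \0                  \0
        (XYmap _ _ _ _ w_B) (Ymap _ _ _ _ w_B).

Definition frakX : dmixed k := DMixed frak_b frak_d frak_B.

Definition hat_theta (v w : nat) : {linear frakX v w -> hatX v w} :=
  block idfun (YXmap _ _ _ _ (fun y => [:: w_t (1, y)]))
        \0    (YXmap _ _ _ _ w_theta).
Definition hat_vartheta (v w : nat) : {linear hatX v w -> frakX v w} :=
  block idfun \0
        \0    (XYmap _ _ _ _ w_vartheta).

End Main.

(* Main.v *)
Require Import Defs.
From HB Require Import structures.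
From mathcomp Require Import all_boot all_order all_algebra.
From mathcomp Require Import ring_quotient boolp freeg zify.

(** All the modules of tensors embed in one k-module, the ambient module [amb]. It is
    spanned by the classes of sequences of elements of E of any length, modulo the
    relations of cyclic tensors over K, normalized in all positions but the first. The
    Hochschild boundary and the Connes operator are endomorphisms [hoch] and [connes] of
    it, and satisfy the relations of a mixed complex. As E is the sum of A and M, the
    ambient module is also spanned by words in letters of A and of M, and linear maps on
    it can be prescribed on words ([word_lift], [word_ext]). It is graded by the number of
    letters in M, and [hoch] is the sum of a part [D0] that keeps this number, given by
    the product of A and the actions, and a part [D1] that lowers it by one, given by the
    product of M. The operator [Vop] is the map vartheta.

    The two components of frakX are the words with x_0 in M and in A, and b, d and B of
    frakX are [D0], [D1] and [connes]. The homogeneous parts of the relations for [hoch]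
    and [connes] are therefore the relations of frakX ([frakX_double_mixed]). Moreover the
    total complex of frakX consists of all words with at least one letter in M, which is
    the kernel of the map from the tensors of E to those of A
    ([frakX_same_homologies]).

    The main computation is [hoch_Vop]. The extra degeneracy s, the rotation r by one step
    and the boundary b' without the last face satisfy b s = id - r - s b'. Summing this
    over the rotations that occur in vartheta gives b vartheta = id - t - vartheta b#,
    where t is the rotation to the last letter in M, and b# is b except that the cyclic
    contraction is omitted on some words. On words with x_0 in M this says that
    vartheta commutes with b and d; it commutes with B because the rotations in
    vartheta t^l, for l = 0, ..., w, are all the rotations ([Vop_N]). Since theta vartheta
    is the identity, vartheta is injective, and hatX inherits its relations from frakX
    ([hatX_double_mixed]). On words with x_0 in A the same computation says that - vartheta
    is a homotopy h from vartheta theta to the identity for b, which anticommutes with d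
    ([homotopy_b], [homotopy_d]). As h B = B h = 0, the map vartheta theta commutes with
    b, d and B, and so does theta ([theta_morphism]).

    A morphism of mixed complexes with a left inverse, such that the other composite is
    homotopic to the identity for b, induces isomorphisms of all the homologies
    ([same_homologies_retract]): a cycle of b + B in the complement of the image is a
    boundary, by a recursion on the degree that starts in degree 0. Applied to vartheta
    this compares hatX with frakX, hence with the relative complex. *)

Set Implicit Arguments.
Unset Strict Implicit.
Unset Printing Implicit Defensive.
Import GRing.Theory.
Local Open Scope ring_scope.

(** * Linear maps out of modules given by generators and relations *)

Section Presentations.
Variable k : pzRingType.

(** A linear function as a bundled linear map. *)
Definition mklin (V W : lmodType k) (f : V -> W) (hf : linear f) : {linear V -> W} :=
  HB.pack f (GRing.isLinear.Build k V W *:%R f hf).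

(** A linear map that vanishes on S factors through the quotient by S. *)
Lemma quotm_lift (V W : lmodType k) (S : submodClosed V) (f : {linear V -> W}) :
  (forall x, x \in S -> f x = 0) ->
  exists g : {linear quotm S -> W}, forall x, g (cls S x) = f x.
Proof.
move=> fS; pose g (x : quotm S) : W :=
  f (repr (x : Quotient.quot (submod_zmod S))).
have gE x : g (cls S x) = f x.
  apply/eqP; rewrite /g -subr_eq0 -raddfB; apply/eqP/fS.
  by rewrite -clsE cls_reprK.
have lg : linear g.
  move=> a x y; rewrite -[x]cls_reprK -[y]cls_reprK.
  have -> : forall u v : V, a *: cls S u + cls S v = cls S (a *: u + v).
    by move=> u v; rewrite clsD; congr (_ + _); exact: qscale_cls.
  by rewrite !gE linearP.
by exists (mklin lg).
Qed.

Lemma cls_scale (V : lmodType k) (S : submodClosed V) a x :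
  cls S (a *: x) = a *: cls S x.
Proof. by symmetry; exact: qscale_cls. Qed.

Lemma cls0 (V : lmodType k) (S : submodClosed V) : cls S 0 = 0.
Proof. by apply: (@addrI _ (cls S 0)); rewrite -clsD !addr0. Qed.

Lemma cls_sum (V : lmodType k) (S : submodClosed V) I (r : seq I) (P : pred I) F :
  cls S (\sum_(i <- r | P i) F i) = \sum_(i <- r | P i) cls S (F i).
Proof. by apply: (big_morph (cls S)) => [x y|]; [exact: clsD | exact: cls0]. Qed.

Lemma cls_eq0 (V : lmodType k) (S : submodClosed V) x : x \in S -> cls S x = 0.
Proof. by move=> xS; rewrite -(cls0 S); apply/eqP; rewrite clsE subr0. Qed.

Lemma mem_spanl (V : lmodType k) (S : V -> Prop) x : S x -> x \in spanl S.
Proof.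
move=> Sx; apply/asboolP; exists [:: (1, x)]; split.
  by move=> p; rewrite inE => /eqP->.
by rewrite big_seq1 scale1r.
Qed.

End Presentations.

Section FreePresentation.
Variables (k : nzRingType) (T : choiceType).

Local Notation free := [the lmodType k of {freeg T / k}].

Variable rel : {freeg T / k} -> Prop.

Fact fglift_linear (V : lmodType k) (G : T -> V) : linear (fglift G).
Proof.
have fgA : {morph fglift G : x y / x - y} by exact: lift_is_additive.
have fg0 : fglift G 0 = 0 by have := fgA 0 0; rewrite !subr0 subrr.
have fgN x : fglift G (- x) = - fglift G x by rewrite -[- x]sub0r fgA fg0 sub0r.
have fgD x y : fglift G (x + y) = fglift G x + fglift G y.
  by rewrite -[y in LHS]opprK fgA fgN opprK.
have fgS I (r : seq I) (F : I -> {freeg T / k}) :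
    fglift G (\sum_(i <- r) F i) = \sum_(i <- r) fglift G (F i).
  exact: (big_morph _ fgD fg0).
move=> a u v; rewrite fgD; congr (_ + _).
rewrite -[u in RHS]freeg_sumE {1}/GRing.scale /= /fgscale !fgS scaler_sumr.
by apply: eq_bigr => i _; rewrite !liftU scalerA.
Qed.

(** The linear extension of a function on the basis of a free module. *)
Definition fgmap (V : lmodType k) (G : T -> V) : {linear free -> V} :=
  mklin (fglift_linear G).

Lemma fgmapE (V : lmodType k) (G : T -> V) t : fgmap G << t >> = G t.
Proof. by rewrite /= liftU scale1r. Qed.

(** The class of a generator in the module presented by the relations rel. *)
Definition gen (t : T) : quotm (spanl rel) := cls (spanl rel) << t >>.

Lemma gen_lift (V : lmodType k) (G : T -> V) :
  (forall r, rel r -> fgmap G r = 0) ->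
  exists g : {linear quotm (spanl rel) -> V}, forall t, g (gen t) = G t.
Proof.
move=> hG; have [|g gE] := @quotm_lift _ _ _ (spanl rel) (fgmap G); last first.
  by exists g => t; rewrite gE fgmapE.
move: (fgmap G) hG => f hf x /asboolP[s [hs ->]].
rewrite linear_sum big_seq big1 // => p ps.
by rewrite linearZ /= (hf _ (hs _ ps)) scaler0.
Qed.

Lemma gen_span (u : quotm (spanl rel)) :
  exists s : seq (k * T), u = \sum_(p <- s) p.1 *: gen p.2.
Proof.
rewrite -[u]cls_reprK; move: (repr _) => x.
exists [seq (coeff y x, y) | y <- dom x]; rewrite big_map /=.
rewrite -[x in LHS]freeg_sumE cls_sum; apply: eq_bigr => y _.
rewrite -cls_scale; congr (cls _ _); apply/eqP/freeg_eqP => z.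
by rewrite coeffZ !coeffU mul1r.
Qed.

Lemma gen_ext (V : lmodType k) (f g : {linear quotm (spanl rel) -> V}) :
  (forall t, f (gen t) = g (gen t)) -> forall u, f u = g u.
Proof.
move=> fg u; have [s ->] := gen_span u; rewrite !linear_sum.
by apply: eq_bigr => p _; rewrite !linearZ /= fg.
Qed.

Lemma gen_rel r : rel r -> cls (spanl rel) r = 0.
Proof. by move=> hr; apply/cls_eq0/mem_spanl. Qed.

End FreePresentation.

(** * Deformation retracts of mixed complexes and their homologies *)

Section HomologyIso.
Variable k : pzRingType.

Lemma inj_surj_bij (U V : Type) (f : U -> V) :
  injective f -> (forall y, exists x, f x = y) -> bijective f.
Proof.
move=> fi fs; pose g y := projT1 (cid (fs y)).
have gK y : f (g y) = y by rewrite /g; case: cid.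
by exists g => // x; apply: fi; rewrite gK.
Qed.

Lemma lmod_iso_trans (U V W : lmodType k) :
  lmod_iso U V -> lmod_iso V W -> lmod_iso U W.
Proof.
move=> [f fb] [g gb]; exists (g \o f : {linear _ -> _}).
exact: bij_comp.
Qed.

(** A map between the middle terms of two sequences induces an isomorphism of
    homologies if it preserves cycles and boundaries, if only boundaries among the
    cycles become boundaries, and if it reaches every cycle up to a boundary. *)
Lemma homology_iso (U V W U' V' W' : lmodType k)
    (f : {linear U -> V}) (g : {linear V -> W})
    (f' : {linear U' -> V'}) (g' : {linear V' -> W'}) (phi : {linear V -> V'}) :
  (forall x, g x = 0 -> g' (phi x) = 0) ->
  (forall u, exists u', phi (f u) = f' u') ->
  (forall x u', g x = 0 -> phi x = f' u' -> exists u, x = f u) ->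
  (forall x', g' x' = 0 -> exists x u', g x = 0 /\ x' = phi x + f' u') ->
  lmod_iso (homology f g) (homology f' g').
Proof.
move=> hk hi hinj hsurj.
have kerP (x : sub (kerl g)) : phi (val x) \in kerl g'.
  by rewrite unfold_in; apply/eqP/hk/eqP; exact: (valP x).
pose q' := cls (preim_sub (S := kerl g') (iml f')).
pose p0 (x : sub (kerl g)) : homology f' g' := q' (Defs.Sub (kerP x)).
have lp0 : linear p0.
  move=> a x y; rewrite /p0 /q' -cls_scale -clsD; congr (cls _ _).
  by apply/val_inj; rewrite /= !linearP.
have [|p pE] := @quotm_lift _ _ _ (preim_sub (S := kerl g) (iml f)) (mklin lp0).
  move=> x /asboolP [u fu]; rewrite /= /p0 /q'; apply: cls_eq0.
  by apply/asboolP; have [u' hu'] := hi u; exists u'; rewrite /= fu.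
exists p; apply: inj_surj_bij.
  have pN x y : p (cls _ x) = p (cls _ y) ->
      cls (preim_sub (S := kerl g) (iml f)) x = cls _ y.
    rewrite !pE /= /p0 /q' => /eqP; rewrite clsE => /asboolP[u'].
    rewrite raddfB /= -raddfB => hu'.
    have gxy : g (val x - val y) = 0 by apply/eqP; exact: (valP (x - y)).
    have [u hu] := hinj _ _ gxy hu'.
    by apply/eqP; rewrite clsE; apply/asboolP; exists u.
  by move=> x y; rewrite -[x]cls_reprK -[y]cls_reprK; exact: pN.
move=> y; rewrite -[y]cls_reprK; move: (repr _) => {}y.
have gy : g' (val y) = 0 by apply/eqP; exact: (valP y).
have [x [u' [gx yE]]] := hsurj _ gy.
have xk : x \in kerl g by rewrite unfold_in gx.
exists (cls _ (Defs.Sub xk)); rewrite pE /= /p0 /q'.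
apply/eqP; rewrite clsE; apply/asboolP; exists (- u').
by rewrite raddfN /= yE opprD addrA subrr sub0r.
Qed.

End HomologyIso.

Section Retract.
Variable k : pzRingType.

(** The relations of a mixed complex. The last one is b B + B b = 0 in degree 0,
    where b is 0. *)
Record is_mixed (X : mixed k) : Prop := {
  mixed_bb : forall n (x : X n.+2), mcx_b X n (mcx_b X n.+1 x) = 0;
  mixed_BB : forall n (x : X n), mcx_B X n.+1 (mcx_B X n x) = 0;
  mixed_bB : forall n (x : X n.+1),
    mcx_b X n.+1 (mcx_B X n.+1 x) + mcx_B X n (mcx_b X n x) = 0;
  mixed_bB0 : forall x : X 0, mcx_b X 0 (mcx_B X 0 x) = 0 }.

Variables (X Y : mixed k) (hY : is_mixed Y).
Variables (theta : forall n, {linear Y n -> X n}) (vth : forall n, {linear X n -> Y n}).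
Hypothesis theta_b : forall n x, theta n (mcx_b Y n x) = mcx_b X n (theta n.+1 x).
Hypothesis theta_B : forall n x, theta n.+1 (mcx_B Y n x) = mcx_B X n (theta n x).
Hypothesis vth_b : forall n x, vth n (mcx_b X n x) = mcx_b Y n (vth n.+1 x).
Hypothesis vth_B : forall n x, vth n.+1 (mcx_B X n x) = mcx_B Y n (vth n x).
Hypothesis theta_vth : forall n x, theta n (vth n x) = x.
Hypothesis homot : homotopic (fun n x => vth n (theta n x)) (fun n x => x).

(** The map induced on the product over all degrees. *)
Definition prod_map (U V : nat -> lmodType k) (f : forall n, {linear U n -> V n})
  (x : prodm U) : prodm V := fun n => f n (x n).

Fact prod_map_linear (U V : nat -> lmodType k) (f : forall n, {linear U n -> V n}) :
  linear (prod_map f).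
Proof.
by move=> a x y; apply: functional_extensionality_dep => n; exact: linearP.
Qed.
HB.instance Definition _ (U V : nat -> lmodType k) (f : forall n, {linear U n -> V n}) :=
  GRing.isLinear.Build k _ _ _ (prod_map f) (prod_map_linear f).

Lemma vth_bB (x : prodm X) :
  prod_map vth (bB_fun x) = bB_fun (prod_map vth x).
Proof.
apply: functional_extensionality_dep => -[|n]; rewrite /prod_map /=; first exact: vth_b.
by rewrite linearD vth_b vth_B.
Qed.

Lemma theta_bB (x : prodm Y) :
  prod_map theta (bB_fun x) = bB_fun (prod_map theta x).
Proof.
apply: functional_extensionality_dep => -[|n]; rewrite /prod_map /=; first exact: theta_b.
by rewrite linearD theta_b theta_B.
Qed.

(** The projection of Y onto a complement of the image of vth. This complement is
    stable under b and B, and contractible for b. *)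
Definition defect n (x : Y n) := x - vth n (theta n x).

Fact defect_linear n : linear (@defect n).
Proof.
by move=> a x y; rewrite /defect !linearP addrACA -scalerDr.
Qed.
HB.instance Definition _ n :=
  GRing.isLinear.Build k (Y n) (Y n) _ (@defect n) (@defect_linear n).

Lemma defect_b n (x : Y n.+1) : defect (mcx_b Y n x) = mcx_b Y n (defect x).
Proof. by rewrite /defect theta_b vth_b raddfB. Qed.
Lemma defect_B n (x : Y n) : defect (mcx_B Y n x) = mcx_B Y n (defect x).
Proof. by rewrite /defect theta_B vth_B raddfB. Qed.
Lemma defect_idem n (x : Y n) : defect (defect x) = defect x.
Proof. by rewrite /defect raddfB /= theta_vth subrr raddf0 subr0. Qed.

Lemma defect_homotopy : exists h : forall n, {linear Y n -> Y n.+1},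
  (forall x : Y 0, defect x = mcx_b Y 0 (h 0 x)) /\
  (forall n (x : Y n.+1), defect x = mcx_b Y n.+1 (h n.+1 x) + h n (mcx_b Y n x)).
Proof.
have [h [h0 hS]] := homot; exists (fun n => \- h n); split=> [x|n x] /=.
  by rewrite raddfN /= -h0 opprB.
by rewrite raddfN /= -opprD -hS opprB.
Qed.

Section Solve.
Variables (x : prodm Y).
Variable h : forall n, {linear Y n -> Y n.+1}.

(** The recursion that solves (b + B) z = defect x for a cycle x of b + B. It goes
    up in the degree: rem m = defect (x_m) - B z_(m-1) is what b z_(m+1) has to be,
    and it is a cycle of b, so that z_(m+1) is obtained from it by the homotopy. *)
Fixpoint rem (m : nat) : Y m :=
  match m return Y m with
  | 0 => defect (x 0)
  | m1.+1 => match m1 return Y m1.+1 with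
             | 0 => defect (x 1)
             | m2.+1 => defect (x m2.+2) - mcx_B Y m2.+1 (defect (h m2 (rem m2)))
             end
  end.

(** The components z_m of the solution; z_0 = 0. *)
Definition sol (m : nat) : Y m :=
  match m return Y m with 0 => 0 | m1.+1 => defect (h m1 (rem m1)) end.

Lemma remE m : rem m.+1 = defect (x m.+1) - mcx_B Y m (sol m).
Proof. by case: m => [|m] //=; rewrite raddf0 subr0. Qed.

Lemma defect_rem m : defect (rem m) = rem m.
Proof.
case: m => [|m]; first exact: defect_idem.
rewrite remE raddfB /= defect_idem defect_B; congr (_ - mcx_B _ _ _).
by case: m => [|m] /=; [rewrite raddf0 | rewrite defect_idem].
Qed.

Hypothesis h0 : forall x : Y 0, defect x = mcx_b Y 0 (h 0 x).
Hypothesis hS : forall n (x : Y n.+1),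
  defect x = mcx_b Y n.+1 (h n.+1 x) + h n (mcx_b Y n x).

Lemma B_rem m : mcx_B Y m (rem m) = defect (mcx_B Y m (x m)).
Proof.
case: m => [|m]; first by rewrite defect_B.
by rewrite remE raddfB /= mixed_BB // subr0 defect_B.
Qed.

Lemma sol_rem m : (forall j, (j < m)%N -> bB_fun x j = 0) ->
  mcx_b Y m (sol m.+1) = rem m.
Proof.
elim/ltn_ind: m => -[_ _|m IH hx].
  by rewrite /= -defect_b -h0 !defect_idem.
have br : mcx_b Y m (rem m.+1) = 0.
  rewrite remE raddfB /= -defect_b; case: m IH hx => [|m] IH hx.
    by have /= -> := hx 0 isT; rewrite /= !raddf0 addr0.
  have /eqP := mixed_bB hY (sol m.+1); rewrite addr_eq0 => /eqP ->.
  rewrite opprK IH //; last by move=> j jm; apply: hx; lia.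
  rewrite B_rem -raddfD; have /= -> := hx m.+1 (ltnSn _).
  exact: raddf0.
by rewrite /= -defect_b -[X in defect X](addrK (h m (mcx_b Y m (rem m.+1)))) -hS br
  raddf0 subr0 !defect_rem.
Qed.

(** The solution starts where x does, hence it stays in the complex for HN when x
    does. *)
Lemma sol_supp m : (forall j, (j < m)%N -> x j = 0) -> sol m = 0.
Proof.
move=> hx; case: m hx => [|m] //= hx.
suff -> : rem m = 0 by rewrite !raddf0.
elim/ltn_ind: m hx => m IH hx; case: m IH hx => [|m] IH hx.
  by rewrite /= hx // raddf0.
rewrite remE hx // raddf0 sub0r; case: m IH hx => [|m] IH hx /=.
  by rewrite raddf0 oppr0.
by rewrite IH ?raddf0 ?oppr0 // => j jm; apply: hx; lia.
Qed.

End Solve.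

Lemma HH_retract n : lmod_iso (HH X n) (HH Y n).
Proof.
have [h [h0 hS]] := defect_homotopy.
have split_y m (y : Y m) : y = vth m (theta m y) + defect y.
  by rewrite addrC subrK.
case: n => [|n]; apply: (homology_iso (phi := vth _)).
- by [].
- by move=> u; exists (vth 1 u); rewrite vth_b.
- by move=> x u' _ hx; exists (theta 1 u'); rewrite -theta_b -hx theta_vth.
- move=> x' _; exists (theta 0 x'), (h 0 x'); split=> //.
  by rewrite -h0 -split_y.
- by move=> x hx; rewrite -vth_b hx raddf0.
- by move=> u; exists (vth _ u); rewrite vth_b.
- by move=> x u' _ hx; exists (theta _ u'); rewrite -theta_b -hx theta_vth.
move=> x' hx'; exists (theta _ x'), (h _ x'); split; first by rewrite -theta_b hx' raddf0.
by rewrite {1}[x']split_y hS hx' raddf0 addr0.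
Qed.

(** The conditions on S are common to the three complexes for HC, HP and HN, in
    which the chains of degree n have components in the degrees m with S n m. *)
Lemma bB_homology_retract (S : int -> pred nat) n :
  (forall n m, S (n + 1) m.+1 = S n m) ->
  (forall n m j, S n m -> (j.+2 <= m)%N -> S n j -> S n j.+2) ->
  (forall n m, S n m.+1 -> S (n + 1) m \/ forall j, (j < m)%N -> ~~ S n j) ->
  lmod_iso (bB_homology X S n) (bB_homology Y S n).
Proof.
move=> S1 S2 S3.
have cut_map (U V : nat -> lmodType k) (f : forall n, {linear U n -> V n}) (P : pred nat) x :
    prod_map f (cut P x) = cut P (prod_map f x).
  apply: functional_extensionality_dep => i; rewrite /prod_map /cut.
  by case: ifP => // _; rewrite raddf0.
have suppE (U : nat -> lmodType k) (P : pred nat) (x : sub (supp (X := U) P)) i :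
    ~~ P i -> val x i = 0.
  by move=> hi; have /asboolP := valP x; apply.
have cut_id (U : nat -> lmodType k) (P : pred nat) (x : sub (supp (X := U) P)) :
    cut P (val x) = val x.
  apply: functional_extensionality_dep => i; rewrite /cut.
  by case: ifPn => // hi; rewrite suppE.
pose pv m : {linear _ -> _} := supp_map (prod_map vth) (S m) (S m).
pose pt m : {linear _ -> _} := supp_map (prod_map theta) (S m) (S m).
have pvE m x : val (pv m x) = prod_map vth (val x).
  by rewrite /= -cut_map cut_id.
have ptE m x : val (pt m x) = prod_map theta (val x).
  by rewrite /= -cut_map cut_id.
have pvD m m' (x : sub (supp (X := X) (S m))) :
    pv m' (supp_map (bB_fun (X := X)) (S m) (S m') x) =
    supp_map (bB_fun (X := Y)) (S m) (S m') (pv m x).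
  by apply/val_inj; rewrite -[RHS]/(cut (S m') (bB_fun (val (pv m x)))) !pvE -vth_bB -cut_map.
have ptD m m' (x : sub (supp (X := Y) (S m))) :
    pt m' (supp_map (bB_fun (X := Y)) (S m) (S m') x) =
    supp_map (bB_fun (X := X)) (S m) (S m') (pt m x).
  by apply/val_inj; rewrite -[RHS]/(cut (S m') (bB_fun (val (pt m x)))) !ptE -theta_bB -cut_map.
have ptv m x : pt m (pv m x) = x.
  apply/val_inj; rewrite ptE pvE; apply: functional_extensionality_dep => i.
  exact: theta_vth.
apply: (homology_iso (phi := pv n)).
- by move=> x hx; rewrite -[LHS]pvD [X in pv _ X]hx raddf0.
- by move=> u; exists (pv _ u); exact: pvD.
- by move=> x u' _ hx; exists (pt _ u'); rewrite -[RHS]ptD -[X in pt _ X]hx ptv.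
move=> x hx.
have [h [h0 hS]] := defect_homotopy.
exists (pt n x), (Defs.Sub (cut_supp (S (n + 1)) (sol (val x) h))).
split; first by rewrite -[LHS]ptD [X in pt _ X]hx raddf0.
apply/val_inj; rewrite [RHS]raddfD.
rewrite -[RHS]/(val (pv n (pt n x)) + cut (S n) (bB_fun (cut (S (n + 1)) (sol (val x) h)))).
rewrite pvE ptE.
apply: functional_extensionality_dep => i.
rewrite -[RHS]/(vth i (theta i (val x i)) +
  (if S n i then bB_fun (cut (S (n + 1)) (sol (val x) h)) i else 0)).
case: ifPn => hi; last by rewrite suppE // !raddf0 addr0.
suff -> : bB_fun (cut (S (n + 1)) (sol (val x) h)) i = defect (val x i).
  by rewrite addrC subrK.
have cyc j : (j < i)%N -> bB_fun (val x) j = 0.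
  move=> ji; case hj: (S (n - 1) j).
    have := congr1 (fun f : sub (supp (X := Y) (S (n - 1))) => val f j) hx.
    by rewrite /= /cut hj.
  have Sj : S n j.+1 = false by rewrite -hj -(S1 (n - 1)) subrK.
  case: j ji Sj {hj} => [|j] ji Sj /=; rewrite (suppE _ _ x) ?Sj // raddf0 //.
  rewrite (suppE _ _ x j) ?raddf0 ?addr0 //; apply/negP => hj.
  by have := S2 n i j hi ji hj; rewrite Sj.
have bi : mcx_b Y i (cut (S (n + 1)) (sol (val x) h) i.+1) = rem (val x) h i.
  by rewrite /cut S1 hi sol_rem.
case: i hi cyc bi => [|i] hi cyc bi; rewrite [LHS]/= bi //.
have -> : cut (S (n + 1)) (sol (val x) h) i = sol (val x) h i.
  rewrite /cut; case: ifPn => // hni; case: (S3 n i hi) => [hI|hI].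
    by rewrite hI in hni.
  by rewrite sol_supp // => j ji; rewrite suppE // hI.
by rewrite remE subrK.
Qed.

(** A morphism of mixed complexes with a left inverse morphism induces isomorphisms
    of all homologies as soon as the composite in the other order is homotopic to the
    identity for b alone; the homotopy need not be compatible with B. *)
Lemma same_homologies_retract : same_homologies X Y.
Proof.
split; [exact: HH_retract | | | ] => n; apply: bB_homology_retract => {n}.
- by move=> n m; congr (_ && _); rewrite ?/same_parity; lia.
- by move=> n m j; rewrite /same_parity; lia.
- by move=> n m; rewrite /same_parity => h; left; lia.
- by move=> n m; rewrite ?/same_parity; lia.
- by move=> n m j; rewrite /same_parity; lia.
- by move=> n m; rewrite /same_parity => h; left; lia.
- by move=> n m; congr (_ && _); rewrite ?/same_parity; lia.
- by move=> n m j; rewrite /same_parity; lia.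
move=> n m; rewrite /same_parity => h.
have [hm|hm] := boolP (n + 1 <= m%:Z)%R; [left; lia | right => j jm; lia].
Qed.

End Retract.

(** * Total complexes *)

Section Totalization.
Variable k : pzRingType.

(** The projection in the definition of supp_map does nothing on a value that has
    its support in the right place already. *)
Lemma supp_mapE (I J : Type) (X : I -> lmodType k) (Y : J -> lmodType k)
    (D : {linear prodm X -> prodm Y}) (S : pred I) (T : pred J) (f : sub (supp (X := X) S)) :
  D (val f) \in supp (X := Y) T -> val (supp_map D S T f) = D (val f).
Proof.
move=> /asboolP h; apply: functional_extensionality_dep => j.
by rewrite /= /cut; case: ifPn => // hj; rewrite h.
Qed.

Lemma suppP (I : Type) (X : I -> lmodType k) (S : pred I) (f : sub (supp (X := X) S)) i :
  ~~ S i -> val f i = 0.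
Proof. by move=> hi; have /asboolP := valP f; apply. Qed.

Variable X : dmixed k.
Notation tot := (tot_mixed X).

Lemma tot_bE n (f : tot n.+1) : val (mcx_b tot n f) = tot_b_fun (val f).
Proof.
apply: supp_mapE; apply/asboolP => -[v w] h.
change (dmx_b X v w (val f (v.+1, w)) + dmx_beta X v w (val f (v, w.+1)) = 0).
rewrite !suppP ?raddf0 ?addr0 //; rewrite /tot_degree /= in h *; lia.
Qed.

Lemma tot_BE n (f : tot n) : val (mcx_B tot n f) = tot_B_fun (val f).
Proof.
apply: supp_mapE; apply/asboolP => -[[|v] w] h //.
change (dmx_B X v w (val f (v, w)) = 0); rewrite suppP ?raddf0 //; rewrite /tot_degree /= in h *; lia.
Qed.

Lemma tot_b_at n (f : tot n.+1) v w : val (mcx_b tot n f) (v, w) =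
  dmx_b X v w (val f (v.+1, w)) + dmx_beta X v w (val f (v, w.+1)).
Proof. by rewrite tot_bE. Qed.

Lemma tot_B_at n (f : tot n) v w : val (mcx_B tot n f) (v.+1, w) = dmx_B X v w (val f (v, w)).
Proof. by rewrite tot_BE. Qed.

Lemma tot_B_at0 n (f : tot n) w : val (mcx_B tot n f) (0, w) = 0.
Proof. by rewrite tot_BE. Qed.

Lemma tot_ext n (f g : tot n) : (forall v w, val f (v, w) = val g (v, w)) -> f = g.
Proof. by move=> h; apply/val_inj/functional_extensionality_dep => -[v w]. Qed.

Hypothesis hX : is_double_mixed X.

Lemma tot_is_mixed : is_mixed tot.
Proof.
split=> [n f|n f|n f|f]; apply: tot_ext => v w; rewrite -[RHS]/(0 : X v w).
- rewrite tot_b_at !tot_b_at !linearD dmixed_bb // add0r dmixed_betabeta // addr0.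
  by rewrite addrC dmixed_betab.
- case: v => [|v]; first by rewrite tot_B_at0.
  rewrite tot_B_at; case: v => [|v]; first by rewrite tot_B_at0 raddf0.
  by rewrite tot_B_at dmixed_BB.
- have -> : val (mcx_b tot n.+1 (mcx_B tot n.+1 f) + mcx_B tot n (mcx_b tot n f)) (v, w) =
    val (mcx_b tot n.+1 (mcx_B tot n.+1 f)) (v, w) + val (mcx_B tot n (mcx_b tot n f)) (v, w) by [].
  rewrite tot_b_at tot_B_at; case: v => [|v].
    by rewrite !tot_B_at0 raddf0 !addr0 dmixed_bB0.
  rewrite !tot_B_at tot_b_at linearD addrACA dmixed_bB // add0r.
  by rewrite dmixed_betaB.
rewrite tot_b_at tot_B_at; case: v => [|v].
  by rewrite tot_B_at0 raddf0 addr0 dmixed_bB0.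
by rewrite tot_B_at !suppP ?raddf0 ?addr0 //; rewrite /tot_degree /=; lia.
Qed.

End Totalization.

Section TotalMaps.
Variables (k : pzRingType) (X Y : dmixed k) (f : forall v w, {linear X v w -> Y v w}).

Lemma tot_map_at n (x : tot_mixed X n) v w :
  val (tot_map f n x) (v, w) = f v w (val x (v, w)).
Proof.
rewrite /tot_map [LHS](congr1 (fun g => g (v, w)) (supp_mapE _)) //.
apply/asboolP => -[v' w'] hv.
by change (f v' w' (val x (v', w')) = 0); rewrite suppP ?raddf0.
Qed.

Hypothesis hf : is_dmixed_morphism f.

Lemma tot_map_b n x : tot_map f n (mcx_b (tot_mixed X) n x) =
  mcx_b (tot_mixed Y) n (tot_map f n.+1 x).
Proof.
apply: tot_ext => v w; rewrite tot_map_at !tot_b_at linearD.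
by rewrite (dmor_b hf) (dmor_beta hf) !tot_map_at.
Qed.

Lemma tot_map_B n x : tot_map f n.+1 (mcx_B (tot_mixed X) n x) =
  mcx_B (tot_mixed Y) n (tot_map f n x).
Proof.
apply: tot_ext => v w; rewrite tot_map_at; case: v => [|v].
  by rewrite !tot_B_at0 raddf0.
by rewrite !tot_B_at (dmor_B hf) tot_map_at.
Qed.

End TotalMaps.

Section TotalHomotopy.
Variables (k : pzRingType) (X : dmixed k) (e : forall v w, {linear X v w -> X v w}).
Variable h : forall v w, {linear X v w -> X v.+1 w}.
Hypothesis hb : forall v w (x : X v.+1 w),
  e v.+1 w x - x = dmx_b X v.+1 w (h v.+1 w x) + h v w (dmx_b X v w x).
Hypothesis hb0 : forall w (x : X 0 w), e 0 w x - x = dmx_b X 0 w (h 0 w x).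
Hypothesis hbeta : forall v w (x : X v w.+1),
  dmx_beta X v.+1 w (h v w.+1 x) + h v w (dmx_beta X v w x) = 0.

(** A homotopy with respect to b that anticommutes with beta is a homotopy with
    respect to b + beta. *)
Lemma tot_homotopy :
  homotopic (X := tot_mixed X) (Y := tot_mixed X) (fun n x => tot_map e n x) (fun n x => x).
Proof.
(* The total map of h is the operator B of the diagram with h in the place of B. *)
pose X' := DMixed (dmx_b X) (dmx_beta X) h.
exists (mcx_B (tot_mixed X')).
pose H n : tot_mixed X n -> tot_mixed X n.+1 := mcx_B (tot_mixed X') n.
have H0 n (x : tot_mixed X n) w : val (H n x) (0, w) = 0 by exact: (@tot_B_at0 _ X').
have HS n (x : tot_mixed X n) v w : val (H n x) (v.+1, w) = h v w (val x (v, w)).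
  exact: (@tot_B_at _ X').
split=> [x|n x]; apply: tot_ext => v w.
  rewrite -[mcx_B (tot_mixed X') 0 x]/(H 0 x) tot_b_at HS.
  have -> : val (tot_map e 0 x - x) (v, w) = val (tot_map e 0 x) (v, w) - val x (v, w) by [].
  rewrite tot_map_at; case: v => [|v]; first by rewrite H0 raddf0 addr0 hb0.
  rewrite HS !(@suppP _ _ _ _ x) ?raddf0 ?addr0 ?subr0 //; rewrite /tot_degree /=; lia.
rewrite -[mcx_B (tot_mixed X') n.+1 x]/(H n.+1 x) -[mcx_B (tot_mixed X') n _]/(H n (mcx_b (tot_mixed X) n x)).
have -> : val (tot_map e n.+1 x - x) (v, w) = val (tot_map e n.+1 x) (v, w) - val x (v, w) by [].
have -> : val (mcx_b (tot_mixed X) n.+1 (H n.+1 x) + H n (mcx_b (tot_mixed X) n x)) (v, w) =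
  val (mcx_b (tot_mixed X) n.+1 (H n.+1 x)) (v, w) + val (H n (mcx_b (tot_mixed X) n x)) (v, w) by [].
rewrite tot_b_at tot_map_at HS; case: v => [|v]; first by rewrite !H0 raddf0 !addr0 hb0.
by rewrite !HS tot_b_at linearD addrACA hbeta addr0 hb.
Qed.

End TotalHomotopy.

(** * Functions of words that are compatible with the tensor relations *)

Section Letters.
Variable k : comNzRingType.

(** An alphabet for cyclic tensors: a partial addition (as a relation), a scaling,
    the letters in K and the multiplication by them on both sides, and a kind which
    does not change under these operations. The elements of an algebra form an
    alphabet with one kind, and the disjoint union of A and M is one with two. *)
Record letters := Letters {
  letter :> Type;
  ladd : letter -> letter -> letter -> Prop;
  lscale : k -> letter -> letter;
  lK : letter -> Prop;
  lmulK : letter -> letter -> letter;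
  lkind : letter -> bool;
  lkind_add : forall x y z, ladd x y z -> lkind x = lkind z /\ lkind y = lkind z;
  lkind_scale : forall c x, lkind (lscale c x) = lkind x;
  lkind_mulr : forall x l, lK l -> lkind (lmulK x l) = lkind x;
  lkind_mull : forall x l, lK l -> lkind (lmulK l x) = lkind x }.

Variables (L : letters) (V : lmodType k).
Implicit Types (s t : seq L) (x y z l : L) (G : seq L -> V).

(** G is multilinear, balanced over K, and balanced over K between the last and the
    first letter. The last two clauses are the same condition for sequences with at
    least two letters and with one letter. *)
Record cyclic G : Prop := {
  cyc_add : forall s x y z t, ladd x y z ->
    G (s ++ z :: t) = G (s ++ x :: t) + G (s ++ y :: t);
  cyc_scale : forall s c x t, G (s ++ lscale c x :: t) = c *: G (s ++ x :: t);
  cyc_bal : forall s x l y t, lK l ->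
    G (s ++ lmulK x l :: y :: t) = G (s ++ x :: lmulK l y :: t);
  cyc_turn : forall s x l y, lK l ->
    G (y :: rcons s (lmulK x l)) = G (lmulK l y :: rcons s x);
  cyc_turn1 : forall x l, lK l -> G [:: lmulK x l] = G [:: lmulK l x] }.

(** G vanishes on the sequences with a letter in K in any position. *)
Definition killsK G := forall s l t, lK l -> G (s ++ l :: t) = 0.

(** G is cyclic and vanishes on the sequences with a letter in K in a position other
    than the first: the letters in these positions may be taken modulo K. *)
Record normalized G : Prop := {
  norm_cyclic :> cyclic G;
  norm_kill : forall x s l t, lK l -> G (x :: s ++ l :: t) = 0 }.

Lemma normalized_killsK G : cyclic G -> killsK G -> normalized G.
Proof. by move=> hG hK; split=> // x s l t hl; exact: (hK (x :: s)). Qed.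

Lemma normalized_nth G z0 s i : normalized G ->
  (0 < i < size s)%N -> lK (nth z0 s i) -> G s = 0.
Proof.
move=> hG /andP[i0 iS] hl.
rewrite -(cat_take_drop i s) (drop_nth z0 iS).
have : size (take i s) = i by rewrite size_take iS.
by case: (take i s) => [|x s'] /= h; [rewrite -h in i0 | exact: norm_kill].
Qed.

(** The sequence of kinds of a word. *)
Definition kinds s := map (@lkind _) s.

(** The relations do not change the kinds of the letters, so a function that is given
    by different formulas for different sequences of kinds is cyclic if each of these
    formulas is. *)
Lemma cyclic_local G :
  (forall p, exists2 G', cyclic G' & forall s, kinds s = p -> G s = G' s) ->
  cyclic G.
Proof.
move=> hG; split=> [s x y z t h|s c x t|s x l y t h|s x l y h|x l h].
- have [e1 e2] := lkind_add h; have [G' hG' e] := hG (kinds (s ++ z :: t)).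
  rewrite !e /kinds ?map_cat /= ?e1 ?e2 //; exact: cyc_add.
- have [G' hG' e] := hG (kinds (s ++ x :: t)).
  rewrite !e /kinds ?map_cat /= ?lkind_scale //; exact: cyc_scale.
- have [G' hG' e] := hG (kinds (s ++ x :: y :: t)).
  rewrite !e /kinds ?map_cat /= ?(lkind_mulr _ h) ?(lkind_mull _ h) //; exact: (cyc_bal hG').
- have [G' hG' e] := hG (kinds (y :: rcons s x)).
  rewrite !e /kinds /= ?map_rcons /= ?(lkind_mulr _ h) ?(lkind_mull _ h) //; exact: (cyc_turn hG').
have [G' hG' e] := hG (kinds [:: x]).
rewrite !e /kinds /= ?(lkind_mulr _ h) ?(lkind_mull _ h) //; exact: (cyc_turn1 hG').
Qed.

Lemma cyclic0 : cyclic (fun=> 0).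
Proof. by split=> *; rewrite ?addr0 ?scaler0. Qed.

Lemma cyclicD G G' : cyclic G -> cyclic G' -> cyclic (fun s => G s + G' s).
Proof.
move=> h h'; split=> [s x y z t e|s c x t|s x l y t e|s x l y e|x l e].
- by rewrite (cyc_add h s t e) (cyc_add h' s t e) addrACA.
- by rewrite (cyc_scale h) (cyc_scale h') scalerDr.
- by rewrite (cyc_bal h) // (cyc_bal h').
- by rewrite (cyc_turn h) // (cyc_turn h').
by rewrite (cyc_turn1 h) // (cyc_turn1 h').
Qed.

Lemma cyclicZ a G : cyclic G -> cyclic (fun s => a *: G s).
Proof.
move=> h; split=> [s x y z t e|s c x t|s x l y t e|s x l y e|x l e].
- by rewrite (cyc_add h s t e) scalerDr.
- by rewrite (cyc_scale h) !scalerA mulrC.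
- by rewrite (cyc_bal h).
- by rewrite (cyc_turn h).
by rewrite (cyc_turn1 h).
Qed.

Lemma cyclic_sum I (r : seq I) (G : I -> seq L -> V) :
  (forall i, cyclic (G i)) -> cyclic (fun s => \sum_(i <- r) G i s).
Proof.
move=> h; elim: r => [|i r IH].
  apply: cyclic_local => p; exists (fun=> 0); first exact: cyclic0.
  by move=> s _; rewrite big_nil.
apply: cyclic_local => p; exists (fun s => G i s + \sum_(j <- r) G j s).
  exact: cyclicD.
by move=> s _; rewrite big_cons.
Qed.

Lemma cyclic_eq G G' : G =1 G' -> cyclic G -> cyclic G'.
Proof. by move=> e h; apply: cyclic_local => p; exists G => // s _. Qed.

Lemma cyclic_rot1 G : cyclic G -> cyclic (fun s => G (rot 1 s)).
Proof.
move=> h; split.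
- case=> [|a s] x y z t e; rewrite /= !rot1_cons.
    by rewrite -!cats1; exact: cyc_add.
  by rewrite !rcons_cat /=; exact: cyc_add.
- case=> [|a s] c x t; rewrite /= !rot1_cons.
    by rewrite -!cats1; exact: cyc_scale.
  by rewrite !rcons_cat /=; exact: cyc_scale.
- case=> [|a s] x l y t e; rewrite /= !rot1_cons.
    by rewrite /=; exact: (cyc_turn h).
  by rewrite !rcons_cat /=; exact: (cyc_bal h).
- move=> s x l y e; rewrite !rot1_cons -!cats1 -!catA /=; exact: (cyc_bal h).
by move=> x l e; exact: (cyc_turn1 h).
Qed.

Lemma killsK_rot1 G : killsK G -> killsK (fun s => G (rot 1 s)).
Proof.
move=> h [|a s] l t e; rewrite /= rot1_cons.
  by rewrite -cats1; exact: h.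
by rewrite rcons_cat /=; exact: h.
Qed.

Lemma cyclic_rot i G : cyclic G -> cyclic (fun s => G (iter i (rot 1) s)).
Proof.
elim: i G => [|i IH] G hG; first exact: cyclic_eq hG.
have h := IH _ (cyclic_rot1 hG).
by apply: cyclic_eq h => s; rewrite iterS.
Qed.

Lemma killsK_rot i G : killsK G -> killsK (fun s => G (iter i (rot 1) s)).
Proof.
elim: i G => [|i IH] G hG //= s l t e.
by apply: (IH (fun s => G (rot 1 s))) => //; exact: killsK_rot1.
Qed.

End Letters.

Lemma rot_iter T (s : seq T) i : (i <= size s)%N -> rot i s = iter i (rot 1) s.
Proof.
elim: i => [|i IH] hi; first by rewrite rot0.
by rewrite iterS -IH ?(ltnW hi) // rotS.
Qed.

(** * The ambient module of cyclic tensors of all lengths *)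

Section Ring.
Variables (k : comNzRingType) (R : algType k) (K : {pred R}).

(** The elements of an algebra R, for a subset K of R. *)
Definition ring_letters : letters k.
refine (@Letters k R (fun x y z => z = x + y) (fun c x => c *: x)
  (fun x => x \in K) (fun x y => x * y) (fun=> false) _ _ _ _); done.
Defined.

Notation normalizedR := (@normalized k ring_letters _).

(** The relations of normalized cyclic tensors, for sequences of any length. *)
Inductive word_relation : {freeg (seq R) / k} -> Prop :=
| wrel_add s x y t :
    word_relation (<< s ++ (x + y) :: t >> - (<< s ++ x :: t >> + << s ++ y :: t >>))
| wrel_scale s c x t :
    word_relation (<< s ++ (c *: x) :: t >> - c *: << s ++ x :: t >>)
| wrel_kill x s l t : l \in K -> word_relation << x :: s ++ l :: t >>
| wrel_bal s x l y t : l \in K ->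
    word_relation (<< s ++ (x * l) :: y :: t >> - << s ++ x :: (l * y) :: t >>)
| wrel_turn s x l y : l \in K ->
    word_relation (<< y :: rcons s (x * l) >> - << l * y :: rcons s x >>)
| wrel_turn1 x l : l \in K -> word_relation (<< [:: x * l] >> - << [:: l * x] >>).

(** The ambient module: the direct sum over all n of the normalized cyclic tensors of
    degree n, presented by sequences, so that no type depends on n. The empty sequence
    contributes one more summand, which plays no role. *)
Definition amb : lmodType k := quotm (spanl word_relation).
(** The class of a sequence x_0, ..., x_n, that is x_0 (x) ... (x) x_n. *)
Definition cl (s : seq R) : amb := gen word_relation s.

(** The normalized functions are those which factor through the ambient module. *)
Lemma amb_lift (V : lmodType k) (G : seq R -> V) : normalizedR G ->
  exists f : {linear amb -> V}, forall s, f (cl s) = G s.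
Proof.
move=> [hG hK]; apply: gen_lift; move: (fgmap G) (fgmapE G) => f fE r.
case=> [s x y t|s c x t|x s l t h|s x l y t h|s x l y h|x l h].
- rewrite linearB linearD !fE; apply/eqP; rewrite subr_eq0; apply/eqP.
  exact: (cyc_add hG).
- rewrite linearB linearZ !fE; apply/eqP; rewrite subr_eq0; apply/eqP.
  exact: (cyc_scale hG).
- by rewrite fE; apply: hK.
- rewrite linearB !fE; apply/eqP; rewrite subr_eq0; apply/eqP.
  exact: (cyc_bal hG).
- rewrite linearB !fE; apply/eqP; rewrite subr_eq0; apply/eqP.
  exact: (cyc_turn hG).
rewrite linearB !fE; apply/eqP; rewrite subr_eq0; apply/eqP.
exact: (cyc_turn1 hG).
Qed.

Lemma cl_eq s t : word_relation (<< s >> - << t >>) -> cl s = cl t.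
Proof. by move=> h; apply/eqP; rewrite clsE; exact: mem_spanl. Qed.

Lemma cl_normalized : normalizedR cl.
Proof.
split; last by move=> x s l t h; apply: gen_rel; exact: wrel_kill.
split=> [s x y z t ->|s c x t|s x l y t h|s x l y h|x l h].
- by apply/eqP; rewrite -clsD clsE; exact/mem_spanl/wrel_add.
- by apply/eqP; rewrite -cls_scale clsE; exact/mem_spanl/wrel_scale.
- by apply: cl_eq; exact: wrel_bal.
- by apply: cl_eq; exact: wrel_turn.
by apply: cl_eq; exact: wrel_turn1.
Qed.

Lemma amb_span u : exists s : seq (k * seq R), u = \sum_(p <- s) p.1 *: cl p.2.
Proof. exact: gen_span. Qed.

Lemma amb_ext (V : lmodType k) (f g : {linear amb -> V}) :
  (forall s, f (cl s) = g (cl s)) -> forall u, f u = g u.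
Proof. exact: gen_ext. Qed.

End Ring.

(** * Tensors of a fixed degree *)

Section Tensors.
Variables (k : comNzRingType) (R : algType k) (K : {pred R}).
Notation normalizedR := (@normalized k (ring_letters K) _).

Lemma upd_cat n (T : n.+1.-tuple R) (i : 'I_n.+1) s a t r :
  tval T = s ++ a :: t -> i = size s :> nat -> tval (upd T i r) = s ++ r :: t.
Proof.
move=> eT ei; have sT : size s + (size t).+1 = n.+1.
  by have := congr1 size eT; rewrite size_tuple size_cat.
apply: (@eq_from_nth _ 0); first by rewrite size_tuple size_cat -sT.
move=> j; rewrite size_tuple => jn.
have := tnth_nth 0 (upd T i r) (Ordinal jn); rewrite tnth_mktuple /= => <-.
rewrite -val_eqE /= ei (tnth_nth 0) /= eT !nth_cat.
case: ltngtP => // [js|->]; last by rewrite subnn.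
by case: (j - size s)%N (subn_gt0 (size s) j) => [|m] //=; rewrite js.
Qed.

Lemma tensor_gen n (T : n.+1.-tuple R) : tensor K n T = gen (@tensor_relation k R K n) T.
Proof. by rewrite /tensor valK. Qed.

Lemma tensor_size n s : size s != n.+1 -> tensor K n s = 0.
Proof. by move=> h; rewrite /tensor insubN. Qed.

Lemma tupleE (n : nat) (s : seq R) : size s = n -> exists T : n.-tuple R, tval T = s.
Proof. by move=> /eqP h; exists (Tuple h). Qed.

Lemma tensor_upd n s a t r (T : n.+1.-tuple R) (i : 'I_n.+1) :
  tval T = s ++ a :: t -> i = size s :> nat ->
  tensor K n (s ++ r :: t) = gen (@tensor_relation k R K n) (upd T i r).
Proof. by move=> eT ei; rewrite -(upd_cat r eT ei) tensor_gen. Qed.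

Lemma tensor_rel n (S T : n.+1.-tuple R) :
  tensor_relation K (<< S >> - << T >>) -> tensor K n S = tensor K n T.
Proof. by move=> h; rewrite !tensor_gen; apply/eqP; rewrite clsE; exact: mem_spanl. Qed.

Lemma tensor_normalized n : normalizedR (tensor K n).
Proof.
have sz a b : a = b -> (a == n.+1) -> (b == n.+1) by move=> ->.
have sz' a b : a = b -> (a != n.+1) -> (b != n.+1) by move=> ->.
have at_ s (a : R) t : size (s ++ a :: t) == n.+1 -> exists (T : n.+1.-tuple R) (i : 'I_n.+1),
    tval T = s ++ a :: t /\ i = size s :> nat.
  move=> /[dup] h /eqP h'; have lt : (size s < n.+1)%N by rewrite -h' size_cat /= addnS ltnS leq_addr.
  by exists (Tuple h), (Ordinal lt).
split; last first.
  move=> x s l t hl; have [h|h] := boolP (size ((x :: s) ++ l :: t) == n.+1); last first.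
    by rewrite tensor_size.
  have [T [i [eT ei]]] := at_ _ _ _ h.
  rewrite -[x :: s ++ _]/((x :: s) ++ _) -eT tensor_gen; apply: gen_rel.
  apply: (@rel_mod _ _ _ _ _ i); first by rewrite -val_eqE /= ei.
  by rewrite (tnth_nth 0) eT ei nth_cat ltnn subnn.
split.
- move=> s x y z t ->.
  have [h|h] := boolP (size (s ++ x :: t) == n.+1); last first.
    rewrite !tensor_size ?addr0 //; apply: sz' h; by rewrite !size_cat.
  have [T [i [eT ei]]] := at_ _ _ _ h.
  rewrite !(tensor_upd _ eT ei); apply/eqP; rewrite -clsD clsE; apply/mem_spanl.
  exact: rel_add.
- move=> s c x t.
  have [h|h] := boolP (size (s ++ x :: t) == n.+1); last first.
    rewrite !tensor_size ?scaler0 //; apply: sz' h; by rewrite !size_cat.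
  have [T [i [eT ei]]] := at_ _ _ _ h.
  rewrite !(tensor_upd _ eT ei); apply/eqP; rewrite -cls_scale clsE; apply/mem_spanl.
  exact: rel_scale.
- move=> s x l y t hl.
  have [h|h] := boolP (size (s ++ x :: y :: t) == n.+1); last first.
    rewrite !tensor_size //; apply: sz' h; by rewrite !size_cat.
  have [T [i [eT ei]]] := at_ _ _ _ h.
  have eT' : tval T = rcons s x ++ y :: t by rewrite cat_rcons.
  have lt : (i.+1 < n.+1)%N by rewrite ei -(eqP h) size_cat /=; lia.
  have ei' : ordS i = size (rcons s x) :> nat.
    by rewrite /= size_rcons -ei modn_small.
  have Ti : tnth T i = x by rewrite (tnth_nth 0) eT ei nth_cat ltnn subnn.
  have Ti' : tnth T (ordS i) = y by rewrite (tnth_nth 0) eT' ei' nth_cat ltnn subnn.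
  have := rel_balanced T i hl; rewrite Ti Ti' => /tensor_rel.
  by rewrite (upd_cat _ eT ei) (upd_cat _ eT' ei') cat_rcons.
- move=> s x l y hl.
  have [h|h] := boolP (size ((y :: s) ++ [:: x]) == n.+1); last first.
    rewrite !tensor_size //; apply: sz' h; by rewrite ?size_cat /= ?size_rcons addn1.
  have [T [i [eT ei]]] := at_ _ _ _ h.
  have eT' : tval T = [::] ++ y :: rcons s x by rewrite eT /= cats1.
  have si : i.+1 = n.+1 by rewrite ei -(eqP h) size_cat addn1.
  have ei' : ordS i = size (@nil R) :> nat.
    by rewrite /= si modnn.
  have Ti : tnth T i = x by rewrite (tnth_nth 0) eT ei nth_cat ltnn subnn.
  have Ti' : tnth T (ordS i) = y by rewrite (tnth_nth 0) eT' ei' nth_cat ltnn subnn.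
  have := rel_balanced T i hl; rewrite Ti Ti' => /tensor_rel.
  by rewrite (upd_cat _ eT ei) (upd_cat _ eT' ei') /= cats1.
move=> x l hl.
have [h|h] := boolP (size ([::] ++ [:: x]) == n.+1); last first.
  rewrite !tensor_size //; apply: sz' h; by [].
have [T [i [eT ei]]] := at_ _ _ _ h.
have ei' : ordS i = size (@nil R) :> nat.
  by rewrite /= ei -(eqP h).
have := rel_balanced T i hl; rewrite !(tnth_nth 0) ei' ei eT /= => /tensor_rel.
by rewrite (upd_cat _ eT ei) (upd_cat _ eT ei').
Qed.

(** The universal property of the tensors of degree n. *)
Lemma tensor_lift n (V : lmodType k) (G : seq R -> V) : normalizedR G ->
  exists f : {linear cyc_tensors K n -> V}, forall s, size s = n.+1 -> f (tensor K n s) = G s.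
Proof.
move=> [hG hK].
have split_ (T : n.+1.-tuple R) (i : 'I_n.+1) :
    tval T = take i T ++ tnth T i :: drop i.+1 T /\ i = size (take i T) :> nat.
  rewrite size_take size_tuple ltn_ord; split=> //.
  by rewrite (tnth_nth 0) -drop_nth ?size_tuple ?ltn_ord // cat_take_drop.
pose GT (T : n.+1.-tuple R) := G T.
have [] := @gen_lift k _ (@tensor_relation k R K n) V GT; last first.
  move=> f fE; exists f => s hs; have [T <-] := tupleE hs.
  by rewrite tensor_gen fE.
move: (fgmap GT) (fgmapE GT) => f; rewrite /GT => fE r [x i r' s|x i c r'|x i i0 hx|x i l hl].
- rewrite linearB linearD !fE; apply/eqP; rewrite subr_eq0; apply/eqP.
  have [eT ei] := split_ x i; rewrite !(upd_cat _ eT ei); exact: (cyc_add hG).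
- rewrite linearB linearZ !fE; apply/eqP; rewrite subr_eq0; apply/eqP.
  have [eT ei] := split_ x i; rewrite !(upd_cat _ eT ei); exact: (cyc_scale hG).
- rewrite fE; have [eT ei] := split_ x i; rewrite /= {}eT.
  case: (take i x) ei => [|y s] ei; last exact: hK.
  by move: i0; rewrite -val_eqE /= ei.
rewrite linearB !fE; apply/eqP; rewrite subr_eq0; apply/eqP.
have [eT ei] := split_ x i; have [eT' ei'] := split_ x (ordS i).
rewrite (upd_cat _ eT ei) (upd_cat _ eT' ei').
have [hi|hi] := ltnP i.+1 n.+1.
  have si : ordS i = i.+1 :> nat by rewrite /= modn_small.
  have xi : tnth x (ordS i) = nth 0 x i.+1 by rewrite (tnth_nth 0) si.
  rewrite [drop i.+1 x](drop_nth 0) ?size_tuple // -xi si (take_nth 0) ?size_tuple //.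
  by rewrite -(tnth_nth 0 x i) cat_rcons; exact: (cyc_bal hG).
have in_ : i = n :> nat by have := ltn_ord i; lia.
have si : ordS i = 0 :> nat by rewrite /= in_ modnn.
have x0 : tnth x (ordS i) = nth 0 x 0 by rewrite (tnth_nth 0) si.
have xE : tval x = tnth x (ordS i) :: drop 1 x.
  by rewrite x0 -drop_nth ?drop0 ?size_tuple.
have dE : drop i.+1 x = [::] by rewrite drop_oversize ?size_tuple ?in_.
rewrite {}dE si take0 /= in eT *.
case: (posnP n) => n0.
  have -> : ordS i = i by apply/val_inj; rewrite [LHS]si [RHS]in_ n0.
  have d1 : drop 1 x = [::] by apply: size0nil; rewrite size_drop size_tuple n0.
  have -> : take i x = [::] by apply: size0nil; rewrite size_take size_tuple ltn_ord in_.
  by rewrite d1; exact: (cyc_turn1 hG).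
have tE : take i x = tnth x (ordS i) :: take n.-1 (drop 1 x).
  by rewrite in_ {1}xE -{1}(prednK n0).
have -> : drop 1 x = rcons (take n.-1 (drop 1 x)) (tnth x i).
  have := eT; rewrite tE {1}xE cats1 /= => -[]; exact.
rewrite tE cats1 /=; exact: (cyc_turn hG).
Qed.

End Tensors.

(** * Contractions and rotations of signed words *)

Lemma rotrD T i j (s : seq T) : (i + j <= size s)%N -> rotr (i + j) s = rotr i (rotr j s).
Proof.
move=> h; apply: (@rot_inj (i + j)); rewrite rotrK addnC rotD ?rotrK //.
by rewrite !size_rotr addnC.
Qed.

Section Contract.
Variables (L : Type) (z : L) (op : L -> L -> L).
Notation contr := (contract z op).

(** The contraction of the first two letters. *)
Definition contract0 (s : seq L) : seq L :=
  if s is x :: y :: t then op x y :: t else [::].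

(** Every contraction, the cyclic one included, is conjugate by a rotation to the
    contraction of the first two letters. *)
Lemma contract_rotr j s : (j < size s)%N -> (1 < size s)%N ->
  contr j s = rotr j (contract0 (rot j s)).
Proof.
move=> js s1; rewrite /contract.
have e : size s = (size s).-1.+1 by rewrite prednK // ltnW.
case: ifP => [jn|/negbT jn].
  have jt : size (take j s) = j by rewrite size_take js.
  rewrite /rot (drop_nth z js) (@drop_nth _ z j.+1); last by rewrite e ltnS.
  rewrite [contract0 _]/= -cat_cons.
  by have := rotr_size_cat (op (nth z s j) (nth z s j.+1) :: drop j.+2 s) (take j s);
    rewrite jt.
have -> : j = (size s).-1 by lia.
move: s1; clear; case/lastP: s => [|[|x s] y] //= _.
rewrite size_rcons /= nth_rcons ltnn eqxx.
have -> : take (size s) (rcons s y) = s by rewrite -cats1 take_size_cat.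
have -> : rot (size s).+1 (x :: rcons s y) = y :: x :: s.
  by rewrite -rcons_cons -cats1 -[(size s).+1]/(size (x :: s)) rot_size_cat.
by rewrite /rotr /= subnn rot0.
Qed.

Lemma size_contract j s : (1 < size s)%N -> size (contr j s) = (size s).-1.
Proof.
move=> s1; rewrite /contract; case: ifP => h /=.
  by rewrite size_cat /= size_take size_drop; case: ifP => ?; lia.
by rewrite size_behead size_take; case: ifP => ?; lia.
Qed.

Lemma contract_cons x j s : (j.+1 < size s)%N -> contr j.+1 (x :: s) = x :: contr j s.
Proof. by move=> h; rewrite /contract /= h; case: ifP => //; lia. Qed.

Lemma contract_wrap x s y : contr (size s).+1 (x :: rcons s y) = op y x :: s.
Proof.
rewrite /contract /= size_rcons ltnn /= nth_rcons ltnn eqxx.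
by rewrite -cats1 take_size_cat.
Qed.

Lemma size_contract0 s : size (contract0 s) = (size s).-1.
Proof. by case: s => [|x [|y t]]. Qed.

Lemma contract_rotrD i j s : (i + j < size s)%N -> (1 < size s)%N ->
  contr (i + j) (rotr i s) = rotr i (contr j s).
Proof.
move=> ij s1; rewrite !contract_rotr ?size_rotr //; last by lia.
have -> : rot (i + j) (rotr i s) = rot j s.
  rewrite addnC rotD ?rotrK // size_rotr; lia.
by rewrite rotrD // size_contract0 size_rot; lia.
Qed.

Lemma contract_rotr1 s j : (j.+1 < size s)%N ->
  contr j.+1 (rotr 1 s) = rotr 1 (contr j s).
Proof. by move=> h; rewrite -add1n contract_rotrD //; lia. Qed.

Lemma contract0_rotr1 s : (1 < size s)%N -> contr 0 (rotr 1 s) = contr (size s).-1 s.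
Proof.
case/lastP: s => [|[|x s] y] //.
by move=> _; rewrite rotr1_rcons size_rcons /= contract_wrap /contract /= drop0.
Qed.

End Contract.

Section Signed.
Variables (k : comNzRingType) (L : Type).
Implicit Types (s : seq L) (p : k * seq L).

(** The signed rotation by one step: the last letter is moved to the front, with the
    sign (-1)^n for n + 1 letters. *)
Definition sgrot p : k * seq L := (p.1 * (-1) ^+ (size p.2).-1, rotr 1 p.2).

Lemma sgrot_iter l c s : (l <= size s)%N ->
  iter l sgrot (c, s) = (c * (-1) ^+ ((size s).-1 * l), rotr l s).
Proof.
elim: l => [|l IH] hl; first by rewrite muln0 mulr1 /rotr subn0 rot_size.
rewrite iterS IH ?(ltnW hl) // /sgrot /= size_rotr -mulrA -exprD.
by rewrite mulnS addnC -rotrD.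
Qed.

Lemma sgrot_full c s : iter (size s) sgrot (c, s) = (c, s).
Proof.
rewrite sgrot_iter // /rotr subnn rot0 -signr_odd oddM.
by case: (size s) => [|n] /=; rewrite ?andbN ?mulr1 // andbF mulr1.
Qed.

Lemma size_sgrot l p : size (iter l sgrot p).2 = size p.2.
Proof. by elim: l => //= l <-; rewrite size_rotr. Qed.

(** The linear extension of G, evaluated at a sequence with a coefficient. *)
Definition on_pair (V : lmodType k) (G : seq L -> V) p : V := p.1 *: G p.2.

Lemma on_pair_sgrot (V : lmodType k) (G : seq L -> V) l c s : (l <= size s)%N ->
  on_pair G (iter l sgrot (c, s)) = (c * (-1) ^+ ((size s).-1 * l)) *: G (rotr l s).
Proof. by move=> h; rewrite sgrot_iter. Qed.

Section Faces.
Variables (z : L) (op : L -> L -> L).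

(** The j-th signed contraction. *)
Definition face (j : nat) p : k * seq L := (p.1 * (-1) ^+ j, contract z op j p.2).

Lemma face_pair j c s : face j (c, s) = (c * (-1) ^+ j, contract z op j s).
Proof. by []. Qed.

Lemma face_sgrot p j : (j.+1 < size p.2)%N -> face j.+1 (sgrot p) = sgrot (face j p).
Proof.
case: p => c s /= h; rewrite /face /sgrot /= contract_rotr1 //; congr (_, _).
rewrite size_contract; last by lia.
rewrite -!mulrA -!exprD -signr_odd -[in RHS]signr_odd.
by congr (_ * _ ^+ nat_of_bool _); lia.
Qed.

Lemma face0_sgrot p : (1 < size p.2)%N -> face 0 (sgrot p) = face (size p.2).-1 p.
Proof.
by case: p => c s /= h; rewrite /face /sgrot /= contract0_rotr1 // mulr1.
Qed.

Lemma face_iter l p i : (i + l < size p.2)%N ->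
  face (i + l) (iter l sgrot p) = iter l sgrot (face i p).
Proof.
elim: l => [|l IH] h; first by rewrite addn0.
by rewrite !iterS addnS face_sgrot ?size_sgrot ?IH //; lia.
Qed.

Lemma face_iter_wrap l p j : (j < l)%N -> (l < size p.2)%N -> (1 < size p.2)%N ->
  face j (iter l sgrot p) = iter l.-1 sgrot (face (size p.2 + j - l) p).
Proof.
move=> jl ls s1.
have -> : l = (j + (1 + (l - j.+1)))%N by lia.
rewrite iterD -[j in LHS]add0n face_iter; last by rewrite size_sgrot; lia.
rewrite iterD face0_sgrot ?size_sgrot //.
have -> : (size p.2).-1 = ((size p.2 + j - (j + (1 + (l - j.+1)))) + (l - j.+1))%N by lia.
by rewrite face_iter; [rewrite -iterD; congr (iter _ _ _) | ]; lia.
Qed.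

(** The faces other than the last one of the first r rotations of p, arranged as
    rotations of the faces of p: the i-th face occurs with r rotations for i < n + 2 - r, and with r - 1 rotations
    otherwise. *)
Lemma sum_face_iter (V : zmodType) (ev : k * seq L -> V) n p r :
  size p.2 = n.+2 -> (r <= n.+2)%N ->
  \sum_(0 <= l < r) \sum_(0 <= j < n.+1) ev (face j (iter l sgrot p)) =
  \sum_(0 <= i < n.+2 - r) \sum_(0 <= l < r) ev (iter l sgrot (face i p)) +
  \sum_(n.+2 - r <= i < n.+2) \sum_(0 <= l < r.-1) ev (iter l sgrot (face i p)).
Proof.
move=> sp; elim: r => [|r IH] hr.
  rewrite subn0 [in LHS]big_geq // [X in _ + X]big_geq // addr0 big1 // => i _.
  exact: big_geq.
rewrite big_nat_recr //= IH ?(ltnW hr) //.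
have -> : (n.+2 - r = (n.+1 - r).+1)%N by lia.
rewrite subSS big_nat_recr //= (@big_ltn _ _ _ (n.+1 - r) n.+2) ?ltnS ?leq_subr //.
rewrite [X in _ = X + _](eq_bigr (fun i => \sum_(0 <= l < r) ev (iter l sgrot (face i p)) +
  ev (iter r sgrot (face i p)))); last by move=> i _; rewrite big_nat_recr.
rewrite big_split /=.
have -> : \sum_(0 <= j < n.+1) ev (face j (iter r sgrot p)) =
    \sum_(0 <= i < n.+1 - r) ev (iter r sgrot (face i p)) +
    \sum_((n.+1 - r).+1 <= i < n.+2) ev (iter r.-1 sgrot (face i p)).
  rewrite (@big_cat_nat _ _ _ r) //= addrC; congr (_ + _).
    rewrite -{1}[r]add0n big_addn; apply: eq_big_nat => i hi.
    by rewrite face_iter // sp; lia.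
  rewrite (_ : (n.+1 - r).+1 = 0 + (n.+2 - r))%N; last by lia.
  rewrite big_addn (_ : (n.+2 - (n.+2 - r) = r)%N); last by lia.
  apply: eq_big_nat => i hi; rewrite face_iter_wrap ?sp //; try lia.
  by congr (ev (iter _ _ (face _ _))); lia.
set m := (n.+1 - r)%N; set f := fun l i => ev (iter l sgrot (face i p)).
have e : \sum_(m.+1 <= i < n.+2) \sum_(0 <= l < r) f l i =
    \sum_(m.+1 <= i < n.+2) \sum_(0 <= l < r.-1) f l i +
    \sum_(m.+1 <= i < n.+2) f r.-1 i.
  rewrite -big_split /=; apply: eq_big_nat => i hi.
  have r0 : (0 < r)%N by rewrite /m in hi; lia.
  by rewrite -{1}(prednK r0) big_nat_recr.
by rewrite [in RHS]e [LHS](AC (3*2) ((1*4)*(2*(3*5)))).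
Qed.

End Faces.
End Signed.

(** * The normalized Hochschild and Connes operators *)

Section ContractAssoc.
Variables (L : Type) (z : L) (op : L -> L -> L).
Hypothesis opA : associative op.
Notation contr := (contract z op).

Lemma contract0E x y s : contr 0 (x :: y :: s) = op x y :: s.
Proof. by rewrite /contract /= drop0. Qed.

Lemma contract_cat u a b v : contr (size u) (u ++ a :: b :: v) = u ++ op a b :: v.
Proof.
elim: u => [|x u IH]; first exact: contract0E.
by rewrite cat_cons (@contract_cons _ z op x (size u)) ?IH // size_cat /=; lia.
Qed.

Lemma contract_contract0 j s : (j.+1 < size s)%N -> (2 < size s)%N ->
  contr 0 (contr j.+1 s) = contr j (contr 0 s).
Proof.
case: s => [|x [|y s]] // hj hs.
case: j hj => [|j] hj.
  case: s {hj} hs => [|u s] // _; rewrite contract_cons // !contract0E.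
  by rewrite opA.
have [hj'|hj'] := ltnP j.+1 (size s).
  by rewrite contract0E (@contract_cons _ z op x j.+1 (y :: s)) // !contract_cons // contract0E.
case/lastP: s {hs} hj hj' => [|s v] // hj hj'.
have -> : j = size s by move: hj hj'; rewrite /= size_rcons; lia.
by rewrite -rcons_cons (contract_wrap _ _ x (y :: s)) !contract0E contract_wrap opA.
Qed.

(** The simplicial identities; the cyclic face is included. *)
Lemma contract_contract i j s : (i < j < size s)%N -> (2 < size s)%N ->
  contr i (contr j s) = contr j.-1 (contr i s).
Proof.
move=> /andP[ij js] s2; have [y sE] : exists y, s = rotr i y by exists (rot i s); rewrite rotK.
rewrite {}sE size_rotr in js s2 *; have -> : j = (i + (j - i).-1.+1)%N by lia.
have c1 m : (i + m < size y)%N -> contr (i + m) (rotr i y) = rotr i (contr m y).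
  by move=> h; rewrite contract_rotrD //; lia.
rewrite c1; last by lia.
have c10 : contr i (rotr i y) = rotr i (contr 0 y) by have := c1 0; rewrite addn0; apply; lia.
rewrite c10; have c2 m u : size u = (size y).-1 -> (i + m < size u)%N ->
    contr (i + m) (rotr i u) = rotr i (contr m u).
  by move=> h h'; rewrite contract_rotrD //; lia.
rewrite addnS /= c2 ?size_contract; try lia.
have := c2 0 (contr (j - i).-1.+1 y); rewrite addn0 => ->; rewrite ?size_contract; try lia.
by rewrite contract_contract0 //; lia.
Qed.

End ContractAssoc.

(** The cancellation in b b = 0, from the simplicial identities. *)
Lemma alternating_sum (V : zmodType) n (g : nat -> nat -> V) :
  (forall i j, (i < j)%N -> (j <= n)%N -> g i j = - g j.-1 i) ->
  \sum_(0 <= j < n.+1) \sum_(0 <= i < n) g i j = 0.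
Proof.
move=> gN; rewrite exchange_big_nat /=.
rewrite (eq_big_nat _ _ (F2 := fun i => \sum_(0 <= j < n.+1 | (j <= i)%N) g i j -
   \sum_(0 <= j < n | (i <= j)%N) g j i)); last first.
  move=> i hi; rewrite (bigID (fun j => j <= i)%N) /=; congr (_ + _).
  rewrite (eq_bigl (fun j => (i < j)%N)); last by move=> j; rewrite ltnNge.
  rewrite big_mkcond /= big_nat_recl //= add0r -sumrN -big_mkcond /=.
  rewrite big_nat_cond [RHS]big_nat_cond; apply: eq_big => [j //|j /andP[h1 h2]].
  by rewrite gN //; lia.
rewrite sumrB; apply/eqP; rewrite subr_eq0; apply/eqP.
rewrite [RHS](exchange_big_dep_nat xpredT) //= !big_nat; apply: eq_bigr => i hi.
rewrite (big_cat_nat (n := i.+1)) //=; last by lia.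
rewrite [X in _ + X]big_nat_cond [X in _ + X]big_pred0 ?addr0; last by move=> j; lia.
rewrite [RHS](big_cat_nat (n := i.+1)) //=; try lia.
rewrite [X in _ = _ + X]big_nat_cond [X in _ = _ + X]big_pred0 ?addr0 //.
by move=> j; lia.
Qed.

Section Operators.
Variables (k : comNzRingType) (R : algType k) (K : {pred R}).
Hypothesis hK : GRing.subalg_closed K.
Notation cyclicR := (@cyclic k (ring_letters K) _).
Notation normalizedR := (@normalized k (ring_letters K) _).
Notation amb := (amb K).
Notation cl := (cl K).
Notation contr := (contract 0 *%R).

Lemma K1 : 1 \in K. Proof. by case: hK. Qed.

(** The extra degeneracy s_0 : x |-> 1 (x) x. *)
Definition extra (s : seq R) : amb := cl (1 :: s).

Lemma extra_killsK : @killsK k (ring_letters K) _ extra.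
Proof. by move=> s l t hl; exact: (norm_kill (cl_normalized K) 1 s). Qed.

Lemma extra_cyclic : cyclicR extra.
Proof.
have h := norm_cyclic (cl_normalized K); split.
- by move=> s; exact: (cyc_add h (1 :: s)).
- by move=> s; exact: (cyc_scale h (1 :: s)).
- by move=> s; exact: (cyc_bal h (1 :: s)).
- move=> s x l y hl.
  have /= e := cyc_turn h (y :: s) x 1 hl; rewrite /extra /= e /= mulr1.
  by have /= := cyc_bal h [::] 1 y (rcons s x) hl; rewrite mul1r => ->.
move=> x l hl; have /= e := cyc_turn h [::] x 1 hl; rewrite /extra /= e /= mulr1.
by have /= := cyc_bal h [::] 1 x [::] hl; rewrite mul1r => ->.
Qed.

Lemma cyclic_contract0 (V : lmodType k) (G : seq R -> V) : cyclicR G ->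
  cyclicR (fun s => if s is x :: y :: t then G (x * y :: t) else 0).
Proof.
move=> h; split.
- case=> [|a [|b s]] x y z t /= ->.
  + case: t => [|b t]; rewrite ?addr0 // mulrDl; exact: (cyc_add h [::]).
  + rewrite mulrDr; exact: (cyc_add h [::]).
  by rewrite -!cat_cons; exact: (cyc_add h).
- case=> [|a [|b s]] c x t /=.
  + case: t => [|b t]; rewrite ?scaler0 // -scalerAl; exact: (cyc_scale h [::]).
  + rewrite -scalerAr; exact: (cyc_scale h [::]).
  by rewrite -!cat_cons; exact: (cyc_scale h).
- case=> [|a [|b s]] x l y t hl /=.
  + by rewrite mulrA.
  + rewrite mulrA; exact: (cyc_bal h [::]).
  by rewrite -!cat_cons; exact: (cyc_bal h).
- case=> [|a s] x l y hl /=.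
  + by rewrite mulrA -[l * y * x]mulrA; exact: (cyc_turn1 h).
  by rewrite -mulrA; exact: (cyc_turn h).
by [].
Qed.

(** The Hochschild boundary. It is 0 in degree 0, where the only contraction would be
    that of a letter with itself. *)
Definition hoch_word (V : lmodType k) (G : seq R -> V) (s : seq R) : V :=
  if (1 < size s)%N then
    \sum_(0 <= j < size s) on_pair G (face 0 *%R j (1, s)) else 0.

Lemma hoch_word_cyclic (V : lmodType k) (G : seq R -> V) : cyclicR G ->
  cyclicR (hoch_word G).
Proof.
move=> hG; apply: cyclic_local => p; set N := size p.
have [N1|N1] := leqP N 1.
  exists (fun=> 0); first exact: cyclic0.
  move=> s hs; have sN : size s = N by rewrite /N -hs size_map.
  by rewrite /hoch_word sN ltnNge N1.
pose D (G' : seq R -> V) s := if s is x :: y :: t then G' (x * y :: t) else 0.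
exists (fun s => \sum_(0 <= j < N) (-1) ^+ j *:
   D (fun t => G (iter (N.-1 - j) (rot 1) t)) (iter j (rot 1) s)).
  apply: cyclic_sum => j; apply: cyclicZ.
  apply: (@cyclic_rot k (ring_letters K) V j (D (fun t => G (iter (N.-1 - j) (rot 1) t)))).
  apply: cyclic_contract0; exact: (@cyclic_rot k (ring_letters K)).
move=> s hs; have sN : size s = N by rewrite /N -hs size_map.
rewrite /hoch_word sN N1; apply: eq_big_nat => j /andP[_ jN].
have cE : contr j s = rotr j (contract0 *%R (rot j s)) by apply: contract_rotr; rewrite sN.
rewrite /on_pair face_pair cE mul1r /=; congr (_ *: _).
have rE : iter j (rot 1) s = rot j s by rewrite rot_iter // sN ltnW.
rewrite rE /D.
have : size (rot j s) = N by rewrite size_rot.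
case: (rot j s) => [|x [|y t]] /= hN; try by move: N1; rewrite -hN.
rewrite /rotr /= -rot_iter /=; last by lia.
by congr (G (rot _ _)); lia.
Qed.

(** A letter that is not involved in a contraction remains, and not in the first
    position. *)
Lemma nth_contract_kept (z : R) i j (s : seq R) : (0 < i < size s)%N -> (j < size s)%N ->
  j != i -> j.+1 != i ->
  nth z (contr j s) (if (j < i)%N then i.-1 else i) = nth z s i.
Proof.
move=> /andP[i0 iS] jS ji ji'; rewrite /contract.
have [jl|jl] := ltnP j i.
  have -> : (j < (size s).-1)%N by lia.
  rewrite nth_cat size_take jS ifF; last by lia.
  have -> : (i.-1 - j = (i - j.+2).+1)%N by lia.
  by rewrite /= nth_drop; congr nth; lia.
case: ifP => jn.
  by rewrite nth_cat size_take jS ifT ?nth_take //; lia.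
have -> : i = i.-1.+1 by lia.
by rewrite [LHS]/= nth_behead nth_take //; lia.
Qed.

Lemma hoch_word_normalized (V : lmodType k) (G : seq R -> V) : normalizedR G ->
  normalizedR (hoch_word G).
Proof.
move=> hG; split; first by case: hG => hG _; exact: hoch_word_cyclic.
suff main (x : R) (s : seq R) (l : R) t : l \in K -> hoch_word G (x :: s ++ l :: t) = 0.
  by move=> x s l t; exact: main.
move=> hl; set S := x :: s ++ l :: t.
have sS : size S = (size s + size t).+2 by rewrite /= size_cat /= addnS.
set i := (size s).+1; have Sil : nth 0 S i = l by rewrite /= nth_cat ltnn subnn.
have vanish j : (j < size S)%N -> j != i -> j.+1 != i ->
    on_pair G (face 0 *%R j (1, S)) = 0.
  move=> jS ji ji'; rewrite /on_pair /=.
  have iS : (0 < i < size S)%N by rewrite sS /i; lia.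
  have e := nth_contract_kept 0 iS jS ji ji'.
  rewrite (@normalized_nth k (ring_letters K) V G 0 _ (if (j < i)%N then i.-1 else i)) ?scaler0 //.
    rewrite size_contract; last by rewrite sS.
    by rewrite sS /i; case: ifP => ?; rewrite sS in jS; rewrite /i in ji ji' *; lia.
  by rewrite [X in lK X]e Sil.
rewrite /hoch_word sS /= (big_cat_nat (n := size s)) //=; last by lia.
rewrite [X in X + _]big_nat_cond [X in X + _]big1 ?add0r; last first.
  by move=> j hj; apply: vanish; rewrite ?sS /i; lia.
rewrite big_ltn; last by lia.
rewrite big_ltn; last by lia.
rewrite [X in _ + (_ + X)]big_nat_cond [X in _ + (_ + X)]big1 ?addr0; last first.
  by move=> j hj; apply: vanish; rewrite ?sS /i; lia.
rewrite /on_pair /= !mul1r exprS mulN1r scaleNr; apply/eqP; rewrite subr_eq0; apply/eqP.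
congr (_ *: _); rewrite /S; clear vanish Sil sS S i.
have [u [a [e su]]] : exists u a, x :: s = rcons u a /\ size u = size s.
  by exists (belast x s), (last x s); rewrite -lastI size_belast.
have -> : x :: s ++ l :: t = u ++ a :: l :: t by rewrite -cat_cons e cat_rcons.
rewrite -su contract_cat; case: t => [|b t].
  case: u {e su} => [|y u]; first exact: (cyc_turn1 hG).
  have -> : (y :: u) ++ [:: a; l] = y :: rcons (rcons u a) l by rewrite -!cats1 -catA.
  rewrite [size (y :: u)]/= -(size_rcons u a) contract_wrap cats1.
  exact: (cyc_turn hG).
rewrite -[a :: l :: _]cat1s catA -[(size u).+1](size_rcons u a) -cats1 contract_cat.
by rewrite -catA; exact: (cyc_bal hG).
Qed.

Lemma extra_rotr_kill i (s : seq R) l t : l \in K -> extra (rotr i (s ++ l :: t)) = 0.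
Proof.
move=> hl; rewrite /rotr rot_iter ?leq_subr //.
exact: (@killsK_rot k (ring_letters K) _ _ _ extra_killsK s l t hl).
Qed.

Lemma connes_word_normalized : normalizedR (fun s =>
  \sum_(0 <= l < size s) on_pair extra (iter l (@sgrot k R) (1, s))).
Proof.
apply: normalized_killsK; last first.
  suff main (s : seq R) l t : l \in K ->
    \sum_(0 <= i < size (s ++ l :: t)) on_pair extra (iter i (@sgrot k R) (1, s ++ l :: t)) = 0.
    by move=> s l t; exact: main.
  move=> hl; rewrite big_nat big1 // => j /andP[_ hj].
  by rewrite on_pair_sgrot ?(ltnW hj) // extra_rotr_kill ?scaler0.
apply: cyclic_local => p; set N := size p.
exists (fun s => \sum_(0 <= l < N) ((-1) ^+ (N.-1 * l)) *:
   (if (l < N)%N then extra (iter (N - l) (rot 1) s) else 0)).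
  apply: cyclic_sum => l; apply: cyclicZ; case: (l < N)%N; last exact: cyclic0.
  exact: (@cyclic_rot k (ring_letters K) _ _ _ extra_cyclic).
suff main (s : seq R) : size s = N ->
    \sum_(0 <= l < size s) on_pair extra (iter l (@sgrot k R) (1, s)) =
    \sum_(0 <= l < N) ((-1) ^+ (N.-1 * l)) *:
    (if (l < N)%N then extra (iter (N - l) (rot 1) s) else 0).
  by move=> s hs; apply: main; rewrite /N -hs size_map.
move=> sN; rewrite sN; apply: eq_big_nat => l /andP[_ hl].
rewrite on_pair_sgrot sN ?(ltnW hl) // mul1r hl /rotr sN rot_iter // sN.
exact: leq_subr.
Qed.

(** The Hochschild boundary and the Connes operator on the ambient module. *)
Definition hoch : {linear amb -> amb} :=
  projT1 (cid (amb_lift (hoch_word_normalized (cl_normalized K)))).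
Definition connes : {linear amb -> amb} := projT1 (cid (amb_lift connes_word_normalized)).

Lemma hochE s : hoch (cl s) = if (1 < size s)%N then
  \sum_(0 <= j < size s) on_pair cl (face 0 *%R j (1, s)) else 0.
Proof. by rewrite /hoch; case: cid => f /= ->. Qed.

Lemma connesE s : connes (cl s) =
  \sum_(0 <= l < size s) on_pair extra (iter l (@sgrot k R) (1, s)).
Proof. by rewrite /connes; case: cid => f /= ->. Qed.

Lemma hoch_pair p : hoch (on_pair cl p) = if (1 < size p.2)%N then
  \sum_(0 <= j < size p.2) on_pair cl (face 0 *%R j p) else 0.
Proof.
case: p => c s; rewrite /on_pair linearZ /= hochE; case: ifP => _; last by rewrite scaler0.
by rewrite scaler_sumr; apply: eq_bigr => j _; rewrite /on_pair /= scalerA mul1r.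
Qed.

Lemma connes_pair p : connes (on_pair cl p) =
  \sum_(0 <= l < size p.2) on_pair extra (iter l (@sgrot k R) p).
Proof.
case: p => c s; rewrite {1}/on_pair linearZ connesE [LHS]scaler_sumr.
apply: eq_big_nat => l /andP[_ hl].
by rewrite !on_pair_sgrot ?(ltnW hl) // scalerA mul1r.
Qed.

(** b s = id - t - s b', where s is the extra degeneracy, t the signed rotation, and b'
    is b without the last face. *)
Lemma hoch_extra p : (0 < size p.2)%N ->
  hoch (on_pair extra p) = on_pair cl p - on_pair cl (sgrot p) -
    \sum_(0 <= j < (size p.2).-1) on_pair extra (face 0 *%R j p).
Proof.
case: p => c s /= s0.
rewrite -[on_pair extra _]/(on_pair cl (c, 1 :: s)) hoch_pair /= ltnS s0.
rewrite big_nat_recl // -addrA; congr (_ + _).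
  case: s s0 => [|x s] // _; rewrite /on_pair /= mulr1 /contract /= mul1r.
  by rewrite drop0.
have [n sn] : exists n, size s = n.+1 by exists (size s).-1; rewrite prednK.
rewrite sn big_nat_recr //= addrC; congr (_ + _).
  rewrite /sgrot /= sn /= /on_pair /= -scaleNr; congr (_ *: cl _).
    by rewrite exprS mulN1r mulrN.
  case/lastP: s sn {s0} => [|s y] // sn; rewrite rotr1_rcons.
  have -> : n.+1 = (size s).+1 by rewrite -sn size_rcons.
  by rewrite contract_wrap mulr1.
rewrite -sumrN; apply: eq_big_nat => j /andP[_ hj].
rewrite /on_pair /= contract_cons ?sn // exprS mulN1r mulrN scaleNr.
by [].
Qed.

(** The sum of the previous relation over the first r rotations of p. *)
Lemma hoch_sum_extra r p : (0 < size p.2)%N -> (r <= size p.2)%N ->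
  hoch (\sum_(0 <= l < r) on_pair extra (iter l (@sgrot k R) p)) =
  on_pair cl p - on_pair cl (iter r (@sgrot k R) p) -
  (\sum_(0 <= i < size p.2 - r) \sum_(0 <= l < r)
      on_pair extra (iter l (@sgrot k R) (face 0 *%R i p)) +
   \sum_(size p.2 - r <= i < size p.2) \sum_(0 <= l < r.-1)
      on_pair extra (iter l (@sgrot k R) (face 0 *%R i p))).
Proof.
move=> s0 hr; rewrite linear_sum /=.
rewrite (eq_bigr (fun l => (on_pair cl (iter l (@sgrot k R) p) -
   on_pair cl (iter l.+1 (@sgrot k R) p)) - \sum_(0 <= j < (size p.2).-1)
   on_pair extra (face 0 *%R j (iter l (@sgrot k R) p)))); last first.
  by move=> l _; rewrite hoch_extra ?size_sgrot.
rewrite sumrB; congr (_ - _).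
  elim: r {hr} => [|r IH]; first by rewrite big_geq // subrr.
  by rewrite big_nat_recr //= IH addrA subrK.
have [n sn] : exists n, size p.2 = n.+1 by exists (size p.2).-1; rewrite prednK.
rewrite sn in s0 hr *; case: n sn s0 hr => [|n] sn s0 hr.
  rewrite big1; last by move=> l _; rewrite big_geq.
  case: r hr => [|[|r]] // _; rewrite ?subn0 ?subnn.
    by rewrite [X in _ = _ + X]big_geq // addr0 big_nat1 big_geq.
  by rewrite [X in _ = X + _]big_geq // add0r big_nat1 big_geq.
exact: sum_face_iter.
Qed.

Lemma hoch_hoch u : hoch (hoch u) = 0.
Proof.
pose f : {linear amb -> amb} := (hoch \o hoch : {linear _ -> _}).
rewrite -[LHS]/(f u) -[RHS]/((\0 : {linear amb -> amb}) u); apply: amb_ext => s.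
rewrite /f /= hochE; case: ifP => s1; last by rewrite raddf0.
have [n sn] : exists n, size s = n.+2 by exists (size s).-2; lia.
rewrite linear_sum /= sn; case: n sn => [|n] sn.
  by rewrite big_nat big1 // => j hj; rewrite hoch_pair /= size_contract ?sn.
rewrite (eq_big_nat _ _ (F2 := fun j => \sum_(0 <= i < n.+2)
  on_pair cl (face 0 *%R i (face 0 *%R j (1, s))))); last first.
  by move=> j hj; rewrite hoch_pair /= size_contract sn.
apply: alternating_sum => i j ij jn; rewrite /on_pair /= !mul1r -!exprD.
rewrite (contract_contract _ (@mulrA R)) ?sn; try lia.
rewrite -scaleNr; congr (_ *: _).
have -> : (j + i = (i + j.-1).+1)%N by lia.
by rewrite exprS mulN1r.
Qed.

Lemma connes_extra s : connes (extra s) = 0.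
Proof.
rewrite connesE big_nat big1 // => l /andP[_ hl].
rewrite on_pair_sgrot ?(ltnW hl) // (@extra_rotr_kill _ [::]) ?scaler0 //.
exact: K1.
Qed.

Lemma connes_connes u : connes (connes u) = 0.
Proof.
pose f : {linear amb -> amb} := (connes \o connes : {linear _ -> _}).
rewrite -[LHS]/(f u) -[RHS]/((\0 : {linear amb -> amb}) u); apply: amb_ext => s.
rewrite /f /= connesE linear_sum big1 // => l _.
by rewrite /on_pair linearZ /= connes_extra scaler0.
Qed.

Lemma hoch_connes u : hoch (connes u) + connes (hoch u) = 0.
Proof.
pose f : {linear amb -> amb} := ((hoch \o connes) \+ (connes \o hoch) : {linear _ -> _}).
rewrite -[LHS]/(f u) -[RHS]/((\0 : {linear amb -> amb}) u); apply: amb_ext => s.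
rewrite /f /= connesE; have [s0|s0] := posnP (size s).
  by rewrite (size0nil s0) hochE /= big_geq // !raddf0 addr0.
rewrite (@hoch_sum_extra (size s) (1, s)) //= sgrot_full subrr sub0r subnn big_geq // add0r.
rewrite hochE; case: ifP => s1; last first.
  have -> : size s = 1 by lia.
  by rewrite raddf0 addr0 big_nat1 big_geq // oppr0.
rewrite addrC !linear_sum /= -big_split big1 //= => i _.
by rewrite connes_pair /= size_contract // subrr.
Qed.

End Operators.

(** The shape of a contraction, whatever the operation: inside the word, or of the last
    letter with the first one. *)
Lemma contract_spec (L : Type) (z : L) j (x : seq L) : (1 < size x)%N -> (j < size x)%N ->
  (exists u a b v, [/\ x = u ++ a :: b :: v, size u = j &
     forall op, contract z op j x = u ++ op a b :: v]) \/
  (exists u a b, [/\ x = b :: rcons u a, j = (size u).+1 &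
     forall op, contract z op j x = op a b :: u]).
Proof.
move=> x1 jx; have [jn|jn] := ltnP j (size x).-1.
  left; exists (take j x), (nth z x j), (nth z x j.+1), (drop j.+2 x).
  have e : x = take j x ++ nth z x j :: nth z x j.+1 :: drop j.+2 x.
    by rewrite -!drop_nth ?cat_take_drop //; lia.
  have sj : size (take j x) = j by rewrite size_take jx.
  split=> // op; have := contract_cat z op (take j x) (nth z x j) (nth z x j.+1) (drop j.+2 x).
  by rewrite -e sj.
right; have {jn jx} -> : j = (size x).-1 by lia.
case/lastP: x x1 => [|[|b u] a] // _; exists u, a, b; rewrite size_rcons /=.
by split=> // op; exact: contract_wrap.
Qed.

(** Summing over the signed rotations to the right or to the left is the same. *)
Lemma sum_sgrot (k : comNzRingType) (L : Type) (V : lmodType k) (G : seq L -> V) (x : seq L) :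
  \sum_(0 <= l < size x) (iter l (@sgrot k L) (1, x)).1 *: G (iter l (@sgrot k L) (1, x)).2 =
  \sum_(0 <= i < size x) (-1) ^+ (i * (size x).-1)%N *: G (rot i x).
Proof.
have [->|x0] := posnP (size x); first by rewrite !big_geq.
rewrite big_ltn // [in RHS]big_ltn // mul0n rot0; congr (_ + _).
rewrite big_nat_rev; apply: eq_big_nat => i hi; rewrite add1n subSS.
rewrite sgrot_iter ?leq_subr //= mul1r /rotr subKn; last by lia.
rewrite -signr_odd -[in RHS]signr_odd; congr (_ ^+ nat_of_bool _ *: _).
have : (i <= size x)%N by lia.
case: (size x) x0 => [|n] // _ hin.
by rewrite !oddM oddB //=; case: (odd n); case: (odd i).
Qed.

(** * Tensors of degree n inside the ambient module *)

Section Graded.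
Variables (k : comNzRingType) (R : algType k) (K : {pred R}).
Notation amb := (amb K).
Notation cl := (cl K).

(** The embedding of the tensors of degree n in the ambient module, and a left
    inverse. *)
Definition Xi n : {linear cyc_tensors K n -> amb} :=
  projT1 (cid (tensor_lift n (cl_normalized K))).
Definition Pi n : {linear amb -> cyc_tensors K n} :=
  projT1 (cid (amb_lift (tensor_normalized K n))).

Lemma XiE n s : size s = n.+1 -> Xi n (tensor K n s) = cl s.
Proof. by rewrite /Xi; case: cid => f /= h; exact: h. Qed.

Lemma PiE n s : Pi n (cl s) = tensor K n s.
Proof. by rewrite /Pi; case: cid. Qed.

Lemma tensor_ext n (V : lmodType k) (f g : {linear cyc_tensors K n -> V}) :
  (forall s, size s = n.+1 -> f (tensor K n s) = g (tensor K n s)) -> forall u, f u = g u.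
Proof.
move=> fg; apply: gen_ext => t; rewrite -tensor_gen; apply: fg; exact: size_tuple.
Qed.

Lemma XiK n u : Pi n (Xi n u) = u.
Proof.
pose f : {linear cyc_tensors K n -> cyc_tensors K n} := (Pi n \o Xi n : {linear _ -> _}).
rewrite -[LHS]/(f u) -[RHS]/((idfun : {linear cyc_tensors K n -> cyc_tensors K n}) u).
by apply: tensor_ext => s hs; rewrite /f /= XiE // PiE.
Qed.

Lemma Xi_inj n : injective (Xi n). Proof. exact: can_inj (@XiK n). Qed.

Lemma hoch_bE n s : size s = n.+2 -> hoch_b K n (tensor K n.+1 s) =
  \sum_(j < n.+2) (-1) ^+ j *: tensor K n (contract 0 *%R j s).
Proof.
move: s; apply: (the_linearP (P := fun f : {linear cyc_tensors K n.+1 -> cyc_tensors K n} =>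
  forall s, size s = n.+2 -> f (tensor K n.+1 s) =
  \sum_(j < n.+2) (-1) ^+ j *: tensor K n (contract 0 *%R j s))).
exists (Pi n \o (hoch K \o Xi n.+1) : {linear _ -> _}) => s hs /=.
rewrite XiE // hochE hs /= linear_sum big_mkord; apply: eq_bigr => j _.
by rewrite /on_pair face_pair /= mul1r linearZ /= PiE.
Qed.

Lemma connes_BE n s : size s = n.+1 -> connes_B K n (tensor K n s) =
  \sum_(i < n.+1) (-1) ^+ (i * n)%N *: tensor K n.+1 (1 :: rot i s).
Proof.
move: s; apply: (the_linearP (P := fun f : {linear cyc_tensors K n -> cyc_tensors K n.+1} =>
  forall s, size s = n.+1 -> f (tensor K n s) =
  \sum_(i < n.+1) (-1) ^+ (i * n)%N *: tensor K n.+1 (1 :: rot i s))).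
exists (Pi n.+1 \o (connes K \o Xi n) : {linear _ -> _}) => s hs /=.
rewrite XiE // connesE /on_pair (sum_sgrot (extra K)) hs linear_sum big_mkord.
by apply: eq_bigr => j _; rewrite linearZ /= PiE.
Qed.

Lemma Xi_hoch_b n u : Xi n (hoch_b K n u) = hoch K (Xi n.+1 u).
Proof.
pose f : {linear _ -> amb} := (Xi n \o hoch_b K n : {linear _ -> _}).
pose g : {linear _ -> amb} := (hoch K \o Xi n.+1 : {linear _ -> _}).
rewrite -[LHS]/(f u) -[RHS]/(g u); apply: tensor_ext => s hs; rewrite /f /g /=.
rewrite hoch_bE // XiE // hochE hs /= linear_sum big_mkord; apply: eq_bigr => j _.
by rewrite linearZ /= XiE ?size_contract ?hs // /on_pair face_pair /= mul1r.
Qed.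

Lemma Xi_connes_B n u : Xi n.+1 (connes_B K n u) = connes K (Xi n u).
Proof.
pose f : {linear _ -> amb} := (Xi n.+1 \o connes_B K n : {linear _ -> _}).
pose g : {linear _ -> amb} := (connes K \o Xi n : {linear _ -> _}).
rewrite -[LHS]/(f u) -[RHS]/(g u); apply: tensor_ext => s hs; rewrite /f /g /=.
rewrite connes_BE // XiE // connesE /on_pair (sum_sgrot (extra K)) hs linear_sum big_mkord.
by apply: eq_bigr => j _; rewrite linearZ /= XiE //= size_rot hs.
Qed.

End Graded.

Section Words.
Variables (k : comNzRingType) (A : algType k) (M : bimodule A).
Variables (T : bimodule_product M) (K : {pred A}).
Hypothesis hK : GRing.subalg_closed K.

Notation E := (E_algebra T).
Notation KE := (@K_in_E k A M T K).
Notation letter := (A + M)%type.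
Notation amb := (amb KE).
Notation cl := (cl KE).
Notation lE := (letter_E T).
Notation normalizedE := (@normalized k (ring_letters KE) _).
Notation z0 := (z0 M).
Notation mul := (@lmul k A M).
Notation tri := (ltri T).
Notation isM := (@isM k A M).
Notation hoch := (@hoch k _ KE).
Notation rot_sg := (@sgrot k (A + M)%type).
Notation lastM := (@lastM k A M).
Notation w_t := (@w_t k A M).
Notation connes := (@connes k _ KE).
Notation extra := (@extra k _ KE).

(** * Words in the letters of A and M *)

Lemma linear_add (U W : lmodType k) (f : U -> W) : linear f -> {morph f : x y / x + y}.
Proof. by move=> lf x y; have := lf 1 x y; rewrite !scale1r. Qed.
Lemma linear_zero (U W : lmodType k) (f : U -> W) : linear f -> f 0 = 0.
Proof. by move=> lf; apply: (@addrI _ (f 0)); rewrite -(linear_add lf) !addr0. Qed.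
Lemma linear_scale (U W : lmodType k) (f : U -> W) : linear f ->
  forall c x, f (c *: x) = c *: f x.
Proof. by move=> lf c x; have := lf c x 0; rewrite (linear_zero lf) !addr0. Qed.

Lemma lact0 a : lact a 0 = 0 :> M. Proof. exact: linear_zero (lact_linear a). Qed.
Lemma lact0l m : lact 0 m = 0 :> M. Proof. exact: linear_zero (lact_linearl m). Qed.
Lemma ract0 m : ract m 0 = 0 :> M. Proof. exact: linear_zero (ract_linear m). Qed.
Lemma ract0l a : ract 0 a = 0 :> M. Proof. exact: linear_zero (ract_linearl a). Qed.
Lemma tri0 m : T m 0 = 0. Proof. exact: linear_zero (tri_linear T m). Qed.
Lemma tri0l m : T 0 m = 0. Proof. exact: linear_zero (tri_linearl T m). Qed.

Lemma extM (x y : E) :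
  x * y = (x.1 * y.1, lact x.1 y.2 + ract x.2 y.1 + T x.2 y.2) :> A * M.
Proof. by []. Qed.

Lemma KE_subalg : GRing.subalg_closed KE.
Proof.
have [K1' KD KM] := hK; split.
- by rewrite unfold_in /= eqxx andbT.
- move=> a [x m] [y m'] /andP[/= hx /eqP hm] /andP[/= hy /eqP hm'].
  rewrite unfold_in /= KD //=; apply/eqP.
  by rewrite hm hm' scaler0 addr0.
move=> [x m] [y m'] /andP[/= hx /eqP hm] /andP[/= hy /eqP hm'].
rewrite unfold_in; rewrite (extM (x, m) (y, m')) /= KM //= hm hm'.
by rewrite lact0 ract0l tri0 !addr0.
Qed.

(** Letters are added within A and within M only. *)
Definition letter_add (x y z : letter) : Prop :=
  match x, y, z with
  | inl a, inl b, inl c => c = a + b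
  | inr m, inr m', inr m'' => m'' = m + m'
  | _, _, _ => False
  end.

Definition letter_scale (c : k) (x : letter) : letter :=
  match x with inl a => inl (c *: a) | inr m => inr (c *: m) end.

Definition letter_K (x : letter) : Prop := if x is inl a then a \in K else False.

(** The disjoint union of A and M, with these two kinds of letters. *)
Definition word_letters : letters k.
refine (@Letters k letter letter_add letter_scale letter_K mul isM _ _ _ _).
- by move=> [a|m] [b|m'] [c|m''].
- by move=> c [].
- by move=> [a|m] [b|m'].
- by move=> [a|m] [b|m'].
Defined.

Notation cyclicW := (@cyclic k word_letters _).
Notation normalizedW := (@normalized k word_letters _).

(** The class of a word in A and M, as a tensor of E. *)
Definition W (x : seq letter) : amb := cl (map lE x).

Lemma letter_E_add x y z : letter_add x y z -> lE z = lE x + lE y.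
Proof.
by case: x y z => [a|m] [b|m'] [c|m''] //= ->; congr (_, _) => /=; rewrite addr0.
Qed.

Lemma letter_E_scale c x : lE (letter_scale c x) = c *: lE x.
Proof. by case: x => [a|m] /=; congr (_, _) => /=; rewrite scaler0. Qed.

Lemma letter_E_K x : letter_K x -> lE x \in KE.
Proof. by case: x => [a|m] //= ha; rewrite unfold_in /= ha eqxx. Qed.

(** The product of E splits into the part that keeps the number of letters in M and
    the part, given by the product of M, that lowers it by one. *)
Lemma letter_E_mul x y : lE x * lE y = lE (lmul x y) + lE (ltri T x y).
Proof.
case: x y => [a|m] [b|m']; rewrite [LHS]extM; congr (_, _) => /=;
 by rewrite ?mulr0 ?mul0r ?lact0 ?lact0l ?ract0 ?ract0l ?tri0 ?tri0l ?addr0 ?add0r.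
Qed.

Lemma letter_E_mulK x l : letter_K l ->
  (lE (lmul x l) = lE x * lE l) * (lE (lmul l x) = lE l * lE x).
Proof.
case: l => [l|m] // _.
have e y y' : ltri T y y' = z0 -> lE (lmul y y') = lE y * lE y'.
  by move=> h; rewrite letter_E_mul h addr0.
by rewrite !e //; case: x.
Qed.

Lemma W_normalized : normalizedW W.
Proof.
have [[hD hZ hB ht ht1] hk] := cl_normalized KE.
split; first split.
- by move=> s x y z t e; rewrite /W !map_cat; apply: hD; exact: letter_E_add.
- by move=> s c x t; rewrite /W !map_cat /= letter_E_scale; exact: hZ.
- move=> s x l y t e; rewrite /W !map_cat /= !(letter_E_mulK _ e).
  by apply: hB; exact: letter_E_K.
- move=> s x l y e; rewrite /W /= !map_rcons !(letter_E_mulK _ e).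
  by apply: ht; exact: letter_E_K.
- move=> x l e; rewrite /W /= !(letter_E_mulK _ e).
  by apply: ht1; exact: letter_E_K.
by move=> x s l t e; rewrite /W /= map_cat; apply: hk; exact: letter_E_K.
Qed.

(** The multilinear expansion of a simple tensor of E into words. *)
Fixpoint expand (s : seq E) : seq (seq letter) :=
  if s is e :: t then
    [seq inl e.1 :: w | w <- expand t] ++ [seq inr e.2 :: w | w <- expand t]
  else [:: [::]].

Section Expand.
Variables (V : lmodType k) (G : seq letter -> V).
(** The multilinear extension of a function on words. *)
Definition expand_sum s := \sum_(w <- expand s) G w.

End Expand.

Lemma expand_sum_cons (V : lmodType k) (G : seq letter -> V) e s :
  expand_sum G (e :: s) = expand_sum (fun w => G (inl e.1 :: w)) s +
     expand_sum (fun w => G (inr e.2 :: w)) s.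
Proof. by rewrite /expand_sum /= big_cat !big_map. Qed.

Lemma expand_sum_cat (V : lmodType k) (G : seq letter -> V) s t :
  expand_sum G (s ++ t) = expand_sum (fun w => expand_sum (fun w' => G (w ++ w')) t) s.
Proof.
elim: s G => [|e s IH] G; first by rewrite [RHS]/expand_sum big_seq1.
by rewrite cat_cons !expand_sum_cons !IH.
Qed.

Lemma eq_expand_sum (V : lmodType k) (G G' : seq letter -> V) s :
  G =1 G' -> expand_sum G s = expand_sum G' s.
Proof. by move=> e; apply: eq_bigr => w _. Qed.

Lemma expand_sum0 (V : lmodType k) s : expand_sum (fun=> 0 : V) s = 0.
Proof. exact: big1. Qed.

Lemma expand_sumD (V : lmodType k) (G G' : seq letter -> V) s :
  expand_sum (fun w => G w + G' w) s = expand_sum G s + expand_sum G' s.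
Proof. exact: big_split. Qed.

Lemma expand_sumZ (V : lmodType k) (G : seq letter -> V) c s :
  expand_sum (fun w => c *: G w) s = c *: expand_sum G s.
Proof. by rewrite /expand_sum scaler_sumr. Qed.

Lemma expand_sum_rcons (V : lmodType k) (G : seq letter -> V) e s :
  expand_sum G (rcons s e) =
    expand_sum (fun w => G (rcons w (inl e.1)) + G (rcons w (inr e.2))) s.
Proof.
rewrite -cats1 expand_sum_cat; apply: eq_expand_sum => w.
by rewrite expand_sum_cons /expand_sum !big_seq1 !cats1.
Qed.

Lemma cyc_zero (V : lmodType k) (G : seq letter -> V) s x t : cyclicW G ->
  (x = inl 0 \/ x = inr 0) -> G (s ++ x :: t) = 0.
Proof.
move=> hG hx; have e : letter_add x x x by case: hx => ->; rewrite /= addr0.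
apply: (@addrI _ (G (s ++ x :: t))).
by rewrite addr0; exact: esym (@cyc_add k word_letters V G hG s x x x t e).
Qed.

Lemma expand_normalized (V : lmodType k) (G : seq letter -> V) :
  normalizedW G -> normalizedE (expand_sum G).
Proof.
move=> hG; have [[hD hZ hB ht ht1] hk] := hG.
split; first split.
- move=> s x y z t ->; rewrite !expand_sum_cat -expand_sumD.
  apply: eq_expand_sum => w; rewrite !expand_sum_cons addrACA -!expand_sumD /=.
  apply: eq_expand_sum => w'; congr (_ + _).
    exact: (hD _ (inl _) (inl _) (inl _)).
  exact: (hD _ (inr _) (inr _) (inr _)).
- move=> s c x t; rewrite !expand_sum_cat -expand_sumZ.
  apply: eq_expand_sum => w; rewrite !expand_sum_cons scalerDr -!expand_sumZ.
  rewrite -!expand_sumD; apply: eq_expand_sum => w'; congr (_ + _).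
    exact: (hZ _ c (inl _)).
  exact: (hZ _ c (inr _)).
- move=> s x l y t /andP[l1 /eqP l2]; rewrite /= !expand_sum_cat.
  apply: eq_expand_sum => w; rewrite !expand_sum_cons !extM /= l2.
  rewrite !lact0 !ract0l !tri0 !tri0l !addr0 !add0r.
  by congr (_ + _ + (_ + _)); apply: eq_expand_sum => w';
   [apply: (hB _ (inl _) (inl _) (inl _)) | apply: (hB _ (inl _) (inl _) (inr _))
   |apply: (hB _ (inr _) (inl _) (inl _)) | apply: (hB _ (inr _) (inl _) (inr _))].
- move=> s x l y /andP[l1 /eqP l2]; rewrite /= !expand_sum_cons !expand_sum_rcons !extM /= l2.
  rewrite !lact0 !ract0l !tri0 !tri0l !addr0 !add0r.
  congr (_ + _); apply: eq_expand_sum => w; congr (_ + _).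
  + exact: (ht _ (inl _) (inl _) (inl _)).
  + exact: (ht _ (inr _) (inl _) (inl _)).
  + exact: (ht _ (inl _) (inl _) (inr _)).
  + exact: (ht _ (inr _) (inl _) (inr _)).
- move=> x l /andP[l1 /eqP l2]; rewrite /= !expand_sum_cons /expand_sum !big_seq1 !extM /= l2.
  rewrite !lact0 !ract0l !tri0 !tri0l !addr0 !add0r; congr (_ + _).
    exact: (ht1 (inl _) (inl _)).
  exact: (ht1 (inr _) (inl _)).
move=> x s l t /andP[l1 /eqP l2]; rewrite -cat_cons expand_sum_cat expand_sum_cons.
rewrite -expand_sumD -[RHS](@expand_sum0 V s); apply: eq_expand_sum => w.
rewrite !expand_sum_cons l2 -!expand_sumD -[RHS](@expand_sum0 V t).
apply: eq_expand_sum => w' /=.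
rewrite -!cat_cons !(cyc_zero _ _ (norm_cyclic hG) (or_intror erefl)) !addr0 !cat_cons.
by rewrite (hk _ w (inl l.1)) // (hk _ w (inl l.1)) // addr0.
Qed.

(** All terms of the expansion of a word but the word itself have a zero letter. *)
Lemma expand_letters (V : lmodType k) (G : seq letter -> V) (x : seq letter) :
  cyclicW G -> expand_sum G (map lE x) = G x.
Proof.
move=> hG; rewrite -[G x]/(G ([::] ++ x)).
rewrite (_ : expand_sum G _ = expand_sum (fun w => G ([::] ++ w)) (map lE x)) //.
elim: x [::] => [|l x IH] p /=; first by rewrite /expand_sum big_seq1.
have e0 : forall z, z = inl 0 \/ z = inr 0 ->
    expand_sum (fun w => G (p ++ z :: w)) (map lE x) = 0.
  move=> z hz; rewrite -[RHS](@expand_sum0 V (map lE x)); apply: eq_expand_sum => w.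
  exact: cyc_zero.
rewrite expand_sum_cons; case: l => [a|m] /=.
  rewrite (e0 (inr 0)) ?addr0; last by right.
  by have := IH (rcons p (inl a)); rewrite cat_rcons => <-; apply: eq_expand_sum => w;
   rewrite cat_rcons.
rewrite (e0 (inl 0)) ?add0r; last by left.
by have := IH (rcons p (inr m)); rewrite cat_rcons => <-; apply: eq_expand_sum => w;
   rewrite cat_rcons.
Qed.

(** A linear map on the ambient module may be prescribed on words. *)
Lemma word_lift (V : lmodType k) (G : seq letter -> V) : normalizedW G ->
  exists F : {linear amb -> V}, forall x, F (W x) = G x.
Proof.
move=> hG; have [F hF] := amb_lift (expand_normalized hG).
by exists F => x; rewrite hF expand_letters //; exact: norm_cyclic hG.
Qed.

Lemma cl_words s : cl s = expand_sum W s.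
Proof.
have [F hF] := amb_lift (expand_normalized W_normalized).
have h : forall p t, cl (map lE p ++ t) = expand_sum (fun w => W (p ++ w)) t.
  move=> p t; elim: t p => [|e t IH] p; first by rewrite /expand_sum big_seq1 !cats0.
  have := cyc_add (norm_cyclic (cl_normalized KE)) (map lE p)
     (x := (e.1, 0) : E) (y := (0, e.2) : E) (z := e) t.
  move=> -> /=; last by case: (e) => a m; congr (_, _); rewrite /= ?addr0 ?add0r.
  rewrite expand_sum_cons; congr (_ + _).
    have := IH (rcons p (inl e.1)); rewrite map_rcons cat_rcons => ->.
    by apply: eq_expand_sum => w; rewrite cat_rcons.
  have := IH (rcons p (inr e.2)); rewrite map_rcons cat_rcons => ->.
  by apply: eq_expand_sum => w; rewrite cat_rcons.
exact: (h [::]).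
Qed.

(** A linear map on the ambient module is determined by its values on words. *)
Lemma word_ext (V : lmodType k) (f g : {linear amb -> V}) :
  (forall x, f (W x) = g (W x)) -> forall u, f u = g u.
Proof.
move=> fg; apply: amb_ext => s; rewrite cl_words /expand_sum !linear_sum.
by apply: eq_bigr => w _.
Qed.

Lemma size_expand s w : w \in expand s -> size w = size s.
Proof.
elim: s w => [|e s IH] w /=; first by rewrite inE => /eqP->.
by rewrite mem_cat => /orP[] /mapP[v hv ->] /=; rewrite (IH v).
Qed.

(** * Operators on words *)

(** The word has a zero letter in A; its class is 0. *)
Definition null (x : seq letter) := exists s t, x = s ++ inl 0 :: t.

Lemma cyclic_null (V : lmodType k) (G : seq letter -> V) x : cyclicW G -> null x -> G x = 0.
Proof. by move=> hG [s [t ->]]; apply: (cyc_zero _ _ hG); left. Qed.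

Lemma W_null x : null x -> W x = 0.
Proof. exact: cyclic_null (norm_cyclic W_normalized). Qed.

Section Lifts.
Variables (V : lmodType k) (G : seq letter -> V) (hG : normalizedW G).
(** The linear map with prescribed values on words. *)
Definition lift_words : {linear amb -> V} := projT1 (cid (word_lift hG)).
Lemma lift_wordsE x : lift_words (W x) = G x.
Proof. by rewrite /lift_words; case: cid. Qed.
End Lifts.

(** The kinds of the letters are respected by the relations, so a linear map may be
    chosen for each sequence of kinds. *)
Lemma proj_normalized (V : lmodType k) (F : seq bool -> {linear amb -> V}) :
  normalizedW (fun x => F (map isM x) (W x)).
Proof.
have hW := W_normalized; split.
  apply: cyclic_local => p; exists (fun x => F p (W x)); last by move=> s <-.
  have [[hD hZ hB ht ht1] _] := hW; split.
  - by move=> s x y z t e; rewrite (hD _ _ _ _ _ e) linearD.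
  - by move=> s c x t; rewrite hZ linearZ.
  - by move=> s x l y t e; rewrite hB.
  - by move=> s x l y e; rewrite ht.
  - by move=> x l e; rewrite ht1.
by move=> x s l t e; rewrite (norm_kill hW) // raddf0.
Qed.

(** The projection on the words whose sequence of kinds satisfies q. *)
Definition projW (q : pred (seq bool)) : {linear amb -> amb} :=
  lift_words (proj_normalized (fun p =>
    if q p then (idfun : {linear amb -> amb}) else (\0 : {linear amb -> amb}))).

Lemma projWE q x : projW q (W x) = if q (map isM x) then W x else 0.
Proof. by rewrite /projW lift_wordsE; case: ifP. Qed.

(** The projection on the words with c letters in M. *)
Definition projC (c : nat) := projW (fun p => count id p == c).
(** The projection on the words with x_0 in M (b = true) or in A (b = false). *)
Definition projH (b : bool) := projW (fun p => head false p == b).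

Lemma count_kinds (x : seq letter) : count id (map isM x) = count isM x.
Proof. by rewrite count_map. Qed.

Lemma head_kinds (x : seq letter) : head false (map isM x) = isM (head z0 x).
Proof. by case: x. Qed.

Lemma projCE c x : projC c (W x) = if count isM x == c then W x else 0.
Proof. by rewrite /projC projWE count_kinds. Qed.

Lemma projHE b x : projH b (W x) = if isM (head z0 x) == b then W x else 0.
Proof. by rewrite /projH projWE head_kinds. Qed.

(** The part of the Hochschild boundary that preserves the number of letters in M,
    and its complement, which lowers this number by one. *)
Definition D0 : {linear amb -> amb} :=
  lift_words (proj_normalized (fun p => projC (count id p) \o hoch : {linear _ -> _})).
Definition D1 : {linear amb -> amb} :=
  lift_words (proj_normalized (fun p =>
    hoch \- (projC (count id p) \o hoch : {linear amb -> amb}) : {linear _ -> _})).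

Lemma D1E u : D1 u = hoch u - D0 u.
Proof.
pose f : {linear amb -> amb} := hoch \- D0.
rewrite -[RHS]/(f u); apply: word_ext => x.
by rewrite /D1 lift_wordsE /f /= /D0 lift_wordsE.
Qed.

(** The j-th contraction of a word, with its sign. *)
Definition term op j x : amb := (-1) ^+ j *: W (contract z0 op j x).

Lemma contract_letters (V : lmodType k) (G : seq (E_algebra T) -> V) j (x : seq letter) :
  @cyclic k (ring_letters KE) V G -> (1 < size x)%N -> (j < size x)%N ->
  G (contract 0 *%R j (map lE x)) =
  G (map lE (contract z0 mul j x)) + G (map lE (contract z0 tri j x)).
Proof.
move=> hG x1 jx; case: (contract_spec z0 x1 jx).
  move=> [u [a [b [v [xE ju cE]]]]]; rewrite !cE xE !map_cat /= -ju -(size_map lE u).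
  rewrite contract_cat letter_E_mul; exact: (cyc_add hG).
move=> [u [a [b [xE ju cE]]]]; rewrite !cE xE ju /= map_rcons -(size_map lE u).
rewrite contract_wrap letter_E_mul; exact: (cyc_add hG [::]).
Qed.

Lemma hoch_W x : hoch (W x) = if (1 < size x)%N then
  \sum_(0 <= j < size x) (term mul j x + term tri j x) else 0.
Proof.
rewrite /W hochE size_map; case: ifP => // x1; apply: eq_big_nat => j /andP[_ jx].
rewrite /on_pair face_pair /= mul1r contract_letters // ?scalerDr //.
exact: norm_cyclic (cl_normalized _).
Qed.

Lemma mul_count j x : (1 < size x)%N -> (j < size x)%N ->
  null (contract z0 mul j x) \/ count isM (contract z0 mul j x) = count isM x.
Proof.
move=> x1 jx; case: (contract_spec z0 x1 jx).
  move=> [u [a [b [v [xE ju cE]]]]]; rewrite cE xE !count_cat /=.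
  case: a b {xE cE} => [a|m] [b|m'] /=; try by right.
  by left; exists u, v.
move=> [u [a [b [xE ju cE]]]]; rewrite cE xE /= -cats1 count_cat /=.
case: a b {xE cE} => [a|m] [b|m'] /=; try by right; lia.
by left; exists [::], u.
Qed.

Lemma tri_count j x : (1 < size x)%N -> (j < size x)%N ->
  null (contract z0 tri j x) \/ (count isM (contract z0 tri j x)).+1 = count isM x.
Proof.
move=> x1 jx; case: (contract_spec z0 x1 jx).
  move=> [u [a [b [v [xE ju cE]]]]]; rewrite cE xE !count_cat /=.
  case: a b {xE cE} => [a|m] [b|m'] /=; try by left; exists u, v.
  by right; lia.
move=> [u [a [b [xE ju cE]]]]; rewrite cE xE /= -cats1 count_cat /=.
case: a b {xE cE} => [a|m] [b|m'] /=; try by left; exists [::], u.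
by right; lia.
Qed.

Lemma projC_mul j x : (1 < size x)%N -> (j < size x)%N ->
  projC (count isM x) (term mul j x) = term mul j x.
Proof.
move=> x1 jx; rewrite /term linearZ /= projCE.
by case: (mul_count x1 jx) => [/W_null->|->]; rewrite ?eqxx // if_same.
Qed.

Lemma projC_tri c j x : (1 < size x)%N -> (j < size x)%N ->
  projC c (term tri j x) = if c.+1 == count isM x then term tri j x else 0.
Proof.
move=> x1 jx; rewrite /term linearZ /= projCE.
case: (tri_count x1 jx) => [/W_null->|<-]; first by rewrite if_same scaler0 if_same.
by rewrite eqSS [c == _]eq_sym; case: ifP => //; rewrite scaler0.
Qed.

Lemma D0_W x : D0 (W x) = if (1 < size x)%N then \sum_(0 <= j < size x) term mul j x else 0.
Proof.
rewrite /D0 lift_wordsE /= count_kinds hoch_W; case: ifP => x1; last by rewrite raddf0.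
rewrite linear_sum; apply: eq_big_nat => j /andP[_ jx].
by rewrite linearD /= projC_mul // projC_tri // gtn_eqF // addr0.
Qed.

Lemma D1_W x : D1 (W x) = if (1 < size x)%N then \sum_(0 <= j < size x) term tri j x else 0.
Proof.
rewrite D1E D0_W hoch_W; case: ifP => _; last by rewrite subrr.
by rewrite big_split /= addrAC subrr add0r.
Qed.

(** * The map vartheta *)

(** The extra degeneracy on words. *)
Definition extW (x : seq letter) : amb := W (inl 1 :: x).

Lemma extW_extra x : extW x = extra (map lE x). Proof. by []. Qed.

Lemma on_pair_map (V : lmodType k) (G : seq E -> V) l c x :
  on_pair G (iter l (@sgrot k _) (c, map lE x)) =
  on_pair (fun y => G (map lE y)) (iter l rot_sg (c, x)).
Proof.
have h : iter l (@sgrot k _) (c, map lE x) =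
    ((iter l rot_sg (c, x)).1, map lE (iter l rot_sg (c, x)).2).
  by elim: l => //= l ->; rewrite /sgrot /= map_rotr size_map.
by rewrite h.
Qed.

Lemma on_pair_extW l c x : on_pair extW (iter l rot_sg (c, x)) =
  on_pair extra (iter l (@sgrot k _) (c, map lE x)).
Proof. by rewrite on_pair_map. Qed.

Lemma extW_kill i (s : seq letter) l t : letter_K l -> extW (rotr i (s ++ l :: t)) = 0.
Proof.
move=> hl; rewrite extW_extra map_rotr map_cat /=; apply: extra_rotr_kill.
exact: letter_E_K.
Qed.

Lemma on_pair_scale (V : lmodType k) (G : seq letter -> V) l c x :
  on_pair G (iter l rot_sg (c, x)) = c *: on_pair G (iter l rot_sg (1, x)).
Proof.
have h : iter l rot_sg (c, x) = (c * (iter l rot_sg (1, x)).1, (iter l rot_sg (1, x)).2).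
  by elim: l => [|l IH] /=; [rewrite mulr1 | rewrite IH /sgrot /= mulrA].
by rewrite h /on_pair scalerA.
Qed.

(** The number of rotations by one step that bring the last letter in M to the head,
    which is the number of terms of vartheta. (It is the length of the word if there is
    no letter in M.) *)
Definition vtail (x : seq letter) : nat := (size x - lastM x)%N.

Lemma vtail_le x : (vtail x <= size x)%N. Proof. exact: leq_subr. Qed.

(** The sum of 1 (x) y over the first r signed rotations y of x. *)
Definition Vsum r (x : seq letter) : amb :=
  \sum_(0 <= l < r) on_pair extW (iter l rot_sg (1, x)).

Lemma lastM_kinds x : lastM x = ((size (map isM x)).-1 - find id (rev (map isM x)))%N.
Proof. by rewrite /Defs.lastM /Defs.deg size_map -map_rev find_map. Qed.

(** The number of terms depends on the kinds of the letters only, and each of them is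
    cyclic; letters in K are killed because the prefix 1 occupies the position 0. *)
Lemma V_normalized : normalizedW (fun x => Vsum (vtail x) x).
Proof.
apply: normalized_killsK; last first.
  suff main (s : seq letter) l t : letter_K l -> Vsum (vtail (s ++ l :: t)) (s ++ l :: t) = 0.
    by move=> s l t; exact: main.
  move=> hl; rewrite /Vsum big_nat big1 // => j /andP[_ hj].
  rewrite on_pair_sgrot ?extW_kill ?scaler0 //.
  exact: leq_trans (ltnW hj) (vtail_le _).
apply: cyclic_local => p; set N := size p.
pose r := (N - (N.-1 - find id (rev p)))%N.
exists (fun s => \sum_(0 <= l < r) ((-1) ^+ (N.-1 * l)) *: (extW (iter (N - l) (rot 1) s))).
  apply: cyclic_sum => l; apply: cyclicZ.
  apply: (@cyclic_rot k word_letters _ (N - l) extW).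
  have [[hD hZ hB ht ht1] _] := W_normalized.
  have h := @extra_cyclic k _ KE.
  split.
  - by move=> s x y z t; exact: (hD (inl 1 :: s)).
  - by move=> s c x t; exact: (hZ (inl 1 :: s)).
  - by move=> s x l' y t; exact: (hB (inl 1 :: s)).
  - move=> s x l' y e; rewrite !extW_extra /= !map_rcons /= !(letter_E_mulK _ e).
    by apply: (cyc_turn h); exact: letter_E_K.
  move=> x l' e; rewrite !extW_extra /= !(letter_E_mulK _ e).
  by apply: (cyc_turn1 h); exact: letter_E_K.
suff main (s : seq letter) : map isM s = p -> Vsum (vtail s) s =
    \sum_(0 <= l < r) ((-1) ^+ (N.-1 * l)) *: (extW (iter (N - l) (rot 1) s)).
  by move=> s hs; exact: main.
move=> hs; have sN : size s = N by rewrite /N -hs size_map.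
have -> : vtail s = r by rewrite /vtail lastM_kinds hs sN.
apply: eq_big_nat => l /andP[_ hl].
have lN : (l <= N)%N by apply: leq_trans (ltnW hl) _; exact: leq_subr.
rewrite on_pair_sgrot sN // mul1r /rotr sN rot_iter // sN.
exact: leq_subr.
Qed.

(** The map vartheta, on all words. *)
Definition Vop : {linear amb -> amb} := lift_words V_normalized.

Lemma VopE x : Vop (W x) = Vsum (vtail x) x.
Proof. exact: lift_wordsE. Qed.

Lemma null_rot x l : null x -> extW (rotr l x) = 0.
Proof.
move=> [s [t ->]]; apply: extW_kill => /=; case: hK => _ KD _.
by rewrite -[0](subrr 1) -scaleN1r addrC; apply: KD; exact: K1.
Qed.

Lemma Vsum_null r x : null x -> (r <= size x)%N -> Vsum r x = 0.
Proof.
move=> nx rx; rewrite /Vsum big_nat big1 // => l /andP[_ hl].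
by rewrite on_pair_sgrot ?null_rot ?scaler0 // (leq_trans (ltnW hl)).
Qed.

(** A word that starts with 1 has it in a position other than the first after
    rotating and prefixing 1. This is why vartheta vartheta and vartheta B are 0. *)
Lemma Vop_ext x : Vop (extW x) = 0.
Proof.
rewrite VopE /Vsum big_nat big1 // => l /andP[_ hl].
rewrite on_pair_sgrot; last by apply: leq_trans (ltnW hl) (vtail_le _).
by rewrite (@extW_kill _ [::]) ?scaler0 //=; exact: (K1 hK).
Qed.

Lemma Vop_Vop u : Vop (Vop u) = 0.
Proof.
pose f : {linear amb -> amb} := (Vop \o Vop : {linear _ -> _}).
rewrite -[LHS]/(f u) -[RHS]/((\0 : {linear amb -> amb}) u); apply: word_ext => x.
rewrite /f [LHS]/= VopE linear_sum big1 // => l _.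
by rewrite /on_pair linearZ /= Vop_ext scaler0.
Qed.

Lemma connes_Vop u : connes (Vop u) = 0.
Proof.
pose f : {linear amb -> amb} := (connes \o Vop : {linear _ -> _}).
rewrite -[LHS]/(f u) -[RHS]/((\0 : {linear amb -> amb}) u); apply: word_ext => x.
rewrite /f [LHS]/= VopE linear_sum big1 // => l _.
by rewrite /on_pair linearZ /= extW_extra (connes_extra KE_subalg) scaler0.
Qed.

Lemma connes_W x : connes (W x) = Vsum (size x) x.
Proof.
rewrite connesE size_map; apply: eq_bigr => l _; by rewrite on_pair_extW.
Qed.

Lemma Vop_connes u : Vop (connes u) = 0.
Proof.
pose f : {linear amb -> amb} := (Vop \o connes : {linear _ -> _}).
rewrite -[LHS]/(f u) -[RHS]/((\0 : {linear amb -> amb}) u); apply: word_ext => x.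
rewrite /f [LHS]/= connes_W linear_sum big1 // => l _.
by rewrite /on_pair linearZ /= Vop_ext scaler0.
Qed.

Lemma last_M x : has isM x -> exists u m t, x = u ++ inr m :: t /\ ~~ has isM t.
Proof.
elim/last_ind: x => [|x [a|m] IH] //; rewrite has_rcons /=.
  move=> /IH[u [m [t [-> ht]]]]; exists u, m, (rcons t (inl a)).
  by rewrite rcons_cat has_rcons.
by move=> _; exists x, m, [::]; rewrite cats1.
Qed.

Lemma lastM_cat u m t : ~~ has isM t -> lastM (u ++ inr m :: t) = size u.
Proof.
move=> ht; rewrite /Defs.lastM /Defs.deg size_cat /= addnS /=.
rewrite rev_cat rev_cons cat_rcons find_cat has_rev (negbTE ht).
by rewrite /= addn0 size_rev addnK.
Qed.

Lemma vtail_cat u m t : ~~ has isM t -> vtail (u ++ inr m :: t) = (size t).+1.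
Proof. by move=> ht; rewrite /vtail lastM_cat // size_cat addKn. Qed.

(** t is a power of the rotation by one step, with the right sign. *)
Lemma w_tE p : (0 < size p.2)%N -> w_t p = iter (vtail p.2) rot_sg p.
Proof.
case: p => c x /= x0; rewrite /Defs.w_t /= sgrot_iter ?vtail_le //.
have l0 : (lastM x < size x)%N by rewrite /Defs.lastM /Defs.deg; lia.
rewrite /rotr /vtail subKn ?(ltnW l0) //; congr (_ * _, _).
rewrite -signr_odd -[RHS]signr_odd; congr (_ ^+ nat_of_bool _).
rewrite /Defs.deg; case: (size x) x0 l0 => [|n] //= _ l0.
by rewrite !oddM oddB /= ?(ltnW l0) //; case: (odd n); case: (odd (lastM x)).
Qed.

Lemma extra_contract l i x : (1 < size x)%N -> (i < size x)%N -> (l < size x)%N ->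
  on_pair extra (iter l (@sgrot k _) (face 0 *%R i (1, map lE x))) =
  (-1) ^+ i *: (on_pair extW (iter l rot_sg (1, contract z0 mul i x)) +
                on_pair extW (iter l rot_sg (1, contract z0 tri i x))).
Proof.
move=> x1 ix lx; rewrite face_pair mul1r on_pair_sgrot; last first.
  by rewrite size_contract size_map //; lia.
rewrite !on_pair_sgrot ?size_contract ?size_map ?mul1r //; try lia.
rewrite -scalerDr scalerA; congr (_ *: _).
rewrite /rotr !size_contract ?size_map // !extW_extra.
have e s : size s = (size x).-1 -> rot ((size x).-1 - l) s = iter ((size x).-1 - l) (rot 1) s.
  by move=> ss; rewrite rot_iter // ss leq_subr.
rewrite rot_iter ?size_contract ?size_map ?leq_subr //.
pose G s := extra (iter ((size x).-1 - l) (rot 1) s).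
rewrite -[LHS]/(G _) (@contract_letters) //; last first.
  exact: (@cyclic_rot k (ring_letters KE) _ _ _ (@extra_cyclic k _ KE)).
by rewrite /G -!rot_iter ?size_map ?size_contract ?leq_subr // !map_rot.
Qed.

(** A contraction to the left of the last letter in M keeps the letters after it. *)
Lemma contract_lo op u m t i : op = mul \/ op = tri -> (i < size u)%N ->
  null (contract z0 op i (u ++ inr m :: t)) \/
  exists u' m', contract z0 op i (u ++ inr m :: t) = u' ++ inr m' :: t.
Proof.
move=> hop iu.
have [u1 [a [u2 [-> <-]]]] : exists u1 a u2, u = u1 ++ a :: u2 /\ size u1 = i.
  exists (take i u), (nth z0 u i), (drop i.+1 u).
  by rewrite -drop_nth // cat_take_drop size_take iu.
rewrite -catA /=; case: u2 => [|b u2] /=.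
  rewrite contract_cat; case: hop => ->; case: a => [a|m'] /=.
  - by right; exists u1, (lact a m).
  - by left; exists u1, t.
  - by left; exists u1, t.
  by right; exists u1, (T m' m).
by rewrite contract_cat -cat_cons catA; right; exists (u1 ++ op a b :: u2), m.
Qed.

(** A contraction to the right of the last letter in M, or a contraction of this letter
    with the next one, leaves one letter less after it for the product of A and the
    action, and it is 0 for the product of M. *)
Lemma contract_hi u m t i : ~~ has isM t -> t != [::] ->
  (size u <= i < size (u ++ inr m :: t))%N ->
  vtail (contract z0 mul i (u ++ inr m :: t)) = size t /\
  null (contract z0 tri i (u ++ inr m :: t)).
Proof.
move=> ht t0 /andP[ui iN].
have [iu|iu] := eqVneq i (size u).
  case: t t0 ht {iN} => [|[b|m'] t] // _ ht; rewrite iu !contract_cat /=; split.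
    by rewrite vtail_cat.
  by exists u, t.
have [j ij] : exists j, i = (size u + j.+1)%N by exists (i - (size u).+1)%N; lia.
have jt : (j < size t)%N by move: iN; rewrite size_cat /= ij; lia.
have [t1 [a [t2 [tE tj]]]] : exists t1 a t2, t = t1 ++ inl a :: t2 /\ size t1 = j.
  have : ~~ isM (nth z0 t j) by apply: (hasPn ht); exact: mem_nth.
  case E: (nth z0 t j) => [a|] // _; exists (take j t), a, (drop j.+1 t).
  by rewrite -E -drop_nth // cat_take_drop size_take jt.
move: ht; rewrite tE has_cat negb_or => /andP[ht1 ht2].
case: t2 tE ht2 => [|[b|//] t2] tE ht2.
  case: u ui iN ij iu => [|b u] ui iN ij iu.
    rewrite cats1 ij /= -tj -[X in contract _ _ X _]add0n /= add0n.
    rewrite -rcons_cons !(@contract_wrap _ _ _ (inr m) t1 (inl a)) /=.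
    split; last by exists [::], t1.
    by rewrite (@vtail_cat [::]) // size_rcons.
  have -> : (b :: u) ++ inr m :: t1 ++ [:: inl a] = b :: rcons (u ++ inr m :: t1) (inl a).
    by rewrite -cats1 -catA.
  have -> : i = (size (u ++ inr m :: t1)).+1 by rewrite ij -tj size_cat /= addSn.
  rewrite !contract_wrap; split; last by case: (b) => ?; exists [::], (u ++ inr m :: t1).
  by rewrite -cat_cons vtail_cat // size_cat addn1.
have -> : u ++ inr m :: t1 ++ [:: inl a, inl b & t2] =
    (u ++ inr m :: t1) ++ [:: inl a, inl b & t2] by rewrite -catA.
have -> : i = size (u ++ inr m :: t1) by rewrite ij -tj size_cat.
rewrite !contract_cat /=; split; last by exists (u ++ inr m :: t1), t2.
rewrite -catA vtail_cat; last by rewrite has_cat negb_or ht1.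
by rewrite !size_cat /=; lia.
Qed.

(** The contractions that occur after rotating in the boundary of vartheta: bsharp for
    the action and the product of A, dsharp for the product of M. These are all the
    contractions except for the cyclic one x_n x_0, which occurs in bsharp when x_n is in
    A only, and not at all in dsharp. *)
Definition bsharp (x : seq letter) : amb :=
  \sum_(0 <= i < (size x).-1) term mul i x +
  (if (1 < vtail x)%N then term mul (size x).-1 x else 0).
Definition dsharp (x : seq letter) : amb := \sum_(0 <= i < (size x).-1) term tri i x.

Lemma Vop_term op j x : Vop (term op j x) =
  (-1) ^+ j *: Vsum (vtail (contract z0 op j x)) (contract z0 op j x).
Proof. by rewrite /term linearZ /= VopE. Qed.

(** The main computation. The sum over the first vtail x rotations of the relation
    b s = id - t - s b' telescopes to id - t, and the faces of the rotations of x are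
    rotations of the faces of x. The number of rotations of the i-th face that occur is
    the number of terms of vartheta of this face, because a contraction to the right of
    the last letter in M reduces both numbers by one. *)
Lemma hoch_Vop x : has isM x ->
  hoch (Vop (W x)) = W x - on_pair W (w_t (1, x)) - (Vop (bsharp x) + Vop (dsharp x)).
Proof.
move=> hx; have [u [m [t [xE ht]]]] := last_M hx.
have x0 : (0 < size x)%N by rewrite xE size_cat /= addnS.
have vx : vtail x = (size t).+1 by rewrite xE vtail_cat.
have sx : size x = (size u + (size t).+1)%N by rewrite xE size_cat.
rewrite VopE w_tE // vx /Vsum.
rewrite (eq_bigr (fun l => on_pair extra (iter l (@sgrot k _) (1, map lE x)))); last first.
  by move=> l _; rewrite on_pair_extW.
have s0 : (0 < size ((1%R : k), map lE x).2)%N by rewrite size_map.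
have sr : ((size t).+1 <= size ((1%R : k), map lE x).2)%N by rewrite size_map sx leq_addl.
have smx : size ((1%R : k), map lE x).2 = size x by rewrite size_map.
rewrite (hoch_sum_extra _ s0 sr) smx on_pair_map {s0 sr smx}.
congr (_ - _ - _); first by rewrite /on_pair /= scale1r.
rewrite /bsharp /dsharp vx sx addnK.
pose S r op i := (-1) ^+ i *: Vsum r (contract z0 op i x).
have SE r i : (i < size x)%N -> (r <= (size t).+1)%N -> (0 < r -> 1 < size x)%N -> (r < size x)%N ||
    (i < size u)%N ->
    \sum_(0 <= l < r) on_pair extra (iter l (@sgrot k _) (face 0 *%R i (1, map lE x))) =
    S r mul i + S r tri i.
  move=> ix rt r1 rx; rewrite /S /Vsum -scalerDr -big_split /= scaler_sumr.
  apply: eq_big_nat => l /andP[_ lr]; rewrite extra_contract ?r1 //; lia.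
have lo op i : op = mul \/ op = tri -> (i < size u)%N ->
    S (size t).+1 op i = Vop (term op i x).
  move=> hop iu; rewrite Vop_term /S; congr (_ *: _).
  have ix : (i < size x)%N by rewrite sx; lia.
  have x1 : (1 < size x)%N by rewrite sx; lia.
  case: (contract_lo m t hop iu); rewrite -xE.
    move=> nx; rewrite !Vsum_null ?vtail_le // size_contract // sx; lia.
  by move=> [u' [m' ->]]; rewrite vtail_cat.
have hi i : (0 < size t)%N -> (size u <= i < size x)%N ->
    S (size t) mul i = Vop (term mul i x) /\ S (size t) tri i = 0 /\ term tri i x = 0.
  move=> t0 /[dup] iux; rewrite xE => hi.
  have := contract_hi ht _ hi; rewrite -xE -size_eq0 -lt0n => /(_ t0) [vi ni].
  rewrite Vop_term vi; split=> //; rewrite /term /S W_null // scaler0; split=> //.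
  rewrite Vsum_null ?scaler0 // size_contract; lia.
case: (posnP (size t)) => t0.
  rewrite t0 /= addn1 /= addr0 big_nat1 [X in _ + X = _]big_geq // addr0.
  rewrite !linear_sum -big_split /=; apply: eq_big_nat => i /andP[_ iu].
  rewrite SE ?sx ?t0 ?addn1 ?iu ?orbT //; try lia.
  by rewrite -!lo ?t0; auto.
have NE : (size u + (size t).+1).-1.+1 = size x by rewrite sx addnS.
set N1 := (_.-1) in NE *.
have bE : \sum_(0 <= i < N1) term mul i x + (if (1 < (size t).+1)%N then term mul N1 x else 0) =
    \sum_(0 <= i < size x) term mul i x.
  by rewrite ltnS t0 -NE big_nat_recr.
have dE : \sum_(0 <= i < N1) term tri i x = \sum_(0 <= i < size x) term tri i x.
  have N1x : (size u <= N1 < size x)%N by rewrite -NE /N1; lia.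
  by rewrite -NE big_nat_recr //= (proj2 (proj2 (hi N1 t0 N1x))) addr0.
rewrite bE dE !linear_sum -big_split /= -sx [in RHS](big_cat_nat (n := size u)) //=; last by lia.
congr (_ + _); apply: eq_big_nat => i hi'.
  by rewrite SE ?sx ?lo //; try lia; auto.
have [h1 [h2 h3]] := hi i t0 hi'.
by rewrite SE ?h1 ?h2 ?h3 ?raddf0 //; lia.
Qed.

(** * Vartheta and the number of letters in M; the maps theta and N *)

Lemma count_rotr l (x : seq letter) : count isM (rotr l x) = count isM x.
Proof. by apply/permP; rewrite perm_rotr. Qed.
Lemma count_rot l (x : seq letter) : count isM (rot l x) = count isM x.
Proof. by apply/permP; rewrite perm_rot. Qed.

Lemma projC_Vop c u : projC c (Vop u) = Vop (projC c u).
Proof.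
pose f : {linear amb -> amb} := (projC c \o Vop : {linear _ -> _}).
pose g : {linear amb -> amb} := (Vop \o projC c : {linear _ -> _}).
rewrite -[LHS]/(f u) -[RHS]/(g u); apply: word_ext => x; rewrite /f /g /= VopE projCE.
rewrite /Vsum linear_sum /=; transitivity (\sum_(0 <= l < vtail x)
   (if count isM x == c then on_pair extW (iter l rot_sg (1, x)) else 0)).
  apply: eq_big_nat => l /andP[_ hl].
  rewrite on_pair_sgrot; last by apply: leq_trans (ltnW hl) (vtail_le _).
  by rewrite linearZ /= projCE /= add0n count_rotr; case: ifP => //; rewrite scaler0.
by case: ifP => _; [rewrite VopE | rewrite big1 ?raddf0].
Qed.

Lemma projC_connes c u : projC c (connes u) = connes (projC c u).
Proof.
pose f : {linear amb -> amb} := (projC c \o connes : {linear _ -> _}).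
pose g : {linear amb -> amb} := (connes \o projC c : {linear _ -> _}).
rewrite -[LHS]/(f u) -[RHS]/(g u); apply: word_ext => x; rewrite /f /g /= connes_W projCE.
rewrite /Vsum linear_sum /=; transitivity (\sum_(0 <= l < size x)
   (if count isM x == c then on_pair extW (iter l rot_sg (1, x)) else 0)).
  apply: eq_big_nat => l /andP[_ hl].
  rewrite on_pair_sgrot; last by apply: (ltnW hl).
  by rewrite linearZ /= projCE /= add0n count_rotr; case: ifP => //; rewrite scaler0.
by case: ifP => _; [rewrite connes_W | rewrite big1 ?raddf0].
Qed.

Lemma D0_projC c u : D0 (projC c u) = projC c (hoch (projC c u)).
Proof.
pose f : {linear amb -> amb} := (D0 \o projC c : {linear _ -> _}).
pose g : {linear amb -> amb} := (projC c \o (hoch \o projC c) : {linear _ -> _}).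
rewrite -[LHS]/(f u) -[RHS]/(g u); apply: word_ext => x; rewrite /f /g /= projCE.
case: ifP => [/eqP <-|_]; last by rewrite !raddf0.
by rewrite lift_wordsE /= count_kinds.
Qed.

Lemma projC_bsharp x : projC (count isM x) (bsharp x) = bsharp x.
Proof.
rewrite /bsharp linearD linear_sum; congr (_ + _).
  by apply: eq_big_nat => j hj; rewrite /= projC_mul //; lia.
case: ifP => vx; last by rewrite raddf0.
have x1 : (1 < size x)%N by apply: leq_trans vx (vtail_le x).
by rewrite projC_mul //; lia.
Qed.

Lemma projC_dsharp x : projC (count isM x) (dsharp x) = 0.
Proof.
rewrite /dsharp linear_sum /= big_nat big1 // => j hj.
by rewrite projC_tri ?gtn_eqF //; lia.
Qed.

Lemma projC_w_t x : projC (count isM x) (on_pair W (w_t (1, x))) = on_pair W (w_t (1, x)).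
Proof. by rewrite /on_pair linearZ /= projCE count_rot eqxx. Qed.

(** The components of the main computation in the two weights. *)
Lemma D0_Vop x : has isM x ->
  D0 (Vop (W x)) = W x - on_pair W (w_t (1, x)) - Vop (bsharp x).
Proof.
move=> hx; set c := count isM x.
have Wc : projC c (W x) = W x by rewrite projCE eqxx.
rewrite -{1}Wc -projC_Vop D0_projC projC_Vop Wc hoch_Vop // !linearB linearD /=.
by rewrite Wc projC_w_t !projC_Vop projC_bsharp projC_dsharp raddf0 addr0.
Qed.

Lemma D1_Vop x : has isM x -> D1 (Vop (W x)) = - Vop (dsharp x).
Proof.
move=> hx; rewrite D1E D0_Vop // hoch_Vop //.
have e (a b d : amb) : a - (b + d) - (a - b) = - d.
  by apply/eqP; rewrite subr_eq opprD addrA [- d + _]addrC.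
exact: e.
Qed.

(** The map mu_0^M on words with x_0 in A, which is the second component of theta. *)
Definition phi_word (x : seq letter) : amb :=
  if x is inl a :: inr m :: s then W (inr (lact a m) :: s) else 0.

Lemma phi_normalized : normalizedW phi_word.
Proof.
have [[hD hZ hB ht ht1] hk] := W_normalized.
split; first split.
- case=> [|a [|b s]] x y z t.
  + case: x y z => [x|x] [y|y] [z|z] //= e; rewrite ?{}e; case: t => [|[b|m] t] /=; rewrite ?addr0 //.
    by apply: (hD [::] (inr _) (inr _) (inr _)) => /=; rewrite (linear_add (lact_linearl m)).
  + case: a => a; case: x y z => [x|x] [y|y] [z|z] //= e; rewrite ?{}e ?addr0 //.
    by apply: (hD [::] (inr _) (inr _) (inr _)) => /=; rewrite (linear_add (lact_linear a)).
  move=> e; case: a b => [a|a] [b|m] /=; rewrite ?addr0 //.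
  exact: (hD (inr _ :: s)).
- case=> [|a [|b s]] c x t.
  + case: x => [x|x]; case: t => [|[b|m] t] /=; rewrite ?scaler0 //.
    by rewrite (linear_scale (lact_linearl m)); exact: (hZ [::] c (inr _)).
  + case: a => a; case: x => [x|x] /=; rewrite ?scaler0 //.
    by rewrite (linear_scale (lact_linear a)); exact: (hZ [::] c (inr _)).
  case: a b => [a|a] [b|m] /=; rewrite ?scaler0 //.
  exact: (hZ (inr _ :: s)).
- case=> [|a [|b s]] x l y t hl.
  + by case: l hl => // l hl; case: x => x; case: y => y //=; rewrite lactA.
  + case: l hl => // l hl; case: a => a; case: x => x //=.
    by rewrite -lractA; exact: (hB [::] (inr _) (inl l)).
  case: a b => [a|a] [b|m] //=; exact: (hB (inr _ :: s)).
- case=> [|a s] x l y hl.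
  + case: l hl => // l hl; case: x y => [x|x] [y|y] //=.
    by rewrite lactA -lractA; exact: (ht1 (inr _) (inl l)).
  case: l hl => // l hl; case: y a => [y|y] [a|a] //=.
  by rewrite lactA; exact: (ht s x (inl l) (inr _)).
- by case=> x [l|l].
move=> x [|b s] [l|l] t hl; case: x => x //=.
case: b => [b|b] //=; exact: (hk _ s (inl l)).
Qed.

Definition phi : {linear amb -> amb} := lift_words phi_normalized.

Lemma phiE x : phi (W x) = phi_word x.
Proof. exact: lift_wordsE. Qed.

Lemma head_M x : isM (head z0 x) -> exists m s, x = inr m :: s.
Proof. by case: x => [|[a|m] s] // _; exists m, s. Qed.

Lemma has_head_M x : isM (head z0 x) -> has isM x.
Proof. by case: x => [|y s] //= ->. Qed.

Lemma head_rotr_tail x l : has isM x -> (0 < l < vtail x)%N -> isM (head z0 (rotr l x)) = false.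
Proof.
move=> /last_M[u [m [t [-> ht]]]]; rewrite vtail_cat // ltnS => /andP[l0 lt].
have e : size (drop (size t - l) t) = l by rewrite size_drop subKn.
rewrite -{1}(cat_take_drop (size t - l) t) -cat_cons catA.
have := rotr_size_cat (u ++ inr m :: take (size t - l) t) (drop (size t - l) t).
rewrite e => ->.
have h2 : ~~ has isM (drop (size t - l) t).
  by apply: contra ht => h; rewrite -(cat_take_drop (size t - l) t) has_cat h orbT.
case: (drop _ t) e h2 => [|b s] /= e; first by rewrite -e in l0.
by rewrite negb_or => /andP[/negbTE].
Qed.

(** Only the first term of vartheta has a letter in M in position 1, as the other ones
    come from rotations that put a letter of A there. *)
Lemma phi_Vop x : isM (head z0 x) -> phi (Vop (W x)) = W x.
Proof.
move=> hx; rewrite VopE /Vsum linear_sum /=.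
have v0 : (0 < vtail x)%N.
  by have [u [m [t [-> ht]]]] := last_M (has_head_M hx); rewrite vtail_cat.
rewrite big_ltn // big_nat big1 ?addr0 => [|l hl].
  rewrite /on_pair scale1r phiE /=; have [m [s ->]] := head_M hx.
  by rewrite lact1.
rewrite on_pair_sgrot; last by have := vtail_le x; lia.
rewrite linearZ /= phiE /=.
have := head_rotr_tail (has_head_M hx) hl.
by case: (rotr l x) => [|[a|m] s] //=; rewrite scaler0.
Qed.

Lemma rot_lastM x : has isM x -> isM (head z0 (rot (lastM x) x)).
Proof.
by move=> /last_M[u [m [t [-> ht]]]]; rewrite lastM_cat // rot_size_cat.
Qed.

Lemma Vsum_pair c x : c *: Vsum (vtail x) x =
  \sum_(0 <= l < vtail x) on_pair extW (iter l rot_sg (c, x)).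
Proof.
by rewrite /Vsum scaler_sumr; apply: eq_bigr => l _; rewrite -on_pair_scale.
Qed.

(** As many steps of t as there are letters of M in z bring the whole of z to the
    front. Each step brings one block m, a_1, ..., a_r with m in M and all a_i in A,
    and vartheta sums over the rotations by one step that bring the next block. *)
Lemma iter_w_t_block y z c : ((z == [::]) || isM (head z0 z)) ->
  iter (count isM z) w_t (c, y ++ z) = iter (size z) rot_sg (c, y ++ z) /\
  \sum_(0 <= l < count isM z) (iter l w_t (c, y ++ z)).1 *:
      Vop (W (iter l w_t (c, y ++ z)).2) =
  \sum_(0 <= l < size z) on_pair extW (iter l rot_sg (c, y ++ z)).
Proof.
have [n] := ubnP (size z); elim: n => // n IH in y z c *; rewrite ltnS => sz hz.
have [->|z_n] := eqVneq z [::]; first by rewrite /= !big_geq.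
rewrite (negbTE z_n) /= in hz; have [u [m [t [zE ht]]]] := last_M (has_head_M hz).
have ct : count isM t = 0 by apply/eqP; rewrite -leqn0 leqNgt -has_count.
have cz : count isM z = (count isM u).+1 by rewrite zE count_cat /= ct addn0 addn1.
have szu : size z = (size u + (size t).+1)%N by rewrite zE size_cat.
have xE : y ++ z = (y ++ u) ++ inr m :: t by rewrite zE catA.
have vx : vtail (y ++ z) = (size t).+1 by rewrite xE vtail_cat.
have w1 : w_t (c, y ++ z) = iter (size t).+1 rot_sg (c, y ++ z).
  by rewrite w_tE /= ?vx // xE size_cat /= addnS.
have [c' w2] : exists c', w_t (c, y ++ z) = (c', (inr m :: t ++ y) ++ u).
  exists (w_t (c, y ++ z)).1; rewrite [LHS]surjective_pairing; congr (_, _).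
  by rewrite /Defs.w_t xE /= lastM_cat // rot_size_cat /= -catA.
have hu : (u == [::]) || isM (head z0 u).
  by move: hz; rewrite zE; case: (u) => [|b u'].
have un : (size u < n)%N by rewrite szu in sz; lia.
have [i1 i2] := IH (inr m :: t ++ y) u c' un hu.
split.
  by rewrite cz iterSr w2 i1 -w2 w1 -iterD szu.
rewrite cz big_nat_recl // [iter 0 _ _]/= VopE Vsum_pair vx.
rewrite [X in _ + X = _](eq_bigr (fun l => (iter l w_t (c', (inr m :: t ++ y) ++ u)).1 *:
    Vop (W (iter l w_t (c', (inr m :: t ++ y) ++ u)).2))); last first.
  by move=> l _; rewrite iterSr w2.
rewrite i2 -w2 w1 szu addnC [in RHS](big_cat_nat (n := (size t).+1)) //=; last by lia.
congr (_ + _).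
rewrite -[X in _ = \sum_(X <= _ < _) _]add0n big_addn addKn.
by apply: eq_bigr => l _; rewrite -iterS -iterD.
Qed.

(** The value in the ambient module of a formal linear combination of words. *)
Definition wsum (g : seq (k * seq letter)) : amb := \sum_(p <- g) p.1 *: W p.2.

Lemma count_head_M x : isM (head z0 x) -> count isM x = (count isM (behead x)).+1.
Proof. by case: x => [|y s] //= ->. Qed.

(** vartheta N = B on words with x_0 in M: the blocks cover all rotations. *)
Lemma Vop_N x : isM (head z0 x) -> Vop (wsum (w_N x)) = connes (W x).
Proof.
move=> hx; rewrite connes_W /wsum linear_sum /= /w_N big_map -count_head_M // /Vsum.
have hx' : (x == [::]) || isM (head z0 x) by rewrite hx orbT.
have [_] := iter_w_t_block [::] 1 hx'; rewrite cat0s => <-.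
rewrite -[iota 0 _]/(iota 0 (count isM x)) /index_iota subn0.
by apply: eq_bigr => l _; rewrite linearZ.
Qed.

Lemma iter_w_t_head l x : isM (head z0 x) -> isM (head z0 (iter l w_t (1, x)).2) /\
  exists i, (iter l w_t (1, x)).2 = rot i x.
Proof.
move=> hx; elim: l => [|l [IH [i e]]]; first by split=> //; exists 0; rewrite rot0.
split; first by rewrite /= /Defs.w_t /=; apply: rot_lastM; exact: has_head_M.
by rewrite /= /Defs.w_t /= {2}e rot_rot_add; eexists.
Qed.

Lemma phi_connes x : isM (head z0 x) -> phi (connes (W x)) = wsum (w_N x).
Proof.
move=> hx; rewrite -Vop_N // /wsum linear_sum /= linear_sum /= /w_N !big_map.
apply: eq_bigr => l _; rewrite linearZ /= linearZ /= phi_Vop //.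
by case: (iter_w_t_head l hx).
Qed.

(** * The combinations of words that define the maps *)

Lemma sum_iota (V : zmodType) (F : nat -> V) m n :
  \sum_(j <- iota m n) F j = \sum_(m <= j < m + n) F j.
Proof. by rewrite /index_iota addKn. Qed.

Lemma wsum_mu x m n : wsum [seq w_mu j x | j <- iota m n] =
  \sum_(m <= j < m + n) term mul j x.
Proof. by rewrite /wsum big_map sum_iota. Qed.

Lemma wsum_rho x m n : wsum [seq w_rho T j x | j <- iota m n] =
  \sum_(m <= j < m + n) term tri j x.
Proof. by rewrite /wsum big_map sum_iota. Qed.

Lemma wsum_b x : isM (head z0 x) -> wsum (w_b x) = D0 (W x).
Proof.
case: x => [|[a|m] [|y s]] // _; rewrite wsum_mu add0n D0_W //=.
by rewrite big_nat1 /term W_null ?scaler0 //; exists [::], [::].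
Qed.

Lemma wsum_d x : (1 < size x)%N -> wsum (w_d T x) = D1 (W x).
Proof. by move=> x1; rewrite wsum_rho add0n D1_W x1 prednK // ltnW. Qed.

Lemma wsum_d' x : wsum (w_d' T x) = dsharp x.
Proof. by rewrite wsum_rho add0n. Qed.

Lemma wsum_vartheta x : wsum (w_vartheta x) = Vop (W x).
Proof.
rewrite VopE /wsum /w_vartheta !big_map sum_iota add0n; apply: eq_bigr => l _.
by [].
Qed.

Lemma wsum_B x : (0 < size x)%N -> wsum (w_B x) = connes (W x).
Proof.
move=> x0; rewrite connes_W /Vsum /on_pair (sum_sgrot extW).
by rewrite /wsum /w_B big_map sum_iota add0n prednK.
Qed.

Lemma wsum_t x : wsum [:: w_t (1, x)] = on_pair W (w_t (1, x)).
Proof. exact: big_seq1. Qed.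

Lemma wsum_id_t x : wsum (w_id_t x) = W x - on_pair W (w_t (1, x)).
Proof.
rewrite /wsum /w_id_t big_cons big_seq1 /= scale1r; congr (_ + _).
by rewrite /on_pair /= mulN1r mul1r scaleNr.
Qed.

Lemma projH_Vop u : projH true (Vop u) = 0.
Proof.
pose f : {linear amb -> amb} := (projH true \o Vop : {linear _ -> _}).
rewrite -[LHS]/(f u) -[RHS]/((\0 : {linear amb -> amb}) u); apply: word_ext => x.
rewrite /f [LHS]/= VopE /Vsum linear_sum big1 // => l _.
by rewrite /on_pair linearZ /= projHE /= scaler0.
Qed.

Lemma projH_Vop' u : projH false (Vop u) = Vop u.
Proof.
pose f : {linear amb -> amb} := (projH false \o Vop : {linear _ -> _}).
rewrite -[LHS]/(f u); apply: word_ext => x.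
rewrite /f [LHS]/= VopE /Vsum linear_sum; apply: eq_bigr => l _.
by rewrite /on_pair linearZ /= projHE /=.
Qed.

Lemma projH_w_t x : has isM x ->
  (projH true (on_pair W (w_t (1, x))) = on_pair W (w_t (1, x))) *
  (projH false (on_pair W (w_t (1, x))) = 0).
Proof. by move=> hx; rewrite /on_pair !linearZ /= !projHE rot_lastM //= scaler0. Qed.

Lemma projT_D0_Vop x : has isM x ->
  projH true (D0 (Vop (W x))) = projH true (W x) - on_pair W (w_t (1, x)).
Proof.
by move=> hx; rewrite D0_Vop // !linearB /= projH_Vop subr0 projH_w_t.
Qed.

Lemma projF_D0_Vop x : has isM x ->
  projH false (D0 (Vop (W x))) = projH false (W x) - Vop (bsharp x).
Proof.
by move=> hx; rewrite D0_Vop // !linearB /= projH_Vop' projH_w_t // subr0.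
Qed.

(** If x_0 and x_n are both in M, then x_n x_0 = 0, so that the omitted contraction
    is 0. *)
Lemma bsharp_X x : isM (head z0 x) -> bsharp x = D0 (W x).
Proof.
move=> hx; rewrite /bsharp D0_W; have [m [s xE]] := head_M hx.
case: (ltnP 1 (size x)) => x1; last first.
  have s1 : size x = 1 by rewrite xE /= in x1 *; lia.
  rewrite s1 big_geq // add0r ifF //.
  by have := vtail_le x; rewrite s1; case: (vtail x) => [|[|n]].
rewrite -[in RHS](prednK (ltnW x1)) big_nat_recr //=; congr (_ + _).
case: ifP => // /negbT v1; have [u [m' [t [xE' ht]]]] := last_M (has_head_M hx).
have t0 : t = [::] by move: v1; rewrite xE' vtail_cat // ltnS -leqNgt leqn0 size_eq0 => /eqP.
rewrite t0 cats1 in xE'; have [u' uE] : exists u', u = inr m :: u'.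
  case: u xE' {v1} => [|y u'] e; first by rewrite e in x1.
  by exists u'; move: xE; rewrite e => -[->].
rewrite /term W_null ?scaler0 // xE' uE /= size_rcons contract_wrap.
by exists [::], u'.
Qed.

Lemma projTF u : u = projH true u + projH false u.
Proof.
pose f : {linear amb -> amb} := (projH true \+ projH false).
rewrite -[RHS]/(f u) -[LHS]/((idfun : {linear amb -> amb}) u); apply: word_ext => y.
by rewrite /f /= !projHE; case: (isM _); rewrite /= ?addr0 ?add0r.
Qed.

Lemma W_inr0 t : W (inr 0 :: t) = 0.
Proof.
by rewrite -[inr 0 :: t]cat0s; apply: (cyc_zero _ _ (norm_cyclic W_normalized)); right.
Qed.

Lemma W_inl0 t : W (inl 0 :: t) = 0.
Proof.
by rewrite -[inl 0 :: t]cat0s; apply: (cyc_zero _ _ (norm_cyclic W_normalized)); left.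
Qed.

Lemma wsum_pi (f : letter -> letter) b j y :
  (f = @pi_A k A M /\ b = false) \/ (f = @pi_M k A M /\ b = true) ->
  (0 < size (contract z0 mul j y))%N ->
  (on_head f (w_mu j y)).1 *: W (on_head f (w_mu j y)).2 = projH b (term mul j y).
Proof.
move=> hf; rewrite /term linearZ /= projHE; case: (contract _ _ _ _) => [|c t] // _.
by case: hf => -[-> ->]; case: c => c /=; rewrite ?W_inl0 ?W_inr0.
Qed.

(** The same maps on words a, s with a in A and a letter in M among those of s. *)
Section HeadA.
Variables (a : A) (s : seq letter).
Let x := inl a :: s.
Hypothesis hx : has isM s.

Let s0 : (0 < size s)%N. Proof. by case: s hx. Qed.

Lemma dsharp_Y : dsharp x = D1 (W x).
Proof.
rewrite /dsharp D1_W /= ltnS s0 big_nat_recr //= -[LHS]addr0; congr (_ + _).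
rewrite /term W_null ?scaler0 // /x; case/lastP: s s0 => [|u b] // _.
rewrite size_rcons contract_wrap /=; exists [::], u.
by case: b.
Qed.

(** The contractions of x which may have their first letter in M are the first one and
    the last one. *)
Lemma head_term j : (0 < j < size s)%N -> projH true (term mul j x) = 0.
Proof.
case: j => [|j] // hj; rewrite /term /x linearZ /= contract_cons // projHE /=.
by rewrite scaler0.
Qed.

Lemma term_first b : projH b (term mul 0 x) =
  if isM (head z0 s) == b then term mul 0 x else 0.
Proof.
rewrite /term /x linearZ /= projHE; case: s s0 => [|y t] // _.
by rewrite contract0E /=; case: y => y /=; case: ifP => // _; rewrite scaler0.
Qed.

Lemma term_last b : projH b (term mul (size s) x) =
  if (vtail x == 1) == b then term mul (size s) x else 0.
Proof.
have [u [m [t [sE ht]]]] := last_M hx.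
have -> : vtail x = (size t).+1 by rewrite /x sE -cat_cons vtail_cat.
rewrite /term /x linearZ /= projHE sE; case/lastP: t ht {sE} => [|t y] ht.
  rewrite cats1 size_rcons contract_wrap /=; case: ifP => //; by rewrite scaler0.
rewrite -rcons_cons -rcons_cat size_rcons contract_wrap /= size_rcons.
move: ht; rewrite has_rcons; case: y => // y _ /=; case: ifP => //; by rewrite scaler0.
Qed.

Lemma D0_Y : D0 (W x) = \sum_(0 <= j < (size s).+1) term mul j x.
Proof. by rewrite D0_W /= ltnS s0. Qed.

Lemma phi_Y : phi (W x) = projH true (term mul 0 x).
Proof.
rewrite phiE term_first /x /=; case: s s0 => [|[b|m] t] // _.
by rewrite /term contract0E scale1r.
Qed.

Lemma D0_Y_split : D0 (W x) = term mul 0 x + \sum_(1 <= j < size s) term mul j x +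
  term mul (size s) x.
Proof. by rewrite D0_Y big_nat_recr //= big_ltn. Qed.

Lemma sum_mid b : projH b (\sum_(1 <= j < size s) term mul j x) =
  if b then 0 else \sum_(1 <= j < size s) term mul j x.
Proof.
rewrite linear_sum /=; case: b; first by rewrite big_nat big1 // => j; exact: head_term.
apply: eq_big_nat => j hj; rewrite [in RHS](projTF (term mul j x)).
by rewrite head_term // add0r.
Qed.

(** The contraction x_n x_0 is omitted if x_n is in M, which is when it has its first
    letter in M. The first contraction, if it has its first letter in M, is phi. *)
Lemma bsharp_Y : bsharp x = projH false (D0 (W x)) + phi (W x).
Proof.
rewrite /bsharp D0_Y_split phi_Y !linearD /= sum_mid term_last !term_first big_ltn //.
have v1 : (1 < vtail x)%N = ((vtail x == 1) == false).
  by rewrite /vtail; have := vtail_cat; case: (last_M hx) => u [m [t [sE ht]]];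
    move=> /(_ (inl a :: u) m t ht); rewrite /vtail /x sE -cat_cons => ->; case: (size t).
rewrite -v1 [RHS]addrAC; congr (_ + _); rewrite [RHS]addrAC; congr (_ + _).
by case: (isM _); rewrite /= ?addr0 ?add0r.
Qed.

Lemma size_contr j : (0 < size (contract z0 mul j x))%N.
Proof. by rewrite size_contract /= ?ltnS. Qed.

Lemma wsum_alpha : wsum (w_alpha x) = projH true (D0 (W x)).
Proof.
rewrite /wsum /w_alpha big_cons big_seq1 !(@wsum_pi _ true) ?size_contr; auto.
by rewrite D0_Y_split !linearD /= sum_mid addr0.
Qed.

Lemma wsum_b1 : wsum (w_b1 x) = projH false (D0 (W x)).
Proof.
rewrite /wsum /w_b1 big_cons big_cat big_seq1 !(@wsum_pi _ false) ?size_contr; auto.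
rewrite D0_Y_split !linearD /= sum_mid addrA; congr (_ + _ + _).
by rewrite -/(wsum _) wsum_mu /Defs.deg /= add1n prednK.
Qed.

Lemma wsum_theta : wsum (w_theta x) = phi (W x).
Proof.
by rewrite /wsum /w_theta big_seq1 (@wsum_pi _ true) ?size_contr; auto; rewrite phi_Y.
Qed.

End HeadA.

End Words.

Section Typed.
Variables (k : comNzRingType) (A : algType k) (M : bimodule A).
Variables (T : bimodule_product M) (K : {pred A}).
Hypothesis hK : GRing.subalg_closed K.

Notation KE := (@K_in_E k A M T K).
Notation letter := (A + M)%type.
Notation amb := (amb KE).
Notation W := (@W k A M T K).
Notation z0 := (z0 M).
Notation mul := (@lmul k A M).
Notation tri := (ltri T).
Notation isM := (@isM k A M).
Notation hoch := (@hoch k _ KE).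
Notation connes := (@connes k _ KE).
Notation D0 := (@D0 k A M T K).
Notation D1 := (@D1 k A M T K).
Notation term := (@term k A M T K).
Notation extW := (@extW k A M T K).
Notation Vop := (@Vop k A M T K).
Notation projC := (@projC k A M T K).
Notation projH := (@projH k A M T K).
Notation Vsum := (@Vsum k A M T K).
Notation dsharp := (@dsharp k A M T K).
Notation null := (@null k A M).
Notation phi := (@phi k A M T K).
Notation wsum := (@wsum k A M T K).
Notation projW := (@projW k A M T K).
Notation TB := (@TB k A M T K).
Notation wtensor := (@wtensor k A M T K).
Notation word_type := (@word_type k A M).

(** * Words of a given type *)

(** The sequences of kinds of the words of a given type. *)
Definition itype (c : bool) (n w : int) : pred (seq bool) := fun p =>
  [&& (size p)%:Z == n + 1, head false p == c & (count id (behead p))%:Z == w].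

Lemma itypeE c n w x : itype c n w (map isM x) = word_type c n w x.
Proof.
by rewrite /itype /Defs.word_type size_map head_kinds behead_map count_kinds.
Qed.

Lemma word_typeP c n w x : word_type c n w x <->
  [/\ (size x)%:Z = n + 1, isM (head z0 x) = c & (count isM x)%:Z = w + c].
Proof.
rewrite /Defs.word_type; case: x => [|y s] /=.
  by split=> [/and3P[/eqP h1 /eqP h2 /eqP h3]|[h1 h2 h3]]; [split | apply/and3P; split; apply/eqP];
   rewrite -?h2 //; lia.
split=> [/and3P[/eqP h1 /eqP h2 /eqP h3]|[h1 h2 h3]].
  by split=> //; rewrite h2 -h3; lia.
by apply/and3P; split; apply/eqP => //; rewrite h2 in h3; lia.
Qed.

(** u is a combination of words with x_0 in M or in A according to c, of degree n, and
    with w letters in M after x_0. *)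
Definition typed c n w (u : amb) : Prop := projW (itype c n w) u = u.

Lemma typed0 c n w : typed c n w 0. Proof. exact: raddf0. Qed.
Lemma typedD c n w u v : typed c n w u -> typed c n w v -> typed c n w (u + v).
Proof. by rewrite /typed linearD => -> ->. Qed.
Lemma typedZ c n w a u : typed c n w u -> typed c n w (a *: u).
Proof. by rewrite /typed linearZ /= => ->. Qed.
Lemma typedN c n w u : typed c n w u -> typed c n w (- u).
Proof. by rewrite /typed linearN /= => ->. Qed.

Lemma typed_sum_nat c n w a b (F : nat -> amb) :
  (forall i, (a <= i < b)%N -> typed c n w (F i)) -> typed c n w (\sum_(a <= i < b) F i).
Proof.
move=> h; rewrite big_nat; apply: big_ind => //; [exact: typed0 | exact: typedD].
Qed.

Lemma typed_W c n w x : word_type c n w x -> typed c n w (W x).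
Proof. by move=> h; rewrite /typed projWE itypeE h. Qed.

Lemma typed_null c n w x : null x \/ word_type c n w x -> typed c n w (W x).
Proof. by case=> [h|]; [rewrite W_null //; exact: typed0 | exact: typed_W]. Qed.

Lemma typed_lin c n w c' n' w' (F : {linear amb -> amb}) :
  (forall x, word_type c n w x -> typed c' n' w' (F (W x))) ->
  forall u, typed c n w u -> typed c' n' w' (F u).
Proof.
move=> h u <-; rewrite /typed.
pose f : {linear amb -> amb} := (projW (itype c' n' w') \o (F \o projW (itype c n w)) : {linear _ -> _}).
pose g : {linear amb -> amb} := (F \o projW (itype c n w) : {linear _ -> _}).
rewrite -[LHS]/(f u) -[RHS]/(g u); apply: word_ext => x; rewrite /f /g /= projWE itypeE.
by case: ifP => [/h //|_]; rewrite !raddf0.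
Qed.

Lemma typed_ext c n w (V : lmodType k) (F G : {linear amb -> V}) :
  (forall x, word_type c n w x -> F (W x) = G (W x)) ->
  forall u, typed c n w u -> F u = G u.
Proof.
move=> h u <-.
pose f : {linear amb -> V} := (F \o projW (itype c n w) : {linear _ -> _}).
pose g : {linear amb -> V} := (G \o projW (itype c n w) : {linear _ -> _}).
rewrite -[LHS]/(f u) -[RHS]/(g u); apply: word_ext => x; rewrite /f /g /= projWE itypeE.
by case: ifP => [/h //|_]; rewrite !raddf0.
Qed.

(** For these c and n the words of type (c, n, w) have |n| + 1 letters. For c = false
    and n = -1 this fails for the empty word. *)
Definition sound (c : bool) (n : int) : bool := c || (0 <= n).

Lemma word_size c n w x : sound c n -> word_type c n w x -> size x = `|n|%N.+1.
Proof.
move=> hs /word_typeP[h1 h2 _]; case: c hs h2 => /= hs h2; last by lia.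
by case: x h1 h2 => [|y s] //= h1 _; lia.
Qed.

Section Iota.
Variables (c : bool) (n w : int).
Definition iota_fun (u : TB c n w) : amb := Xi KE `|n|%N (val u).
Fact iota_linear : linear iota_fun.
Proof. by move=> a u v; rewrite /iota_fun !linearP. Qed.
HB.instance Definition _ := GRing.isLinear.Build k (TB c n w) amb _ iota_fun iota_linear.
(** The embedding of the modules of words of a given type in the ambient module. *)
Definition iota_TB : {linear TB c n w -> amb} := iota_fun.

Lemma iota_inj : injective iota_TB.
Proof. by move=> u v /Xi_inj /val_inj. Qed.

Hypothesis hs : sound c n.

Lemma iota_word u x : word_type c n w x -> val u = wtensor `|n|%N x -> iota_TB u = W x.
Proof.
move=> hx; rewrite -[iota_TB u]/(Xi KE `|n|%N (val u)) => ->; apply: XiE.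
by rewrite size_map (word_size hs hx).
Qed.

Lemma TB_ext (V : lmodType k) (f g : {linear TB c n w -> V}) :
  (forall x u, word_type c n w x -> val u = wtensor `|n|%N x -> f u = g u) ->
  forall u, f u = g u.
Proof.
move=> fg [u hu]; have /asboolP[s [hs' uE]] := hu.
suff h : forall s : seq (k * CE T K `|n|%N), (forall p, p \in s -> exists2 x, word_type c n w x &
    p.2 = wtensor `|n|%N x) -> forall v : TB c n w, val v = \sum_(p <- s) p.1 *: p.2 -> f v = g v.
  exact: (h s hs' (Defs.Sub hu) uE).
elim=> [|[a y] s0 IH] hp v vE.
  by have -> : v = 0; [apply/val_inj; rewrite vE big_nil | rewrite !raddf0].
have [x hx yE] := hp (a, y) (mem_head _ _); rewrite /= in yE.
have my : y \in spanl (fun u => exists2 x, word_type c n w x & u = wtensor `|n|%N x).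
  by apply: mem_spanl; exists x.
pose v1 : TB c n w := Defs.Sub my.
have [v2 v2E] : exists v2, v2 = v - a *: v1 by eexists.
have -> : v = a *: v1 + v2 by rewrite v2E addrC subrK.
rewrite !linearD !linearZ /=; congr (a *: _ + _); first exact: (fg x).
apply: IH => [p ps|]; first by apply: hp; rewrite inE ps orbT.
by rewrite v2E linearB linearZ /= vE big_cons /= scalerN addrC addKr.
Qed.

Lemma typed_iota u : typed c n w (iota_TB u).
Proof.
pose f : {linear TB c n w -> amb} := (projW (itype c n w) \o iota_TB : {linear _ -> _}).
rewrite /typed -[LHS]/(f u); apply: TB_ext => x v hx vE.
by rewrite /f /= (iota_word hx vE) projWE itypeE hx.
Qed.

Lemma typed_span u : typed c n w u ->
  Pi KE `|n|%N u \in spanl (fun u => exists2 x, word_type c n w x & u = wtensor `|n|%N x).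
Proof.
rewrite /typed => <-; have [s ->] := amb_span u.
rewrite linear_sum linear_sum; apply: rpred_sum => p _.
rewrite linearZ linearZ; apply: rpredZ; rewrite cl_words /expand_sum linear_sum linear_sum.
apply: rpred_sum => x _ /=; rewrite projWE itypeE; case: ifP => hx; last by rewrite raddf0 rpred0.
by apply: mem_spanl; exists x => //; rewrite PiE.
Qed.

Lemma typed_Xi u : typed c n w u -> Xi KE `|n|%N (Pi KE `|n|%N u) = u.
Proof.
move: u; pose f : {linear amb -> amb} := (Xi KE `|n|%N \o Pi KE `|n|%N : {linear _ -> _}).
apply: (@typed_ext c n w _ f idfun) => x hx.
by rewrite /f /= PiE XiE // size_map (word_size hs hx).
Qed.

Lemma iota_surj u : typed c n w u -> exists v, iota_TB v = u.
Proof.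
by move=> hu; exists (Defs.Sub (typed_span hu)); exact: typed_Xi.
Qed.

End Iota.
Arguments iota_TB {c n w}.

(** A map given by combinations of words is the restriction of F if it agrees with F on
    words and F respects the types. In particular the prescription is consistent. *)
Lemma wmapE c n w c' n' w' (g : seq letter -> seq (k * seq letter)) (F : {linear amb -> amb}) :
  sound c n -> sound c' n' ->
  (forall x, word_type c n w x -> wsum (g x) = F (W x)) ->
  (forall x, word_type c n w x -> typed c' n' w' (F (W x))) ->
  forall u, iota_TB (@wmap k A M T K c n w c' n' w' g u) = F (iota_TB u).
Proof.
move=> hs hs' hg hF.
have tF (u : TB c n w) : typed c' n' w' (F (iota_TB u)).
  exact: typed_lin hF _ (typed_iota hs u).
pose f (u : TB c n w) : TB c' n' w' := Defs.Sub (typed_span (tF u)).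
have lf : linear f.
  by move=> a u v; apply/val_inj; rewrite /= !linearP.
have spec := the_linearP (P := fun f : {linear TB c n w -> TB c' n' w'} =>
  forall (x : seq letter) (u : TB c n w), word_type c n w x -> val u = wtensor `|n|%N x ->
    val (f u) = \sum_(p <- g x) p.1 *: wtensor `|n'|%N p.2).
move=> u.
pose f1 : {linear TB c n w -> amb} := (@iota_TB c' n' w' \o @wmap k A M T K c n w c' n' w' g : {linear _ -> _}).
pose f2 : {linear TB c n w -> amb} := (F \o @iota_TB c n w : {linear _ -> _}).
rewrite -[LHS]/(f1 u) -[RHS]/(f2 u); apply: (@TB_ext c n w amb f1 f2) => x {}u hx uE.
rewrite /f1 /f2 /= -[iota_fun u]/(iota_TB u) (iota_word hs hx uE).
rewrite /iota_fun (spec _ x u hx uE).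
  rewrite -[RHS](typed_Xi hs' (hF x hx)) -hg //; congr (Xi _ _ _).
  rewrite /wsum linear_sum /=; apply: eq_bigr => p _.
  by rewrite linearZ /= PiE.
exists (mklin lf) => {hx uE} {}x {}u hx uE /=.
rewrite -[iota_fun u]/(iota_TB u) (iota_word hs hx uE) -hg // /wsum linear_sum.
by apply: eq_bigr => p _; rewrite linearZ /= PiE.
Qed.

(** * The operators on words of a given type *)

Lemma hochE_split u : hoch u = D0 u + D1 u.
Proof. by rewrite D1E addrC subrK. Qed.

Lemma projC_D0 c u : projC c (D0 u) = D0 (projC c u).
Proof.
pose f : {linear amb -> amb} := (projC c \o D0 : {linear _ -> _}).
pose g : {linear amb -> amb} := (D0 \o projC c : {linear _ -> _}).
rewrite -[LHS]/(f u) -[RHS]/(g u); apply: word_ext => x; rewrite /f /g /= projCE.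
rewrite D0_W; case: (ltnP 1 (size x)) => x1; last first.
  by rewrite raddf0; case: ifP => _; rewrite ?raddf0 // D0_W ltnNge x1.
rewrite linear_sum /= (eq_big_nat _ _ (F2 := fun j => if count isM x == c then term mul j x else 0)).
  by case: ifP => _; [rewrite D0_W x1 | rewrite big1 ?raddf0].
move=> j /andP[_ jx]; rewrite /term linearZ /= projCE.
case: (mul_count x1 jx) => [/W_null->|->]; first by rewrite if_same scaler0 if_same.
by case: ifP => //; rewrite scaler0.
Qed.

Lemma projC_D1 c u : projC c (D1 u) = D1 (projC c.+1 u).
Proof.
pose f : {linear amb -> amb} := (projC c \o D1 : {linear _ -> _}).
pose g : {linear amb -> amb} := (D1 \o projC c.+1 : {linear _ -> _}).
rewrite -[LHS]/(f u) -[RHS]/(g u); apply: word_ext => x.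
change (projC c (D1 (W x)) = D1 (projC c.+1 (W x))); rewrite projCE D1_W; case: (ltnP 1 (size x)) => x1; last first.
  by rewrite raddf0; case: ifP => _; rewrite ?raddf0 // D1_W ltnNge x1.
rewrite linear_sum (eq_big_nat _ _ (F2 := fun j => if count isM x == c.+1 then term tri j x else 0)).
  by case: ifP => _; [rewrite D1_W x1 | rewrite big1 ?raddf0].
by move=> j /andP[_ jx]; rewrite projC_tri // eq_sym.
Qed.

Let zeroE : (D0 0 = 0) * (D1 0 = 0) * (connes 0 = 0) * (forall c, projC c 0 = 0).
Proof. by split; [split; [split|] |] => [||| c]; exact: linear0. Qed.

Section Weight.
Variables (c : nat) (u : amb).
Hypothesis hu : projC c u = u.

Lemma projC_other c' : c' != c -> projC c' u = 0.
Proof.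
move=> cc; rewrite -hu.
pose f : {linear amb -> amb} := (projC c' \o projC c : {linear _ -> _}).
rewrite -[LHS]/(f u) -[RHS]/((\0 : {linear amb -> amb}) u); apply: word_ext => x.
rewrite /f /= projCE; case: ifP => [/eqP e|_]; last exact: raddf0.
by rewrite projCE e eq_sym (negbTE cc).
Qed.

Lemma hoch_hoch_split : D0 (D0 u) + (D0 (D1 u) + D1 (D0 u)) + D1 (D1 u) = 0.
Proof.
rewrite -[RHS](hoch_hoch u) !hochE_split !linearD /=.
by rewrite -!addrA; congr (_ + _); rewrite addrCA.
Qed.

Lemma hoch_connes_split :
  (D0 (connes u) + connes (D0 u)) + (D1 (connes u) + connes (D1 u)) = 0.
Proof.
rewrite -[RHS](hoch_connes u) !hochE_split !linearD /=.
by rewrite addrACA.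
Qed.

Lemma D0_D0 : D0 (D0 u) = 0.
Proof.
have := congr1 (projC c) hoch_hoch_split.
rewrite !linearD ?projC_D0 ?projC_D1 ?projC_D0 ?projC_D1 hu.
rewrite (@projC_other c.+1) ?gtn_eqF // (@projC_other c.+2) ?gtn_eqF ?(ltnW (ltnSn _)) //.
by rewrite !zeroE !addr0.
Qed.

Lemma D0_connes : D0 (connes u) + connes (D0 u) = 0.
Proof.
have := congr1 (projC c) hoch_connes_split.
rewrite !linearD ?projC_D0 ?projC_D1 ?projC_connes ?projC_D0 ?projC_D1 hu.
by rewrite (@projC_other c.+1) ?gtn_eqF // !zeroE !addr0.
Qed.

End Weight.

Lemma D0_D1 c u : projC c.+1 u = u -> D0 (D1 u) + D1 (D0 u) = 0.
Proof.
move=> hu; have := congr1 (projC c) (hoch_hoch_split u).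
rewrite !linearD ?projC_D0 ?projC_D1 ?projC_D0 ?projC_D1 hu.
rewrite (projC_other hu (c' := c)) ?ltn_eqF // (projC_other hu (c' := c.+2)) ?gtn_eqF //.
by rewrite !zeroE !addr0 add0r.
Qed.

Lemma D1_D1 c u : projC c.+2 u = u -> D1 (D1 u) = 0.
Proof.
move=> hu; have := congr1 (projC c) (hoch_hoch_split u).
rewrite !linearD ?projC_D0 ?projC_D1 ?projC_D0 ?projC_D1 hu.
rewrite (projC_other hu (c' := c)) ?ltn_eqF ?(ltnW (ltnSn _)) //.
rewrite (projC_other hu (c' := c.+1)) ?ltn_eqF //.
by rewrite !zeroE !addr0 add0r.
Qed.

Lemma D1_connes c u : projC c.+1 u = u -> D1 (connes u) + connes (D1 u) = 0.
Proof.
move=> hu; have := congr1 (projC c) (hoch_connes_split u).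
rewrite !linearD ?projC_D0 ?projC_D1 ?projC_connes ?projC_D0 ?projC_D1 hu.
rewrite (projC_other hu (c' := c)) ?ltn_eqF //.
by rewrite !zeroE addr0 add0r.
Qed.

Lemma typed_projC c n w m u : typed c n w u -> m%:Z = w + c -> projC m u = u.
Proof.
move=> hu hm; move: u hu; apply: (@typed_ext _ _ _ _ (projC m) idfun) => x.
by move=> /word_typeP[_ _ h]; rewrite projCE (_ : count isM x == m) //; lia.
Qed.

Lemma typed_projH b c n w u : typed c n w u -> projH b u = if b == c then u else 0.
Proof.
move=> hu; move: u hu; case: eqP => [->|bc].
  apply: (@typed_ext _ _ _ _ (projH c) idfun) => x /word_typeP[_ h _].
  by rewrite projHE h eqxx.
apply: (@typed_ext _ _ _ _ (projH b) \0) => x /word_typeP[_ h _].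
by rewrite projHE h (_ : (c == b) = false) //; apply/eqP => e; apply: bc.
Qed.

Lemma typed_empty c n w u : (forall x, ~ word_type c n w x) -> typed c n w u -> u = 0.
Proof.
by move=> h; apply: (@typed_ext c n w _ idfun \0) => x /h.
Qed.

Lemma mul_head j x : (1 < size x)%N -> (j < size x)%N -> isM (head z0 x) ->
  null (contract z0 mul j x) \/ isM (head z0 (contract z0 mul j x)).
Proof.
move=> x1 jx; case: (contract_spec z0 x1 jx).
  move=> [[|y u] [a [b [v [-> ju cE]]]]]; rewrite cE /=; last by right.
  case: a b {cE} => [a|m] [b|m'] //= _; first by right.
  by left; exists [::], v.
move=> [u [a [b [-> ju cE]]]]; rewrite cE /=.
case: a b {cE} => [a|m] [b|m'] //= _; first by right.
by left; exists [::], u.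
Qed.

Lemma tri_head j x : (1 < size x)%N -> (j < size x)%N ->
  null (contract z0 tri j x) \/ isM (head z0 (contract z0 tri j x)) = isM (head z0 x).
Proof.
move=> x1 jx; case: (contract_spec z0 x1 jx).
  move=> [[|y u] [a [b [v [-> ju cE]]]]]; rewrite cE /=; last by right.
  by case: a b {cE} => [a|m] [b|m'] //=; [left|left|left|right]; try exists [::], v.
move=> [u [a [b [-> ju cE]]]]; rewrite cE /=.
by case: a b {cE} => [a|m] [b|m'] //=; [left|left|left|right]; try exists [::], u.
Qed.

Lemma typed_projH_D0 b c n w u : typed c n w u ->
  typed b (n - 1) (w + c - Posz b) (projH b (D0 u)).
Proof.
move: u; apply: (@typed_lin _ _ _ _ _ _ (projH b \o D0 : {linear amb -> amb})).
move=> x /word_typeP[hs hh hc] /=; rewrite D0_W; case: ifP => x1; last by rewrite raddf0; exact: typed0.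
rewrite linear_sum; apply: typed_sum_nat => j /andP[_ jx].
rewrite /term linearZ /= projHE; apply: typedZ.
case: (mul_count x1 jx) => [/W_null->|hc']; first by rewrite if_same; exact: typed0.
case: ifP => [/eqP hb|_]; last exact: typed0.
by apply: typed_W; apply/word_typeP; rewrite size_contract // hc'; split=> //; rewrite subrK //; lia.
Qed.

Lemma projH_D0_X n w u : typed true n w u -> projH true (D0 u) = D0 u.
Proof.
move: u; apply: (@typed_ext _ _ _ _ (projH true \o D0 : {linear amb -> amb}) D0).
move=> x /word_typeP[hs hh hc] /=; rewrite D0_W; case: ifP => x1; last by rewrite raddf0.
rewrite linear_sum; apply: eq_big_nat => j /andP[_ jx].
rewrite /term linearZ /= projHE.
by case: (mul_head x1 jx hh) => [/W_null->|->]; rewrite ?if_same.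
Qed.

Lemma typed_D0 n w u : typed true n w u -> typed true (n - 1) w (D0 u).
Proof.
move=> hu; rewrite -(projH_D0_X hu); have := typed_projH_D0 true hu.
by rewrite addrK.
Qed.

Lemma typed_D1 c n w u : typed c n w u -> typed c (n - 1) (w - 1) (D1 u).
Proof.
move: u; apply: typed_lin => x /word_typeP[hs hh hc].
rewrite D1_W; case: ifP => x1; last exact: typed0.
apply: typed_sum_nat => j /andP[_ jx]; apply: typedZ; apply: typed_null.
case: (tri_count T x1 jx) => [|hc']; first by left.
case: (tri_head x1 jx) => [|hh']; first by left.
by right; apply/word_typeP; rewrite size_contract // hh' hh; split=> //; lia.
Qed.

Lemma typed_extW n w x : (size x)%:Z = n -> (count isM x)%:Z = w -> typed false n w (extW x).
Proof.
by move=> hs hc; apply: typed_W; apply/word_typeP; split=> //=; lia.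
Qed.

Lemma typed_Vsum c n w r x : word_type c n w x -> (r <= size x)%N ->
  typed false (n + 1) (w + c) (Vsum r x).
Proof.
move=> /word_typeP[hs hh hc] rx; apply: typed_sum_nat => l /andP[_ lr].
rewrite on_pair_sgrot; last by apply: leq_trans (ltnW lr) rx.
by apply: typedZ; apply: typed_extW; rewrite ?size_rotr ?count_rotr.
Qed.

Lemma typed_Vop c n w u : typed c n w u -> typed false (n + 1) (w + c) (Vop u).
Proof.
move: u; apply: typed_lin => x hx; rewrite VopE; apply: typed_Vsum => //; exact: vtail_le.
Qed.

Lemma typed_connes c n w u : typed c n w u -> typed false (n + 1) (w + c) (connes u).
Proof. by move: u; apply: typed_lin => x hx; rewrite connes_W; exact: typed_Vsum. Qed.

Lemma typed_phi n w u : typed false n w u -> typed true (n - 1) (w - 1) (phi u).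
Proof.
move: u; apply: typed_lin => x /word_typeP[hs hh hc]; rewrite phiE.
case: x hs hh hc => [|[a|m] [|[b|m'] s]] //= hs _ hc; try exact: typed0.
by apply: typed_W; apply/word_typeP; split=> //=; lia.
Qed.

(** The relations between the operators on words whose first letter is in M (suffix X)
    or in A (suffix Y). *)

Lemma phi_Vop_X n w u : typed true n w u -> phi (Vop u) = u.
Proof.
move: u; apply: (@typed_ext _ _ _ _ (phi \o Vop : {linear amb -> amb}) idfun).
by move=> x /word_typeP[hs hh hc] /=; exact: phi_Vop.
Qed.

Lemma D0_Vop_X n w u : typed true n w u ->
  D0 (Vop u) = projH true (D0 (Vop u)) - Vop (D0 u).
Proof.
move=> hu; rewrite [LHS]projTF; congr (_ + _).
move: u hu; apply: (@typed_ext _ _ _ _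
  (projH false \o (D0 \o Vop) : {linear amb -> amb}) (\- (Vop \o D0))).
move=> x /word_typeP[hs hh hc] /=; rewrite projF_D0_Vop ?has_head_M //.
by rewrite bsharp_X // projHE hh sub0r.
Qed.

Lemma typed_dsharp n w x : word_type true n w x -> typed true (n - 1) (w - 1) (dsharp x).
Proof.
move=> /word_typeP[hs hh hc]; apply: typed_sum_nat => j jx; apply: typedZ; apply: typed_null.
have [x1 jx'] : (1 < size x)%N /\ (j < size x)%N by lia.
case: (tri_count T x1 jx') => [|hc']; first by left.
case: (tri_head x1 jx') => [|hh']; first by left.
by right; apply/word_typeP; rewrite size_contract // hh' hh; split=> //; lia.
Qed.

Lemma dsharpE n w x : word_type true n w x -> dsharp x = - phi (D1 (Vop (W x))).
Proof.
move=> hx; have /word_typeP[_ hh _] := hx.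
by rewrite D1_Vop ?has_head_M // linearN /= (phi_Vop_X (typed_dsharp hx)) opprK.
Qed.

Lemma D1_Vop_X n w u : typed true n w u -> Vop (phi (D1 (Vop u))) = D1 (Vop u).
Proof.
move: u; apply: (@typed_ext _ _ _ _
  (Vop \o (phi \o (D1 \o Vop)) : {linear amb -> amb}) (D1 \o Vop)).
move=> x hx; have /word_typeP[_ hh _] := hx.
change (Vop (phi (D1 (Vop (W x)))) = D1 (Vop (W x))).
by rewrite -[X in Vop X]opprK -(dsharpE hx) D1_Vop ?has_head_M // raddfN.
Qed.

Lemma connes_X n w u : typed true n w u -> Vop (phi (connes u)) = connes u.
Proof.
move: u; apply: (@typed_ext _ _ _ _
  (Vop \o (phi \o connes) : {linear amb -> amb}) connes).
by move=> x /word_typeP[_ hh _] /=; rewrite phi_connes // Vop_N.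
Qed.

Lemma word_Y n (w : nat) x : word_type false n (w%:Z + 1) x ->
  exists a s, x = inl a :: s /\ has isM s.
Proof.
move=> /word_typeP[_ h1 h2]; case: x h1 h2 => [|[a|m] s] //= _ h2; first by lia.
by exists a, s; split=> //; rewrite has_count; lia.
Qed.

Lemma D0_Vop_Y n (w : nat) u : typed false n (w%:Z + 1) u ->
  D0 (Vop u) = projH true (D0 (Vop u)) + (u - Vop (projH false (D0 u)) - Vop (phi u)).
Proof.
move=> hu; rewrite [LHS]projTF; congr (_ + _).
move: u hu; apply: (@typed_ext _ _ _ _
  (projH false \o (D0 \o Vop) : {linear amb -> amb})
  ((idfun \- (Vop \o (projH false \o D0))) \- (Vop \o phi))).
move=> x hx; have [a [s [xE hs]]] := word_Y hx.
change (projH false (D0 (Vop (W x))) =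
  W x - Vop (projH false (D0 (W x))) - Vop (phi (W x))).
rewrite projF_D0_Vop; [|exact: hK|by rewrite xE].
by rewrite projHE xE /= bsharp_Y // linearD opprD addrA.
Qed.

Lemma D1_Vop_Y n (w : nat) u : typed false n (w%:Z + 1) u -> D1 (Vop u) = - Vop (D1 u).
Proof.
move: u; apply: (@typed_ext _ _ _ _
  (D1 \o Vop : {linear amb -> amb}) (\- (Vop \o D1))).
move=> x hx; have [a [s [xE hs]]] := word_Y hx.
change (D1 (Vop (W x)) = - Vop (D1 (W x))); rewrite D1_Vop ?xE //.
by rewrite dsharp_Y.
Qed.

End Typed.

Section Diagrams.
Variables (k : comNzRingType) (A : algType k) (M : bimodule A).
Variables (T : bimodule_product M) (K : {pred A}).
Hypothesis hK : GRing.subalg_closed K.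

Notation KE := (@K_in_E k A M T K).
Notation amb := (amb KE).
Notation W := (@W k A M T K).
Notation z0 := (z0 M).
Notation isM := (@isM k A M).
Notation w_t := (@w_t k A M).
Notation connes := (@connes k _ KE).
Notation D0 := (@D0 k A M T K).
Notation D1 := (@D1 k A M T K).
Notation Vop := (@Vop k A M T K).
Notation projC := (@projC k A M T K).
Notation projH := (@projH k A M T K).
Notation phi := (@phi k A M T K).
Notation TB := (@TB k A M T K).
Notation word_type := (@word_type k A M).
Notation typed := (@typed k A M T K).
Notation iota_TB := (@iota_TB k A M T K _ _ _).
Notation X := (@X k A M T K).
Notation Y := (@Y k A M T K).
Notation Xmap := (@Xmap k A M T K).
Notation Ymap := (@Ymap k A M T K).
Notation XYmap := (@XYmap k A M T K).
Notation YXmap := (@YXmap k A M T K).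
Notation iota := iota_TB.
Notation frakX := (@frakX k A M T K).
Notation hatX := (@hatX k A M T K).
Notation vth := (@hat_vartheta k A M T K).
Notation theta := (@hat_theta k A M T K).

(** * The two diagrams *)

Lemma head_X n w x : word_type true n w x -> isM (head z0 x).
Proof. by case/word_typeP. Qed.

Lemma typed_X v w (u : X v w) : typed true (v + w) w (iota u).
Proof. exact: typed_iota. Qed.

Lemma typed_Y (v w : nat) (u : Y v w) : typed false (v%:Z + w%:Z) (w%:Z + 1) (iota u).
Proof. exact: typed_iota. Qed.

Lemma typed_eq c n w n' w' u : n = n' -> w = w' -> typed c n w u -> typed c n' w' u.
Proof. by move=> -> ->. Qed.

Lemma iota_b v v' w (u : X v w) : v = v' + 1 -> iota (Xmap v w v' w (@w_b k A M) u) = D0 (iota u).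
Proof.
move=> hv; apply: wmapE => // x hx; first by apply: wsum_b; exact: head_X hx.
by apply: typed_eq (typed_D0 (typed_W T K hx)); lia.
Qed.

Lemma projT_D0_Vop_X v w (u : amb) : typed true (v + w) w u ->
  typed true (v + w) w (projH true (D0 (Vop u))).
Proof.
by move=> hu; apply: typed_eq (typed_projH_D0 true (typed_Vop hu)); lia.
Qed.

Lemma iota_id_t v v' w (u : X v w) : v = v' ->
  iota (Xmap v w v' w (@w_id_t k A M) u) = projH true (D0 (Vop (iota u))).
Proof.
move=> hv; subst v'; apply: (@wmapE _ _ _ _ _ _ _ _ _ _ _ _ (projH true \o (D0 \o Vop) : {linear amb -> amb})) => // x hx.
  have hh := head_X hx; rewrite wsum_id_t.
  change (W x - on_pair W (w_t (1, x)) = projH true (D0 (Vop (W x)))).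
  by rewrite projT_D0_Vop ?has_head_M // projHE hh.
exact: projT_D0_Vop_X (typed_W T K hx).
Qed.

Lemma iota_d v (w w' : nat) (u : X v w) : w = w'.+1 :> nat ->
  iota (Xmap v w v w' (w_d T) u) = D1 (iota u).
Proof.
move=> hw; apply: wmapE => // x hx.
  apply: wsum_d; have /word_typeP[hs _ hc] := hx.
  by have := count_size isM x; lia.
by apply: typed_eq (typed_D1 (typed_W T K hx)); lia.
Qed.

Lemma iota_d' v (w w' : nat) (u : X v w) : w = w'.+1 :> nat ->
  iota (Xmap v w v w' (w_d' T) u) = - phi (D1 (Vop (iota u))).
Proof.
move=> hw; apply: (@wmapE _ _ _ _ _ _ _ _ _ _ _ _ (\- (phi \o (D1 \o Vop)) : {linear amb -> amb})) => // x hx.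
  by rewrite wsum_d' (dsharpE T hK hx).
change (typed true (v + w'%:Z) w'%:Z (- phi (D1 (Vop (W x))))).
rewrite -(dsharpE T hK hx); apply: typed_eq (typed_dsharp T K hx); lia.
Qed.

Lemma iota_N v v' w (u : X v w) : v = v' ->
  iota (Xmap v w v' w (@w_N k A M) u) = phi (connes (iota u)).
Proof.
move=> hv; subst v'; apply: (@wmapE _ _ _ _ _ _ _ _ _ _ _ _ (phi \o connes : {linear amb -> amb})) => // x hx.
  by apply: esym; apply: phi_connes; exact: head_X hx.
by apply: typed_eq (typed_phi (typed_connes (typed_W T K hx))); lia.
Qed.

Lemma iota_BX (v w : nat) (u : X v w) :
  iota (XYmap v w v.+1 w (@w_B k A M) u) = connes (iota u).
Proof.
apply: wmapE => // x hx; first by apply: wsum_B; have /word_typeP[hs _ _] := hx; lia.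
by apply: typed_eq (typed_connes (typed_W T K hx)); lia.
Qed.

Lemma iota_vartheta (v w : nat) (u : X (v%:Z - 1) w) :
  iota (XYmap (v%:Z - 1) w v w (@w_vartheta k A M) u) = Vop (iota u).
Proof.
apply: wmapE => // x hx; first exact: wsum_vartheta.
by apply: typed_eq (typed_Vop (typed_W T K hx)); lia.
Qed.

Lemma iota_varthetaY (v w : nat) (u : Y v w) :
  iota (Ymap v w v.+1 w (@w_vartheta k A M) u) = Vop (iota u).
Proof.
apply: wmapE => // x hx; first exact: wsum_vartheta.
by apply: typed_eq (typed_Vop (typed_W T K hx)); lia.
Qed.

Lemma iota_BY (v w : nat) (u : Y v w) :
  iota (Ymap v w v.+1 w (@w_B k A M) u) = connes (iota u).
Proof.
apply: wmapE => // x hx; first by apply: wsum_B; have /word_typeP[hs _ _] := hx; lia.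
by apply: typed_eq (typed_connes (typed_W T K hx)); lia.
Qed.

Lemma iota_alpha (v w : nat) (u : Y v.+1 w) :
  iota (YXmap v.+1 w v w (@w_alpha k A M) u) = projH true (D0 (iota u)).
Proof.
apply: (@wmapE _ _ _ _ _ _ _ _ _ _ _ _ (projH true \o D0 : {linear amb -> amb})) => // x hx.
  by have [a [s [-> hs]]] := word_Y hx; rewrite wsum_alpha.
by apply: typed_eq (typed_projH_D0 true (typed_W T K hx)); lia.
Qed.

Lemma iota_b1 (v w : nat) (u : Y v.+1 w) :
  iota (Ymap v.+1 w v w (@w_b1 k A M) u) = projH false (D0 (iota u)).
Proof.
apply: (@wmapE _ _ _ _ _ _ _ _ _ _ _ _ (projH false \o D0 : {linear amb -> amb})) => // x hx.
  by have [a [s [-> hs]]] := word_Y hx; rewrite wsum_b1.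
by apply: typed_eq (typed_projH_D0 false (typed_W T K hx)); lia.
Qed.

Lemma iota_dY (v w : nat) (u : Y v w.+1) : iota (Ymap v w.+1 v w (w_d T) u) = D1 (iota u).
Proof.
apply: wmapE => // x hx; first by apply: wsum_d; have /word_typeP[hs _ hc] := hx; lia.
by apply: typed_eq (typed_D1 (typed_W T K hx)); lia.
Qed.

Lemma iota_t (v w : nat) (u : Y v w) :
  iota (YXmap v w v w (fun y => [:: w_t (1, y)]) u) = - projH true (D0 (Vop (iota u))).
Proof.
apply: (@wmapE _ _ _ _ _ _ _ _ _ _ _ _ (\- (projH true \o (D0 \o Vop)) : {linear amb -> amb})) => // x hx.
  have [a [s [xE hs]]] := word_Y hx; rewrite wsum_t.
  change (on_pair W (w_t (1, x)) = - projH true (D0 (Vop (W x)))).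
  by rewrite projT_D0_Vop ?xE // projHE /= sub0r opprK.
apply: typedN; apply: typed_eq (typed_projH_D0 true (typed_Vop (typed_W T K hx))); lia.
Qed.

Lemma iota_theta (v w : nat) (u : Y v w) :
  iota (YXmap v w (v%:Z - 1) w (@w_theta k A M) u) = phi (iota u).
Proof.
apply: wmapE => // x hx.
  by have [a [s [-> hs]]] := word_Y hx; rewrite wsum_theta.
by apply: typed_eq (typed_phi (typed_W T K hx)); lia.
Qed.

Lemma iotaD c n w (u v : TB c n w) : iota (u + v) = iota u + iota v.
Proof. exact: linearD. Qed.
Lemma iota0 c n w : iota (0 : TB c n w) = 0.
Proof. exact: linear0. Qed.
Lemma iotaN c n w (u : TB c n w) : iota (- u) = - iota u.
Proof. exact: linearN. Qed.

(** The embedding of the sum of the two components of frakX in the ambient module. It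
    turns the three operators of frakX into D0, D1 and the Connes operator. *)
Definition real v w (p : frakX v w) : amb := iota p.1 + iota p.2.

Fact real_linear v w : linear (@real v w).
Proof.
by move=> a p q; rewrite /real !linearP scalerDr addrACA.
Qed.

Lemma realD v w (p q : frakX v w) : real (p + q) = real p + real q.
Proof. by rewrite /real !iotaD addrACA. Qed.
Lemma real0 v w : real (0 : frakX v w) = 0.
Proof. by rewrite /real !iota0 addr0. Qed.
Lemma realN v w (p : frakX v w) : real (- p) = - real p.
Proof. by rewrite /real !iotaN opprD. Qed.

Lemma iota_proj v w (p : frakX v w) :
  (projH true (iota p.1) = iota p.1) * (projH false (iota p.1) = 0) *
  (projH true (iota p.2) = 0) * (projH false (iota p.2) = iota p.2).
Proof.
have hx := typed_X (p.1 : X v w); have hy := typed_Y (p.2 : Y v w).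
by rewrite !(typed_projH _ hx) !(typed_projH _ hy).
Qed.

Lemma real_proj v w (p : frakX v w) :
  (projH true (real p) = iota p.1) * (projH false (real p) = iota p.2).
Proof. by rewrite /real !linearD !iota_proj addr0 add0r. Qed.

Lemma real_inj v w : injective (@real v w).
Proof.
move=> p q e; rewrite [p]surjective_pairing [q]surjective_pairing; congr (_, _);
  by apply: iota_inj; rewrite -!real_proj e.
Qed.

(** The words of bidegree (v, w) have w + 1 letters in M. *)
Lemma real_weight v w (p : frakX v w) : projC w.+1 (real p) = real p.
Proof.
rewrite /real linearD; congr (_ + _).
  by apply: (typed_projC (typed_X (p.1 : X v w))); lia.
by apply: (typed_projC (typed_Y (p.2 : Y v w))); lia.
Qed.

Lemma real_b v w (p : frakX v.+1 w) : real (dmx_b frakX v w p) = D0 (real p).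
Proof.
change (iota (Xmap v.+1 w v w (@w_b k A M) p.1 + YXmap v.+1 w v w (@w_alpha k A M) p.2) +
  iota (0 + Ymap v.+1 w v w (@w_b1 k A M) p.2) = D0 (real p)).
rewrite add0r iotaD iota_b; last by lia.
rewrite iota_alpha iota_b1 -addrA -projTF -linearD.
by [].
Qed.

Lemma real_d v w (p : frakX v w.+1) : real (dmx_beta frakX v w p) = D1 (real p).
Proof.
change (iota (Xmap v w.+1 v w (w_d T) p.1 + 0) +
  iota (0 + Ymap v w.+1 v w (w_d T) p.2) = D1 (real p)).
by rewrite add0r addr0 iota_d // iota_dY -linearD.
Qed.

Lemma real_B v w (p : frakX v w) : real (dmx_B frakX v w p) = connes (real p).
Proof.
change (iota (0 + 0 : X v.+1 w) + iota (XYmap v w v.+1 w (@w_B k A M) p.1 +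
   Ymap v w v.+1 w (@w_B k A M) p.2) = connes (real p)).
by rewrite addr0 iota0 add0r iotaD iota_BX iota_BY -linearD.
Qed.

(** In degree w there are at most w letters after x_0, hence no words with x_0 in A and
    w + 1 letters in M. *)
Lemma Y0_empty (w : nat) (u : Y 0 w) : iota u = 0.
Proof.
have := typed_Y (u : Y 0%N w); apply: typed_empty => x /word_typeP[h1 h2 h3].
case: x h1 h2 h3 => [|[a|m] s] //= h1 _ h3; first by lia.
by have := count_size isM s; lia.
Qed.

Lemma D0_X0 (w : nat) (u : X 0 w) : D0 (iota u) = 0.
Proof.
have := typed_D0 (typed_X u); apply: typed_empty => x /word_typeP[h1 h2 h3].
by have := count_size isM x; lia.
Qed.

(** The relations are the parts of b b = 0, B B = 0 and b B + B b = 0 that change the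
    number of letters in M by a given amount. *)
Lemma frakX_double_mixed : is_double_mixed frakX.
Proof.
split=> [v w p|v w p|v w p|v w p|v w p|v w p|w p]; apply: real_inj;
  rewrite ?realD !(real_b, real_d, real_B, real0).
- exact: D0_D0 (real_weight p).
- exact: D1_D1 (real_weight p).
- exact: (connes_connes (KE_subalg T hK)).
- by rewrite addrC; exact: D0_D1 (real_weight p).
- exact: D1_connes (real_weight p).
- exact: D0_connes (real_weight p).
have := D0_connes (real_weight p).
by rewrite [D0 (real p)]linearD D0_X0 Y0_empty linear0 addr0 linear0 addr0.
Qed.

(** * The maps between the two diagrams *)

Lemma typed_hat2 v w (p : hatX v w) : typed true (v%:Z - 1 + w%:Z) w%:Z (iota p.2).
Proof. exact: typed_X. Qed.

Lemma vth_pair v w (p : hatX v w) :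
  (iota (vth v w p).1 = iota p.1) * (iota (vth v w p).2 = Vop (iota p.2)).
Proof.
split.
  change (iota ((p.1 : X v w) + 0) = iota p.1); by rewrite addr0.
change (iota (0 + XYmap (v%:Z - 1) w v w (@w_vartheta k A M) p.2) = Vop (iota p.2)).
by rewrite add0r iota_vartheta.
Qed.

Lemma theta_pair v w (p : frakX v w) :
  (iota (theta v w p).1 = iota p.1 - projH true (D0 (Vop (iota p.2)))) *
  (iota (theta v w p).2 = phi (iota p.2)).
Proof.
split.
  change (iota ((p.1 : X v w) + YXmap v w v w (fun y => [:: w_t (1, y)]) p.2) =
    iota p.1 - projH true (D0 (Vop (iota p.2)))).
  by rewrite iotaD iota_t.
change (iota (0 + YXmap v w (v%:Z - 1) w (@w_theta k A M) p.2) = phi (iota p.2)).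
by rewrite add0r iota_theta.
Qed.

Lemma hat_inj v w (p q : hatX v w) : iota p.1 = iota q.1 -> iota p.2 = iota q.2 -> p = q.
Proof.
move=> h1 h2; rewrite [p]surjective_pairing [q]surjective_pairing; congr (_, _);
  exact: iota_inj.
Qed.

Lemma thetaK v w (p : hatX v w) : theta v w (vth v w p) = p.
Proof.
apply: hat_inj; rewrite theta_pair !vth_pair.
  by rewrite (Vop_Vop hK) !linear0 addr0.
exact: phi_Vop_X (typed_hat2 p).
Qed.

Lemma vth_inj v w : injective (vth v w).
Proof. exact: can_inj (@thetaK v w). Qed.

Lemma hat_b_pair v w (p : hatX v.+1 w) :
  (iota (dmx_b hatX v w p).1 = D0 (iota p.1) + projH true (D0 (Vop (iota p.2)))) *
  (iota (dmx_b hatX v w p).2 = - D0 (iota p.2)).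
Proof.
split.
  change (iota (Xmap v.+1 w v w (@w_b k A M) p.1 +
    Xmap (v.+1%:Z - 1) w v w (@w_id_t k A M) p.2) =
    D0 (iota p.1) + projH true (D0 (Vop (iota p.2)))).
  by rewrite iotaD iota_b ?iota_id_t //; lia.
change (iota (0 - Xmap (v.+1%:Z - 1) w (v%:Z - 1) w (@w_b k A M) p.2) = - D0 (iota p.2)).
by rewrite sub0r iotaN iota_b //; lia.
Qed.

Lemma hat_d_pair v w (p : hatX v w.+1) :
  (iota (dmx_beta hatX v w p).1 = D1 (iota p.1)) *
  (iota (dmx_beta hatX v w p).2 = phi (D1 (Vop (iota p.2)))).
Proof.
split.
  change (iota (Xmap v w.+1 v w (w_d T) p.1 + 0) = D1 (iota p.1)).
  by rewrite addr0 iota_d.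
change (iota (0 - Xmap (v%:Z - 1) w.+1 (v%:Z - 1) w (w_d' T) p.2) =
  phi (D1 (Vop (iota p.2)))).
by rewrite sub0r iotaN iota_d' // opprK.
Qed.

Lemma hat_B_pair v w (p : hatX v w) :
  (iota (dmx_B hatX v w p).1 = 0) *
  (iota (dmx_B hatX v w p).2 = phi (connes (iota p.1))).
Proof.
split.
  change (iota (0 + 0 : X v.+1 w) = 0); by rewrite addr0 iota0.
change (iota (Xmap v w (v.+1%:Z - 1) w (@w_N k A M) p.1 + 0) = phi (connes (iota p.1))).
by rewrite addr0 iota_N //; lia.
Qed.

Lemma vth_b v w (p : hatX v.+1 w) :
  vth v w (dmx_b hatX v w p) = dmx_b frakX v w (vth v.+1 w p).
Proof.
apply: real_inj; rewrite real_b /real !vth_pair !hat_b_pair linearD linearN.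
by rewrite -addrA -(D0_Vop_X hK (typed_hat2 p)).
Qed.

Lemma vth_d v w (p : hatX v w.+1) :
  vth v w (dmx_beta hatX v w p) = dmx_beta frakX v w (vth v w.+1 p).
Proof.
apply: real_inj; rewrite real_d /real !vth_pair !hat_d_pair linearD.
by rewrite (D1_Vop_X hK (typed_hat2 p)).
Qed.

Lemma vth_B v w (p : hatX v w) :
  vth v.+1 w (dmx_B hatX v w p) = dmx_B frakX v w (vth v w p).
Proof.
apply: real_inj; rewrite real_B /real !vth_pair !hat_B_pair linearD.
by rewrite (connes_Vop hK) addr0 add0r (connes_X (typed_X (p.1 : X v w))).
Qed.

(** The relations are inherited from frakX by the injective map vartheta, which commutes
    with the operators. *)
Lemma hatX_double_mixed : is_double_mixed hatX.
Proof.
have hF := frakX_double_mixed.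
split=> [v w p|v w p|v w p|v w p|v w p|v w p|w p]; apply: vth_inj;
  rewrite ?[vth _ _ (_ + _)]linearD !(vth_b, vth_d, vth_B) linear0.
- exact: dmixed_bb.
- exact: dmixed_betabeta.
- exact: dmixed_BB.
- exact: dmixed_betab.
- exact: dmixed_betaB.
- exact: dmixed_bB.
exact: dmixed_bB0.
Qed.

Lemma vth_morphism : is_dmixed_morphism vth.
Proof.
split; [exact: hatX_double_mixed | exact: frakX_double_mixed | | | ].
- exact: vth_b.
- exact: vth_d.
exact: vth_B.
Qed.

(** * The homotopy, and the morphism theta *)

(** The homotopy: minus vartheta on the second component of frakX. *)
Definition homot v w : {linear frakX v w -> frakX v.+1 w} :=
  block \0 \0 \0 (\- Ymap v w v.+1 w (@w_vartheta k A M)).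

Lemma real_homot v w (p : frakX v w) : real (homot v w p) = - Vop (iota p.2).
Proof.
change (iota (0 + 0 : X v.+1 w) + iota (0 - Ymap v w v.+1 w (@w_vartheta k A M) p.2) =
  - Vop (iota p.2)).
by rewrite addr0 iota0 sub0r add0r iotaN iota_varthetaY.
Qed.

(** The endomorphism vartheta theta of frakX. *)
Definition retr v w : {linear frakX v w -> frakX v w} := vth v w \o theta v w.

(** The main computation on words with x_0 in A, whose component with x_0 in M is the
    first component of theta. *)
Lemma real_retr v w (p : frakX v w) :
  real (retr v w p) - real p = - (D0 (Vop (iota p.2)) + Vop (projH false (D0 (iota p.2)))).
Proof.
change (real (vth v w (theta v w p)) - real p = - (D0 (Vop (iota p.2)) +
  Vop (projH false (D0 (iota p.2))))).
have alg (x y t f g d : amb) : d = t + (y - g - f) -> x - t + f - (x + y) = - (d + g).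
  move=> ->; have -> : t + (y - g - f) + g = t + (y - f).
    by rewrite -addrA; congr (_ + _); rewrite addrAC subrK.
  rewrite !opprD opprK addrACA [x - t]addrC addrK.
  by rewrite [f - y]addrC.
rewrite [real (vth _ _ _)]/real !vth_pair !theta_pair.
exact: (alg (iota p.1) _ _ _ _ _ (D0_Vop_Y hK (typed_Y (p.2 : Y v w)))).
Qed.

Lemma frak_b_snd v w (p : frakX v.+1 w) :
  iota (dmx_b frakX v w p).2 = projH false (D0 (iota p.2)).
Proof.
change (iota (0 + Ymap v.+1 w v w (@w_b1 k A M) p.2) = projH false (D0 (iota p.2))).
by rewrite add0r iota_b1.
Qed.

Lemma frak_d_snd v w (p : frakX v w.+1) : iota (dmx_beta frakX v w p).2 = D1 (iota p.2).
Proof.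
change (iota (0 + Ymap v w.+1 v w (w_d T) p.2) = D1 (iota p.2)).
by rewrite add0r iota_dY.
Qed.

Lemma frak_B_snd v w (p : frakX v w) : iota (dmx_B frakX v w p).2 = connes (real p).
Proof.
change (iota (XYmap v w v.+1 w (@w_B k A M) p.1 +
   Ymap v w v.+1 w (@w_B k A M) p.2) = connes (real p)).
by rewrite iotaD iota_BX iota_BY -linearD.
Qed.

Lemma homotopy_b v w (p : frakX v.+1 w) : retr v.+1 w p - p =
  dmx_b frakX v.+1 w (homot v.+1 w p) + homot v w (dmx_b frakX v w p).
Proof.
apply: real_inj; rewrite realD realN real_retr realD real_b !real_homot frak_b_snd.
by rewrite linearN opprD.
Qed.

Lemma homotopy_b0 w (p : frakX 0 w) : retr 0 w p - p = dmx_b frakX 0 w (homot 0 w p).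
Proof.
apply: real_inj; rewrite realD realN real_retr real_b !real_homot Y0_empty.
by rewrite !(linear0, addr0, oppr0).
Qed.

Lemma homotopy_d v w (p : frakX v w.+1) :
  dmx_beta frakX v.+1 w (homot v w.+1 p) + homot v w (dmx_beta frakX v w p) = 0.
Proof.
apply: real_inj; rewrite realD real_d !real_homot frak_d_snd real0 linearN.
by rewrite (D1_Vop_Y hK (typed_Y (p.2 : Y v w.+1))) opprK subrr.
Qed.

Lemma homotopy_hB v w (p : frakX v w) : homot v.+1 w (dmx_B frakX v w p) = 0.
Proof.
by apply: real_inj; rewrite real_homot frak_B_snd (Vop_connes hK) real0 oppr0.
Qed.

Lemma homotopy_Bh v w (p : frakX v w) : dmx_B frakX v.+1 w (homot v w p) = 0.
Proof.
by apply: real_inj; rewrite real_B real_homot linearN (connes_Vop hK) real0 oppr0.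
Qed.

(** The relations of frakX, and the one of the homotopy with d, as rewriting rules. *)
Lemma frak_bD v w (p q : frakX v.+1 w) :
  dmx_b frakX v w (p + q) = dmx_b frakX v w p + dmx_b frakX v w q.
Proof. exact: linearD. Qed.
Lemma frak_dD v w (p q : frakX v w.+1) :
  dmx_beta frakX v w (p + q) = dmx_beta frakX v w p + dmx_beta frakX v w q.
Proof. exact: linearD. Qed.
Lemma frak_BD v w (p q : frakX v w) :
  dmx_B frakX v w (p + q) = dmx_B frakX v w p + dmx_B frakX v w q.
Proof. exact: linearD. Qed.
Lemma homotN v w (p : frakX v w) : homot v w (- p) = - homot v w p.
Proof. exact: linearN. Qed.
Lemma homot0 v w : homot v w 0 = 0.
Proof. exact: linear0. Qed.
Lemma frak_bN v w (p : frakX v.+1 w) : dmx_b frakX v w (- p) = - dmx_b frakX v w p.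
Proof. exact: linearN. Qed.

Lemma frak_b0 v w : dmx_b frakX v w 0 = 0.
Proof. exact: linear0. Qed.
Lemma frak_bb v w (q : frakX v.+2 w) : dmx_b frakX v w (dmx_b frakX v.+1 w q) = 0.
Proof. exact: (dmixed_bb frakX_double_mixed). Qed.
Lemma frak_db v w (q : frakX v.+1 w.+1) : dmx_beta frakX v w (dmx_b frakX v w.+1 q) =
  - dmx_b frakX v w (dmx_beta frakX v.+1 w q).
Proof. by apply/eqP; rewrite -addr_eq0; apply/eqP; exact: (dmixed_betab frakX_double_mixed). Qed.
Lemma frak_bB v w (q : frakX v.+1 w) : dmx_b frakX v.+1 w (dmx_B frakX v.+1 w q) =
  - dmx_B frakX v w (dmx_b frakX v w q).
Proof. by apply/eqP; rewrite -addr_eq0; apply/eqP; exact: (dmixed_bB frakX_double_mixed). Qed.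
Lemma frak_bB0 w (q : frakX 0 w) : dmx_b frakX 0 w (dmx_B frakX 0 w q) = 0.
Proof. exact: (dmixed_bB0 frakX_double_mixed). Qed.
Lemma frak_dh v w (q : frakX v w.+1) : dmx_beta frakX v.+1 w (homot v w.+1 q) =
  - homot v w (dmx_beta frakX v w q).
Proof. by apply/eqP; rewrite -addr_eq0; apply/eqP; exact: homotopy_d. Qed.
Lemma retr_b v w (p : frakX v.+1 w) :
  retr v w (dmx_b frakX v w p) = dmx_b frakX v w (retr v.+1 w p).
Proof.
rewrite -(subrKC p (retr v.+1 w p)) frak_bD homotopy_b frak_bD frak_bb add0r.
apply/eqP; rewrite addrC -subr_eq; apply/eqP.
case: v p => [|v] p; first exact: homotopy_b0.
by rewrite homotopy_b frak_bb homot0 addr0.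
Qed.

Lemma retr_d v w (p : frakX v w.+1) :
  retr v w (dmx_beta frakX v w p) = dmx_beta frakX v w (retr v w.+1 p).
Proof.
rewrite -(subrKC p (retr v w.+1 p)) frak_dD.
apply/eqP; rewrite addrC -subr_eq; apply/eqP.
case: v p => [|v] p; first by rewrite !homotopy_b0 frak_db frak_dh frak_bN opprK.
by rewrite !homotopy_b frak_dD !frak_db !frak_dh frak_db frak_bN homotN !opprK.
Qed.

Lemma retr_B v w (p : frakX v w) :
  retr v.+1 w (dmx_B frakX v w p) = dmx_B frakX v w (retr v w p).
Proof.
have -> : retr v.+1 w (dmx_B frakX v w p) = dmx_B frakX v w p.
  rewrite -(subrKC (dmx_B frakX v w p) (retr _ _ _)) homotopy_b homotopy_hB frak_b0 add0r.
  rewrite -[RHS]addr0; congr (_ + _); case: v p => [|v] p; first by rewrite frak_bB0 homot0.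
  by rewrite frak_bB homotN homotopy_hB oppr0.
have Bbh q : dmx_B frakX v w (dmx_b frakX v w (homot v w q)) = 0.
  by apply/eqP; rewrite -oppr_eq0 -frak_bB homotopy_Bh frak_b0.
rewrite -(subrKC p (retr v w p)) frak_BD.
case: v p Bbh => [|v] p Bbh; first by rewrite homotopy_b0 Bbh addr0.
by rewrite homotopy_b frak_BD Bbh homotopy_Bh !addr0.
Qed.

Lemma retrE v w (p : frakX v w) : retr v w p = vth v w (theta v w p).
Proof. by []. Qed.

(** Since vartheta is an injective morphism, it is enough that the composite of theta
    and vartheta is a morphism. It differs from the identity by b h + h b, where the
    homotopy h anticommutes with d, and h B = B h = 0. *)
Lemma theta_morphism : is_dmixed_morphism theta.
Proof.
split; [exact: frakX_double_mixed | exact: hatX_double_mixed | | | ] => v w p;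
  apply: vth_inj.
- by have := retr_b p; rewrite !retrE vth_b.
- by have := retr_d p; rewrite !retrE vth_d.
by have := retr_B p; rewrite !retrE vth_B.
Qed.

Lemma frakX_homotopy : homotopic (X := tot_mixed frakX) (Y := tot_mixed frakX)
  (fun n x => tot_map vth n (tot_map theta n x)) (fun n x => x).
Proof.
have [h [h0 hS]] := @tot_homotopy k frakX retr homot (fun v w p => homotopy_b p)
  (fun w p => homotopy_b0 p) (fun v w p => homotopy_d p).
have e n x : tot_map retr n x = tot_map vth n (tot_map theta n x).
  by apply: tot_ext => v w; rewrite !tot_map_at.
by exists h; split=> [x|n x]; rewrite -e; [exact: h0 | exact: hS].
Qed.

Lemma hat_same_homologies : same_homologies (tot_mixed hatX) (tot_mixed frakX).
Proof.
apply: (@same_homologies_retract k (tot_mixed hatX) (tot_mixed frakX)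
  (tot_is_mixed frakX_double_mixed) (tot_map theta) (tot_map vth)).
- exact: tot_map_b theta_morphism.
- exact: tot_map_B theta_morphism.
- exact: tot_map_b vth_morphism.
- exact: tot_map_B vth_morphism.
- by move=> n x; apply: tot_ext => v w; rewrite !tot_map_at thetaK.
exact: frakX_homotopy.
Qed.

End Diagrams.

Section Relative.
Variables (k : comNzRingType) (A : algType k) (M : bimodule A).
Variables (T : bimodule_product M) (K : {pred A}).
Hypothesis hK : GRing.subalg_closed K.

Notation KE := (@K_in_E k A M T K).
Notation amb := (amb KE).
Notation cl := (cl KE).
Notation W := (@W k A M T K).
Notation z0 := (z0 M).
Notation isM := (@isM k A M).
Notation hoch := (@hoch k _ KE).
Notation connes := (@connes k _ KE).
Notation D0 := (@D0 k A M T K).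
Notation D1 := (@D1 k A M T K).
Notation term := (@term k A M T K).
Notation projC := (@projC k A M T K).
Notation projH := (@projH k A M T K).
Notation projW := (@projW k A M T K).
Notation wtensor := (@wtensor k A M T K).
Notation typed := (@typed k A M T K).
Notation iota_TB := (@iota_TB k A M T K _ _ _).
Notation X := (@X k A M T K).
Notation Y := (@Y k A M T K).
Notation iota := iota_TB.
Notation frakX := (@frakX k A M T K).
Notation real := (@real k A M T K).
Notation CE := (@CE k A M T K).
Notation CA := (@CA k A K).
Notation E := (E_algebra T).
Notation EA := (@E_to_A k A M T K).
Notation Rel := (@relative_mixed k A M T K).
Notation XiE_ n := (@Xi k _ KE n).
Notation PiE_ n := (@Pi k _ KE n).
Notation Tot := (tot_mixed frakX).

(** * Comparison with the relative mixed complex *)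

Lemma fst_normalized n : @normalized k (ring_letters KE) _
  (fun s : seq E => tensor K n [seq e.1 | e <- s]).
Proof.
have [[hD hZ hB ht ht1] hk] := tensor_normalized K n.
split; first split.
- by move=> s x y z t ->; rewrite !map_cat; apply: hD.
- by move=> s c x t; rewrite !map_cat; apply: hZ.
- by move=> s x l y t /andP[hl _]; rewrite !map_cat; apply: hB.
- by move=> s x l y /andP[hl _]; rewrite /= !map_rcons; apply: ht.
- by move=> x l /andP[hl _]; apply: ht1.
by move=> x s l t /andP[hl _]; rewrite /= map_cat; apply: hk.
Qed.

Lemma E_to_A_tensor n (s : seq E) : size s = n.+1 ->
  EA n (tensor KE n s) = tensor K n [seq e.1 | e <- s].
Proof.
move: s; apply: (the_linearP (P := fun f : {linear CE n -> CA n} =>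
  forall s : seq E, size s = n.+1 -> f (tensor KE n s) = tensor K n [seq e.1 | e <- s])).
exact: tensor_lift (fst_normalized n).
Qed.

(** The inclusion of A in E. *)
Definition inA (a : A) : E := (a, 0).

Lemma inA_normalized n : @normalized k (ring_letters K) _
  (fun s : seq A => tensor KE n (map inA s)).
Proof.
have inD a b : inA (a + b) = inA a + inA b by congr (_, _); rewrite /= addr0.
have inZ c a : inA (c *: a) = c *: inA a by congr (_, _); rewrite /= scaler0.
have inM a b : inA (a * b) = inA a * inA b.
  by rewrite [RHS]extM /= lact0 ract0l tri0 !addr0.
have inK a : a \in K -> inA a \in KE by move=> h; rewrite unfold_in /= h eqxx.
have [[hD hZ hB ht ht1] hk] := tensor_normalized KE n.
split; first split.
- by move=> s x y z t ->; rewrite !map_cat; apply: hD; exact: inD.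
- by move=> s c x t; rewrite !map_cat /= inZ; apply: hZ.
- by move=> s x l y t hl; rewrite !map_cat /= !inM; apply: hB; exact: inK.
- by move=> s x l y hl; rewrite /= !map_rcons !inM; apply: ht; exact: inK.
- by move=> x l hl; rewrite /= !inM; apply: ht1; exact: inK.
by move=> x s l t hl; rewrite /= map_cat; apply: hk; exact: inK.
Qed.

Lemma tensor_zero n (s t : seq A) : tensor K n (s ++ 0 :: t) = 0.
Proof.
have h := norm_cyclic (tensor_normalized K n).
apply: (@addrI _ (tensor K n (s ++ 0 :: t))); rewrite addr0.
by apply: esym; apply: (@cyc_add k (ring_letters K) _ _ h); rewrite /= addr0.
Qed.

(** A linear map on the tensors of E of degree n is determined by its values on
    words. *)
Lemma tensor_words n (V : lmodType k) (f g : {linear CE n -> V}) :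
  (forall x, size x = n.+1 -> f (wtensor n x) = g (wtensor n x)) -> forall u, f u = g u.
Proof.
move=> fg; apply: tensor_ext => s hs; rewrite -PiE cl_words /expand_sum linear_sum.
rewrite !linear_sum big_seq [RHS]big_seq; apply: eq_bigr => x xs.
by rewrite /= PiE; apply: fg; rewrite (size_expand xs).
Qed.

(** The projection to the tensors of A, followed by the inclusion of these, is the
    projection on the words without letters in M. *)
Lemma E_to_A_kernel n u : (EA n u == 0) = (projC 0 (XiE_ n u) == 0).
Proof.
have [j hj] := tensor_lift n (inA_normalized n).
have jK v : EA n (j v) = v.
  pose f : {linear CA n -> CA n} := (EA n \o j : {linear _ -> _}).
  rewrite -[LHS]/(f v) -[RHS]/((idfun : {linear CA n -> CA n}) v); apply: tensor_ext => s hs.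
  by rewrite /f /= hj // E_to_A_tensor ?size_map // -map_comp map_id.
have jE : XiE_ n (j (EA n u)) = projC 0 (XiE_ n u).
  pose f : {linear CE n -> amb} := (XiE_ n \o (j \o EA n) : {linear _ -> _}).
  pose g : {linear CE n -> amb} := (projC 0 \o XiE_ n : {linear _ -> _}).
  rewrite -[LHS]/(f u) -[RHS]/(g u); apply: tensor_words => x hx.
  rewrite /f /g /= E_to_A_tensor ?size_map // XiE ?size_map // -map_comp.
  rewrite -[cl _]/(W x) projCE; case: (boolP (has isM x)) => hM.
    rewrite ifF; last by move: hM; rewrite has_count; case: (count _ _).
    have [y [m [t [-> _]]]] := last_M hM.
    by rewrite map_cat /= tensor_zero !linear0.
  rewrite ifT; last by move: hM; rewrite has_count -leqNgt leqn0.
  rewrite hj ?size_map // XiE ?size_map //; congr (cl _).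
  rewrite -!map_comp; apply/eq_in_map => -[a|m] hx' //=.
  by case/hasP: hM; exists (inr m).
apply/eqP/eqP => h; first by rewrite -jE h !linear0.
by rewrite -[LHS]jK; have -> : j (EA n u) = 0;
  [apply: (@Xi_inj k _ KE n); rewrite jE h linear0 | rewrite linear0].
Qed.

Lemma rel_kernel n (u : Rel n) : projC 0 (XiE_ n (val u)) = 0.
Proof. by apply/eqP; rewrite -E_to_A_kernel; exact: (valP u). Qed.

(** A contraction of two letters only one of which is in M is 0 for the product of M. *)
Lemma D1_weight1 u : D1 (projC 1 u) = 0.
Proof.
pose f : {linear amb -> amb} := (D1 \o projC 1 : {linear _ -> _}).
rewrite -[LHS]/(f u) -[RHS]/((\0 : {linear amb -> amb}) u); apply: word_ext => x.
rewrite /f /= projCE; case: eqP => [c1|_]; last exact: linear0.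
rewrite D1_W; case: ifP => // x1; rewrite big_nat big1 // => j /andP[_ jx].
rewrite /term W_null ?scaler0 //; case: (contract_spec z0 x1 jx).
  move=> [y [a [b [v [xE _ cE]]]]]; rewrite cE; rewrite xE count_cat /= in c1.
  by case: a b c1 {xE cE} => [a|m] [b|m'] /= c1; try (by exists y, v); lia.
move=> [y [a [b [xE _ cE]]]]; rewrite cE; rewrite xE /= -cats1 count_cat /= in c1.
by case: a b c1 {xE cE} => [a|m] [b|m'] /= c1; try (by exists [::], y); lia.
Qed.

Lemma rel_bE n (u : Rel n.+1) : val (mcx_b Rel n u) = hoch_b KE n (val u).
Proof.
move: u; apply: (the_linearP (P := fun f : {linear Rel n.+1 -> Rel n} =>
  forall u, val (f u) = hoch_b KE n (val u))).
have hk (u : Rel n.+1) : hoch_b KE n (val u) \in kerl (EA n).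
  rewrite unfold_in E_to_A_kernel Xi_hoch_b hochE_split linearD projC_D0 projC_D1.
  by rewrite rel_kernel D1_weight1 linear0 addr0.
have lf : linear (fun u : Rel n.+1 => Defs.Sub (hk u) : Rel n).
  by move=> a u v; apply/val_inj; rewrite /= !linearP.
by exists (mklin lf).
Qed.

Lemma rel_BE n (u : Rel n) : val (mcx_B Rel n u) = connes_B KE n (val u).
Proof.
move: u; apply: (the_linearP (P := fun f : {linear Rel n -> Rel n.+1} =>
  forall u, val (f u) = connes_B KE n (val u))).
have hk (u : Rel n) : connes_B KE n (val u) \in kerl (EA n.+1).
  by rewrite unfold_in E_to_A_kernel Xi_connes_B projC_connes rel_kernel linear0.
have lf : linear (fun u : Rel n => Defs.Sub (hk u) : Rel n.+1).
  by move=> a u v; apply/val_inj; rewrite /= !linearP.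
by exists (mklin lf).
Qed.

(** The embedding of the relative complex in the ambient module. *)
Definition rho n (u : Rel n) : amb := XiE_ n (val u).

Lemma rho_inj n : injective (@rho n).
Proof. by move=> u v /Xi_inj /val_inj. Qed.
Lemma rho_linear n : linear (@rho n).
Proof. by move=> a u v; rewrite /rho -linearP. Qed.
Lemma rhoD n (u v : Rel n) : rho (u + v) = rho u + rho v.
Proof. by rewrite /rho -linearD. Qed.
Lemma rho0 n : rho (0 : Rel n) = 0. Proof. exact: linear0. Qed.
Lemma rho_b n (u : Rel n.+1) : rho (mcx_b Rel n u) = hoch (rho u).
Proof. by rewrite /rho rel_bE Xi_hoch_b. Qed.
Lemma rho_B n (u : Rel n) : rho (mcx_B Rel n u) = connes (rho u).
Proof. by rewrite /rho rel_BE Xi_connes_B. Qed.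

Lemma rel_is_mixed : is_mixed Rel.
Proof.
split=> [n u|n u|n u|u]; apply: rho_inj; rewrite ?rhoD !(rho_b, rho_B, rho0).
- exact: hoch_hoch.
- exact: (connes_connes (KE_subalg T hK)).
- exact: hoch_connes.
have := hoch_connes (rho u); suff -> : hoch (rho u) = 0 by rewrite linear0 addr0.
rewrite /rho; move: (val u); apply: (@tensor_words 0 amb (hoch \o XiE_ 0 : {linear _ -> _}) \0).
by move=> x hx /=; rewrite XiE ?size_map // -[cl _]/(W x) hoch_W hx.
Qed.

(** * The relative complex as a total complex *)

Lemma XiPi c n w m u : sound c n -> `|n|%N = m -> typed c n w u -> XiE_ m (PiE_ m u) = u.
Proof. by move=> hs <-; exact: typed_Xi. Qed.

Lemma XiPi_real n v w (p : frakX v w) : (v + w)%N = n -> XiE_ n (PiE_ n (real p)) = real p.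
Proof.
move=> <-; rewrite !linearD; congr (_ + _).
  by apply: (XiPi _ _ (typed_X (p.1 : X v w))) => //; lia.
by apply: (XiPi _ _ (typed_Y (p.2 : Y v w))) => //=; lia.
Qed.

(** The component of bidegree (v, w) of a chain of the total complex, and the
    chain itself, seen in the ambient module. *)
Definition rf n (f : Tot n) v w : amb := real (val f (v, w)).
Definition realT n (f : Tot n) : amb := \sum_(0 <= w < n.+1) rf f (n - w) w.

Lemma rf_weight n (f : Tot n) v w c : projC c (rf f v w) = if c == w.+1 then rf f v w else 0.
Proof.
case: eqP => [->|hc]; first exact: real_weight.
by apply: (projC_other (real_weight _)); apply/eqP => e; apply: hc.
Qed.

Lemma rf_b n (f : Tot n.+1) v w :
  rf (mcx_b Tot n f) v w = D0 (rf f v.+1 w) + D1 (rf f v w.+1).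
Proof. by rewrite /rf tot_b_at realD real_b real_d. Qed.

Lemma rf_B n (f : Tot n) v w : rf (mcx_B Tot n f) v.+1 w = connes (rf f v w).
Proof. by rewrite /rf tot_B_at real_B. Qed.

Lemma rf_B0 n (f : Tot n) w : rf (mcx_B Tot n f) 0 w = 0.
Proof. by rewrite /rf tot_B_at0 real0. Qed.

Lemma D0_rf0 n (f : Tot n) w : D0 (rf f 0 w) = 0.
Proof.
by rewrite /rf [D0 _]linearD D0_X0 Y0_empty linear0 addr0.
Qed.

Lemma D1_rf0 n (f : Tot n) v : D1 (rf f v 0) = 0.
Proof. by rewrite /rf -[X in D1 X](real_weight (val f (v, 0%N))) D1_weight1. Qed.

(** The terms of the boundary in which the bidegree leaves the first quadrant are 0:
    D0 on bidegrees (0, w) and D1 on bidegrees (v, 0). *)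
Lemma realT_b n (f : Tot n.+1) : realT (mcx_b Tot n f) = hoch (realT f).
Proof.
rewrite hochE_split /realT; under eq_bigr do rewrite rf_b.
rewrite big_split; congr (_ + _); rewrite linear_sum.
  rewrite [RHS]big_nat_recr //= subnn D0_rf0 addr0.
  by apply: eq_big_nat => w /andP[_ hw]; rewrite subSn.
by rewrite [RHS]big_nat_recl //= D1_rf0 add0r.
Qed.

Lemma realT_B n (f : Tot n) : realT (mcx_B Tot n f) = connes (realT f).
Proof.
rewrite /realT linear_sum big_nat_recr //= subnn rf_B0 addr0.
by apply: eq_big_nat => w /andP[_ hw]; rewrite subSn // rf_B.
Qed.

Lemma realT_weight n (f : Tot n) w : projC w.+1 (realT f) = if (w < n.+1)%N then rf f (n - w) w else 0.
Proof.
rewrite /realT linear_sum; under eq_bigr do rewrite rf_weight eqSS.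
case: ifP => hw; last first.
  rewrite big_nat big1 // => i /andP[_ hi]; case: eqP => // e.
  by rewrite e hi in hw.
rewrite (bigD1_seq w) ?mem_index_iota ?iota_uniq //= eqxx.
by rewrite big1 ?addr0 // => i /negbTE hi; rewrite eq_sym hi.
Qed.

Lemma realT_inj n : injective (@realT n).
Proof.
move=> f g e; apply: tot_ext => v w.
have [h|h] := boolP (tot_degree n (v, w)); last by rewrite !suppP.
have hv : v = (n - w)%N by move/eqP: h => /= <-; rewrite addnK.
have hw : (w < n.+1)%N by move/eqP: h => /= <-; rewrite ltnS leq_addl.
apply: real_inj; rewrite -[LHS]/(rf f v w) -[RHS]/(rf g v w) hv.
by have := realT_weight f w; rewrite e realT_weight hw.
Qed.

Lemma realT_linear n : linear (@realT n).
Proof.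
move=> a f g; rewrite /realT scaler_sumr -big_split /=; apply: eq_bigr => w _.
rewrite /rf; have -> : val (a *: f + g) (n - w, w)%N =
  a *: (val f (n - w, w)%N : frakX (n - w)%N w) + val g (n - w, w)%N by [].
exact: real_linear.
Qed.

Lemma XiPi_realT n (f : Tot n) : XiE_ n (PiE_ n (realT f)) = realT f.
Proof.
rewrite /realT !linear_sum; apply: eq_big_nat => w /andP[_ hw].
by rewrite XiPi_real // subnK.
Qed.

Lemma realT_rho n (f : Tot n) : exists u : Rel n, rho u = realT f.
Proof.
have hk : PiE_ n (realT f) \in kerl (EA n).
  rewrite unfold_in E_to_A_kernel XiPi_realT /realT linear_sum big1 // => w _.
  by rewrite rf_weight.
by exists (Defs.Sub hk); exact: XiPi_realT.
Qed.

(** The part of a tensor of degree n with w + 1 factors in M is the image of an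
    element of bidegree (n - w, w): split it according to the type of x_0. *)
Lemma weight_real n v w (u : CE n) : (v + w)%N = n ->
  exists p : frakX v w, real p = projC w.+1 (XiE_ n u).
Proof.
move=> hn.
have hsplit b : typed b n%:Z (w.+1%:Z - Posz b) (projH b (projC w.+1 (XiE_ n u))).
  pose f : {linear CE n -> amb} := (projH b \o (projC w.+1 \o XiE_ n) : {linear _ -> _}).
  pose g : {linear CE n -> amb} :=
    (projW (itype b n%:Z (w.+1%:Z - Posz b)) \o f : {linear _ -> _}).
  rewrite /typed -[LHS]/(g u) -[RHS]/(f u); apply: tensor_words => x hx.
  change (typed b n%:Z (w.+1%:Z - Posz b) (projH b (projC w.+1 (XiE_ n (wtensor n x))))).
  rewrite XiE ?size_map // -[cl _]/(W x) projCE.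
  case: eqP => hc; last by rewrite linear0; exact: typed0.
  rewrite projHE; case: eqP => hh; last exact: typed0.
  by apply: typed_W; apply/word_typeP; split=> //; lia.
have [x hx] : exists x : X v w, iota x = projH true (projC w.+1 (XiE_ n u)).
  by apply: iota_surj => //; apply: typed_eq (hsplit true); lia.
have [y hy] : exists y : Y v w, iota y = projH false (projC w.+1 (XiE_ n u)).
  by apply: iota_surj => //; apply: typed_eq (hsplit false); lia.
by exists (x, y); rewrite /real hx hy -projTF.
Qed.

(** A tensor of degree n that is 0 in the tensors of A is the sum of its parts with 1,
    ..., n + 1 factors in M. *)
Lemma weight_sum n (u : CE n) : projC 0 (XiE_ n u) = 0 ->
  XiE_ n u = \sum_(0 <= w < n.+1) projC w.+1 (XiE_ n u).
Proof.
move=> h0; have : XiE_ n u = \sum_(0 <= w < n.+2) projC w (XiE_ n u).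
  have lf : linear (fun u => \sum_(0 <= w < n.+2) projC w (XiE_ n u)).
    move=> a x y; rewrite scaler_sumr -big_split; apply: eq_bigr => w _.
    by rewrite /= !linearP.
  move: u {h0}; apply: (tensor_words (f := XiE_ n) (g := mklin lf)) => x hx.
  change (XiE_ n (wtensor n x) = \sum_(0 <= w < n.+2) projC w (XiE_ n (wtensor n x))).
  rewrite XiE ?size_map // -[cl _]/(W x); under eq_bigr do rewrite projCE.
  rewrite (bigD1_seq (count isM x)) ?iota_uniq //=; last first.
    by rewrite mem_index_iota /= ltnS -hx count_size.
  by rewrite eqxx big1 ?addr0 // => i /negbTE hi; rewrite eq_sym hi.
by rewrite big_nat_recl // h0 add0r.
Qed.

Lemma realT_surj n (u : Rel n) : exists f : Tot n, realT f = rho u.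
Proof.
have hp w : exists p : frakX (n - w)%N w, (w < n.+1)%N -> real p = projC w.+1 (rho u).
  case: (ltnP w n.+1) => hw; last by exists 0.
  by have [p hp] := weight_real (val u) (subnK (hw : (w <= n)%N)); exists p.
have [p hpE] : exists p : forall w, frakX (n - w)%N w,
    forall w, (w < n.+1)%N -> real (p w) = projC w.+1 (rho u).
  by exists (fun w => projT1 (cid (hp w))) => w; exact: (projT2 (cid (hp w))).
(* the family p on the diagonal q.1 + q.2 = n, extended by 0 *)
pose g : prodm (dmx_pair frakX) := fun q =>
  if eqVneq q.1 (n - q.2)%N is EqNotNeq e then
    eq_rect_r (fun v => frakX v q.2 : Type) (p q.2) e else 0.
have gE w : g (n - w, w)%N = p w.
  rewrite /g /=; case: eqVneq => [e|/eqP//].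
  by rewrite (eq_irrelevance e (erefl _)).
exists (Defs.Sub (cut_supp (X := dmx_pair frakX) (tot_degree n) g)).
rewrite [RHS](weight_sum (rel_kernel u)); apply: eq_big_nat => w /andP[_ hw].
rewrite /rf /= /cut ifT; last by rewrite /tot_degree /= subnK.
by rewrite gE hpE.
Qed.

(** The isomorphism between the total complex of frakX and the relative complex. *)
Lemma realT_iso n : exists F : {linear Tot n -> Rel n}, exists G : {linear Rel n -> Tot n},
  [/\ forall f, rho (F f) = realT f, forall u, realT (G u) = rho u,
      cancel F G & cancel G F].
Proof.
have [F hF] : exists F : Tot n -> Rel n, forall f, rho (F f) = realT f.
  by exists (fun f => projT1 (cid (realT_rho f))) => f; exact: (projT2 (cid (realT_rho f))).
have [G hG] : exists G : Rel n -> Tot n, forall u, realT (G u) = rho u.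
  by exists (fun u => projT1 (cid (realT_surj u))) => u; exact: (projT2 (cid (realT_surj u))).
have lF : linear F.
  by move=> a f g; apply: rho_inj; rewrite hF realT_linear rho_linear !hF.
have lG : linear G.
  by move=> a u v; apply: realT_inj; rewrite hG realT_linear rho_linear !hG.
exists (mklin lF), (mklin lG); split=> // [f|u].
  by apply: realT_inj; rewrite hG hF.
by apply: rho_inj; rewrite hF hG.
Qed.

Lemma frakX_same_homologies : same_homologies Tot Rel.
Proof.
have hiso n := cid (realT_iso n).
have [F hF] : {F : forall n, {linear Tot n -> Rel n} | forall n,
  exists G : {linear Rel n -> Tot n}, [/\ forall f, rho (F n f) = realT f,
      forall u, realT (G u) = rho u, cancel (F n) G & cancel G (F n)]}.
  by exists (fun n => projT1 (hiso n)) => n; exact: (projT2 (hiso n)).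
have [G hG] : {G : forall n, {linear Rel n -> Tot n} | forall n,
  [/\ forall f, rho (F n f) = realT f,
      forall u, realT (G n u) = rho u, cancel (F n) (G n) & cancel (G n) (F n)]}.
  by exists (fun n => projT1 (cid (hF n))) => n; exact: (projT2 (cid (hF n))).
have Fb n f : F n (mcx_b Tot n f) = mcx_b Rel n (F n.+1 f).
  have [h _ _ _] := hG n; have [h' _ _ _] := hG n.+1.
  by apply: rho_inj; rewrite h realT_b rho_b h'.
have FB n f : F n.+1 (mcx_B Tot n f) = mcx_B Rel n (F n f).
  have [h _ _ _] := hG n; have [h' _ _ _] := hG n.+1.
  by apply: rho_inj; rewrite h' realT_B rho_B h.
have FK n : cancel (F n) (G n) by case: (hG n).
have GK n : cancel (G n) (F n) by case: (hG n).
refine (@same_homologies_retract k Tot Rel rel_is_mixed G F _ _ _ _ _ _) => //.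
- by move=> n u; apply: (can_inj (FK n)); rewrite GK Fb GK.
- by move=> n u; apply: (can_inj (FK n.+1)); rewrite GK FB GK.
exists (fun n => \0); split=> [x|n x]; rewrite GK subrr.
  by rewrite [RHS]linear0.
by rewrite [mcx_b Rel _ _]linear0 addr0.
Qed.

Lemma same_homologies_trans (X1 X2 X3 : mixed k) :
  same_homologies X1 X2 -> same_homologies X2 X3 -> same_homologies X1 X3.
Proof.
move=> [h1 h2 h3 h4] [g1 g2 g3 g4]; split=> n; apply: lmod_iso_trans; eauto.
Qed.

End Relative.

Theorem theorem2p2 (k : comNzRingType) (iota : {rmorphism rat -> k})
    (A : algType k) (M : bimodule A) (T : bimodule_product M)
    (K : {pred A}) (hK : GRing.subalg_closed K) :
  is_double_mixed (hatX T K) /\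
  [/\ is_dmixed_morphism (hat_vartheta T K),
      is_dmixed_morphism (hat_theta T K),
      forall (v w : nat) (x : hatX T K v w),
        hat_theta T K v w (hat_vartheta T K v w x) = x
    & homotopic (X := tot_mixed (frakX T K)) (Y := tot_mixed (frakX T K))
        (fun n x => tot_map (hat_vartheta T K) n (tot_map (hat_theta T K) n x))
        (fun n x => x)] /\
  same_homologies (tot_mixed (hatX T K)) (relative_mixed T K).
Proof.
split; first exact: hatX_double_mixed.
split; first split.
- exact: vth_morphism.
- exact: theta_morphism.
- by move=> v w x; exact: thetaK.
- exact: frakX_homotopy.
exact: same_homologies_trans (hat_same_homologies T hK) (frakX_same_homologies T hK).
Qed.
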